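(* For each $a\in(0,1)$ there is a constant $0<C_a<\infty$ (depending only on $a$) such that, for every integer $N\ge 2$, every $\beta>0$, and every $0\le i<N$, under the particle-Palm law of the periodic Riesz gas with parameters $(a,N,\beta)$, $$\mathbb E\,Y_i=i,\qquad \mathbb E|Y_i-i|^2\le \frac{C_a}{\beta}.$$ Moreover, setting $\sigma=(C_a/\beta)^{1/2}$ and $\kappa=\log(3)/4$, for every $t\ge 0$, $$\mathbb P(|Y_i-i|>t)\le 2e^{-\kappa t/\sigma},\qquad \mathbb E\, e^{\kappa|Y_i-i|/(2\sigma)}\le 3.$$
   Context: For $a\in(0,1)$ and an integer $N\ge1$, define the $N$-periodic, even, continuous, zero-mean kernel $$g_N(r)=c_aN^a\sum_{k\in\mathbb Z\setminus\{0\}}\frac{e^{2\pi i k r/N}}{|k|^{1+a}},\qquad c_a=\frac{2\Gamma(1+a)\sin(\pi a/2)}{(2\pi)^{1+a}}.$$ The periodic Riesz gas at inverse temperature $\beta>0$ is the law of $N$ labeled points on the circle $\mathbb T_N=\mathbb R/(N\mathbb Z)$ with density proportional to $\exp\{-\beta\sum_{1\le i<j\le N}g_N(x_i-x_j)\}$ with respect to $\prod_i dx_i$. The particle-Palm law is obtained by choosing one of the $N$ particles uniformly, translating it to the origin, and ordering the particles cyclically as $0=Y_0<Y_1<\cdots<Y_{N-1}<N$. Explicitly, $(Y_1,\dots,Y_{N-1})$ has density proportional to $e^{-\beta H_N(Y)}$ with respect to Lebesgue measure on the simplex $\{0<Y_1<\cdots<Y_{N-1}<N\}$, where $Y_0=0$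 and $$H_N(Y)=\sum_{0\le i<j<N}g_N(Y_j-Y_i).$$ *)

(* Defs.v *)
From HB Require Import structures.
From mathcomp Require Import all_boot all_order all_algebra.
From mathcomp Require Import complex.
From mathcomp Require Import all_classical all_reals all_analysis.
From mathcomp Require Import measurable_realfun.

Set Implicit Arguments.
Unset Strict Implicit.
Unset Printing Implicit Defensive.

Import Order.TTheory GRing.Theory Num.Theory.
Import numFieldNormedType.Exports.

Local Open Scope classical_set_scope.
Local Open Scope ring_scope.

Section lebesgue_tuple.
Context {R : realType}.

(* [lebesgue_measure] lives on [measurableTypeR R], which is [R] with the Borel
   sigma-algebra but is not unified with the canonical measurable structure of
   [R]; hence R^n is [n.-tuple (measurableTypeR R)]. *)
Definition tuple_cons n (p : n.-tuple (measurableTypeR R) * measurableTypeR R) :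
    n.+1.-tuple (measurableTypeR R) :=
  [tuple of p.2 :: p.1].

Lemma measurable_tuple_cons n : measurable_fun setT (@tuple_cons n).
Proof. exact: measurable_cons. Qed.

Definition lebesgue_cons n
    (m : {measure set (n.-tuple (measurableTypeR R)) -> \bar R}) :
    set (n.+1.-tuple (measurableTypeR R)) -> \bar R :=
  pushforward (m \x (@lebesgue_measure R))%E (@tuple_cons n).

Section measure.
Variables (n : nat) (m : {measure set (n.-tuple (measurableTypeR R)) -> \bar R}).

Let cons0 : lebesgue_cons m set0 = 0%E.
Proof. by rewrite /lebesgue_cons /pushforward preimage_set0 measure0. Qed.

Let cons_ge0 A : (0 <= lebesgue_cons m A)%E.
Proof. by rewrite /lebesgue_cons /pushforward; apply: measure_ge0. Qed.

Let cons_sigma_additive : semi_sigma_additive (lebesgue_cons m).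
Proof.
move=> F mF tF mUF; rewrite /lebesgue_cons /pushforward preimage_bigcup.
have mp B : measurable B -> measurable (@tuple_cons n @^-1` B).
  by move=> mB; rewrite -[X in measurable X]setTI; exact: measurable_tuple_cons.
apply: measure_semi_sigma_additive.
- by move=> k; exact: mp.
- apply/trivIsetP => /= i j _ _ ij; rewrite -preimage_setI.
  by move/trivIsetP : tF => /(_ _ _ _ _ ij) ->//; rewrite preimage_set0.
- by rewrite -preimage_bigcup; exact: mp.
Qed.

HB.instance Definition _ := isMeasure.Build _ _ _ (lebesgue_cons m)
  cons0 cons_ge0 cons_sigma_additive.

End measure.

(* Lebesgue measure on R^n, as an iterated product; R^0 is a single point of
   mass 1. *)
Fixpoint lebesgue_tuple n :
    {measure set (n.-tuple (measurableTypeR R)) -> \bar R} :=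
  match n with
  | 0 => dirac ([tuple] : 0.-tuple (measurableTypeR R))
  | n'.+1 => lebesgue_cons (lebesgue_tuple n')
  end.

End lebesgue_tuple.

Section riesz_gas.
Context {R : realType}.

Definition Gamma (s : R) : R :=
  \int[lebesgue_measure]_(x in `]0, +oo[) (x `^ (s - 1) * expR (- x)).

Definition riesz_const (a : R) : R :=
  2 * Gamma (1 + a) * sin (pi * a / 2) / (2 * pi) `^ (1 + a).

Definition expi (t : R) : R[i] := (cos t +i* sin t)%C.

(* e^{2 pi i k r / N} / |k|^{1+a} *)
Definition fourier_term (a : R) (N : nat) (r : R) (k : int) : R[i] :=
  expi (2 * pi * k%:~R * r / N%:R) / (`|k%:~R| `^ (1 + a))%:C%C.

(* Sum over the k in Z with 0 < |k| <= n. *)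
Definition fourier_partial (a : R) (N : nat) (r : R) (n : nat) : R[i] :=
  \sum_(1 <= k < n.+1)
    (fourier_term a N r k%:Z + fourier_term a N r (- k%:Z)).

Lemma fourier_partialE a N r n : fourier_partial a N r n =
  (\sum_(1 <= k < n.+1)
     2 * cos (2 * pi * k%:R * r / N%:R) / k%:R `^ (1 + a))%:C%C.
Proof.
rewrite /fourier_partial rmorph_sum; apply: eq_bigr => k _ /=.
rewrite /fourier_term mulrNz normrN -pmulrn ger0_norm ?ler0n// -mulrDl.
rewrite mulrN !mulNr /expi cosN sinN fmorph_div; congr (_ / _).
apply: (congr2 (@Complex R)); last exact: subrr.
by rewrite [RHS]mulr_natl mulr2n.
Qed.

(* The series over Z \ {0} converges absolutely for 0 < a, so the symmetric
   partial sums may be used; these are real by [fourier_partialE]. *)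
Definition riesz_kernel (a : R) (N : nat) (r : R) : R :=
  riesz_const a * N%:R `^ a *
  limn (fun n => complex.Re (fourier_partial a N r n)).

(* [y] lists Y_1, ..., Y_n; the particle of index 0 is the origin. *)
Definition particle n (y : n.-tuple (measurableTypeR R)) (i : nat) : R :=
  nth 0 (0 :: (y : seq R)) i.

Definition energy (a : R) (N : nat) (y : N.-1.-tuple (measurableTypeR R)) : R :=
  \sum_(j < N) \sum_(i < N | (i < j)%N)
    riesz_kernel a N (particle y j - particle y i).

(* 0 < Y_1 < ... < Y_{N-1} < N *)
Definition simplex (N : nat) : set (N.-1.-tuple (measurableTypeR R)) :=
  [set y | path <%R 0 (rcons (y : seq R) N%:R)].

Arguments energy : clear implicits.
Arguments simplex : clear implicits.

(* No convergence assumption: a divergent sequence has [limn] equal to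
   [point]. *)
Lemma measurable_limn d (T : measurableType d) (u : nat -> T -> R) :
  (forall n, measurable_fun setT (u n)) ->
  measurable_fun setT (fun x => limn (fun n => u n x)).
Proof.
move=> mu.
pose v n := EFin \o u n.
have mv n : measurable_fun setT (v n) by exact/measurable_EFinP.
have ms : measurable_fun setT (fun x => limn_esup (v ^~ x)).
  exact: measurable_fun_limn_esup.
have mi : measurable_fun setT (fun x => limn_einf (v ^~ x)).
  apply: measurableT_comp => //; apply: measurable_fun_limn_esup => n.
  exact: measurableT_comp.
pose b x := (limn_einf (v ^~ x) == limn_esup (v ^~ x)) &&
            (limn_esup (v ^~ x) \is a fin_num).
have bP x : b x -> (fun n => u n x) @ \oo --> fine (limn_esup (v ^~ x)).
  move=> /andP[/eqP ise fs].
  apply: (@fine_cvg _ _ _ _ (v ^~ x)); rewrite fineK//.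
  apply: (@squeeze_cvge _ _ _ _ (einfs (v ^~ x)) _ (esups (v ^~ x))).
  - apply: nearW => n; apply/andP; split.
      by apply: ereal_inf_lbound; exists n => /=.
    by apply: ereal_sup_ubound; exists n => /=.
  - by rewrite -ise limn_einf_lim; exact: is_cvg_einfs.
  - by rewrite limn_esup_lim; exact: is_cvg_esups.
have bN x : ~~ b x -> limn (fun n => u n x) = point.
  move=> nb; apply: dvgP => cu; move/negP : nb; apply.
  have cv : v ^~ x @ \oo --> (limn (fun n => u n x))%:E.
    by apply: cvg_EFin; [exact: nearW|exact: cu].
  by have [ei es] := cvg_limn_einf_sup cv; rewrite /b ei es eqxx.
rewrite (_ : (fun x => _) =
    fun x => if b x then fine (limn_esup (v ^~ x)) else point); last first.
  apply/funext => x; case: ifPn => [/bP/cvg_lim ->//|/bN//].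
apply: measurable_fun_ifT => //.
- apply: measurable_and; first exact: measurable_fun_eqe.
  apply: (measurable_fun_bool true) => /=.
  exact: emeasurable_fin_num.
- exact: measurableT_comp.
Qed.

Lemma measurable_riesz_kernel a N : measurable_fun setT (riesz_kernel a N).
Proof.
rewrite /riesz_kernel; apply: measurable_funM => //.
apply: measurable_limn => n; under eq_fun do rewrite fourier_partialE /=.
apply: measurable_sum => k; apply: measurable_funM => //.
apply: measurable_funM => //; apply: (@measurableT_comp _ _ _ _ _ _ cos).
  by apply: continuous_measurable_fun; exact: continuous_cos.
by apply: measurable_funM => //; exact: measurable_funM.
Qed.

Lemma measurable_particle n i : measurable_fun setT (@particle n ^~ i).
Proof.
case: i => [|i]; first exact: measurable_cst.
have [ni|ni] := ltnP i n.
  have -> : (@particle n)^~ i.+1 = (@tnth n (measurableTypeR R))^~ (Ordinal ni).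
    by apply/funext => y; rewrite /particle/= (tnth_nth 0).
  exact: measurable_tnth.
have -> : (@particle n)^~ i.+1 = cst 0; last exact: measurable_cst.
by apply/funext => y; rewrite /particle/= nth_default// size_tuple.
Qed.

Lemma measurable_energy a N : measurable_fun setT (energy a N).
Proof.
apply: measurable_sum => j.
rewrite [X in measurable_fun _ X](_ : _ = fun y : N.-1.-tuple _ =>
  \sum_(i < N) if (i < j)%N then riesz_kernel a N (particle y j - particle y i)
               else 0); last by apply/funext => y; rewrite big_mkcond.
apply: measurable_sum => i; case: (i < j)%N => /=; last exact: measurable_cst.
apply: (measurableT_comp (measurable_riesz_kernel a N)).
by apply: measurable_funB; exact: measurable_particle.
Qed.

Lemma measurable_simplex N : measurable (simplex N).
Proof.
have mnth i : measurable_fun setT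
    (fun y : N.-1.-tuple (measurableTypeR R) => nth 0 (rcons y (N%:R : R)) i).
  have [iN|iN] := ltnP i N.-1.
    rewrite [X in measurable_fun _ X](_ : _ = (@particle N.-1)^~ i.+1).
      exact: measurable_particle.
    by apply/funext => y; rewrite nth_rcons size_tuple iN.
  rewrite [X in measurable_fun _ X](_ : _ =
    cst (if i == N.-1 then N%:R else 0)); first exact: measurable_cst.
  by apply/funext => y; rewrite nth_rcons size_tuple ltnNge iN.
have -> : simplex N = \bigcap_(i in `I_N.-1.+1) [set y : N.-1.-tuple _ |
    nth 0 (0 :: rcons y (N%:R : R)) i < nth 0 (rcons y (N%:R : R)) i].
  apply/seteqP; split=> y.
    by move=> /(pathP 0) + i /= iN; apply; rewrite size_rcons size_tuple.
  move=> h; apply/(pathP 0) => i; rewrite size_rcons size_tuple => iN.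
  exact: h.
apply: bigcap_measurable => [|i _]; first by exists 0%N.
rewrite -[X in measurable X]setTI; apply: (measurable_fun_ltr _ (mnth i)) => //.
by case: i => [|i]; [exact: measurable_cst|exact: mnth].
Qed.

Definition palm_weight (a : R) (N : nat) (beta : R)
    (A : set (N.-1.-tuple (measurableTypeR R))) : \bar R :=
  (\int[lebesgue_tuple N.-1]_(y in A `&` simplex N)
     (expR (- beta * energy a N y))%:E)%E.

Arguments palm_weight : clear implicits.

Section measure.
Variables (a : R) (N : nat) (beta : R).

Let weight0 : palm_weight a N beta set0 = 0%E.
Proof. by rewrite /palm_weight set0I integral_set0. Qed.

Let weight_ge0 A : (0 <= palm_weight a N beta A)%E.
Proof. by apply: integral_ge0 => y _; rewrite lee_fin expR_ge0. Qed.

Let weight_sigma_additive : semi_sigma_additive (palm_weight a N beta).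
Proof.
rewrite /palm_weight; under eq_fun do rewrite integral_mkcondr.
apply: (@semi_sigma_additive_nng_induced _ _ _ (lebesgue_tuple N.-1)); last first.
  by move=> y; apply: erestrict_ge0 => z _; rewrite lee_fin expR_ge0.
apply/(measurable_restrictT _ _).1; first exact: measurable_simplex.
apply: measurable_funTS; apply/measurable_EFinP.
apply: (measurableT_comp (@measurable_expR R)).
by apply: measurable_funM => //; exact: measurable_energy.
Qed.

HB.instance Definition _ := isMeasure.Build _ _ _ (palm_weight a N beta)
  weight0 weight_ge0 weight_sigma_additive.

End measure.

(* The law with density proportional to exp (- beta H_N) on the simplex. The
   Dirac measure is only the default of [mnormalize] for a total weight equal to
   0 or +oo, which does not happen for 0 < a < 1 and 1 <= N: the energy is then
   bounded and the simplex has positive finite volume. *)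
Definition palm_law (a : R) (N : nat) (beta : R) :
    probability (N.-1.-tuple (measurableTypeR R)) R :=
  mnormalize (palm_weight a N beta) (dirac point).

End riesz_gas.
Arguments energy {R} a N y.
Arguments simplex {R} N.
Arguments palm_weight {R} a N beta A.

(* Main.v *)
Require Import Defs.
From HB Require Import structures.
From mathcomp Require Import all_boot all_order all_algebra.
From mathcomp Require Import all_classical all_reals all_analysis.
From mathcomp Require Import measurable_realfun ring lra zify.

(** In units where N = 2 pi, the convexity gap of the kernel at r, s in (0, 2 pi) is
    at least a constant times (r - s)^2 max(r, s)^(a - 2): Abel summation writes it as a positive
    combination of convexity gaps of twice integrated Fejer kernels.  The energy is
    therefore convex on the simplex, and the Prekopa-Leindler inequality makes every
    gap Y_k - Y_j log-concave under the Palm law.  Invariance under the cyclic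
    relabelling of the particles gives E (Y_k - Y_j) = k - j, so Borell's lemma bounds
    the second moment of a gap by a constant times (k - j)^2.

    Writing Y_i as a weighted sum of gaps at all scales l <= i and completing the
    square, (x_i - y_i)^2 is at most a constant times q(x) + q(y) times the excess of
    the mean energy of x and y over the energy of their midpoint, where q is a weighted
    sum of squared gaps whose expectation is at most a constant times sum_l l^(-1-a).  The
    Prekopa-Leindler inequality applied to {Y_i <= r, q <= K} and
    {Y_i >= r + t, q <= K} then concentrates Y_i within C / sqrt(beta) of a median,
    and Borell's lemma turns this into the variance and the exponential bounds. *)

Set Implicit Arguments.
Unset Strict Implicit.
Unset Printing Implicit Defensive.

Import Order.TTheory GRing.Theory Num.Theory.
Import numFieldNormedType.Exports.

Local Open Scope classical_set_scope.
Local Open Scope ring_scope.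

(** * Strong convexity of the periodised kernel *)

(** Differentiating the kernel series twice term by term gives the divergent series of k^(1-a) cos
    (k t). Convexity is therefore carried by three-point gaps, which are linear in the function and
    survive limits of series.

    The convexity obtained decays like r^(a-2) with the gap length r, so the strength available at a
    configuration depends on how long its gaps are. This is why q enters: it measures the excess of
    the gaps over their scale, and on {q <= K} the energy excess dominates a fixed multiple of (x_i
    - y_i)^2. Nearest-neighbour terms alone would give a bound growing with i; sharing Y_i among all
    pairs at every scale makes scale l cost l^(-1-a), summable since a > 0, whence a bound free of i
    and N.

    The control of q does not involve beta: log-concavity holds for every beta > 0 and the mean gaps
    are fixed by symmetry. Hence beta enters only through the gain in the Prekopa-Leindler
    inequality, which produces the scale beta^(-1/2).

    Every use of Borell's lemma starts from a tail of probability at most 1/4; the ratio of 3/4 to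
    1/4 is the origin of log 3. *)

Definition convexity_gap (R : realType) (l x y : R) (f : R -> R) : R :=
  l * f x + (1 - l) * f y - f (l * x + (1 - l) * y).

Section convexity_gap.
Context {R : realType}.
Implicit Types (l x y m : R) (f g : R -> R).

Let mvt_segment (h dh : R -> R) (a b : R) : a <= b ->
  (forall t, t \in `[a, b] -> is_derive t 1 h (dh t)) ->
  exists2 c, c \in `[a, b] & h b - h a = dh c * (b - a).
Proof.
move=> ab hh; have H := @MVT_segment R h dh a b ab.
apply: (H (fun t tab => hh t (subset_itv_oo_cc tab))).
apply: derivable_within_continuous => t tab.
by have [] := hh _ tab.
Qed.

Let convexity_gap_ge0_lt f (df ddf : R -> R) l x y : 0 <= l <= 1 -> x < y ->
  (forall t, t \in `[x, y] -> is_derive t 1 f (df t)) ->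
  (forall t, t \in `[x, y] -> is_derive t 1 df (ddf t)) ->
  (forall t, t \in `[x, y] -> 0 <= ddf t) ->
  0 <= convexity_gap l x y f.
Proof.
move=> /andP[l0 l1] xy df1 df2 dd.
pose z := l * x + (1 - l) * y.
have ezx : z - x = (1 - l) * (y - x) by rewrite /z; ring.
have eyz : y - z = l * (y - x) by rewrite /z; ring.
have yx0 : 0 <= y - x by rewrite subr_ge0 ltW.
have xz : x <= z by rewrite -subr_ge0 ezx mulr_ge0// subr_ge0.
have zy : z <= y by rewrite -subr_ge0 eyz mulr_ge0.
have sub (a b : R) : x <= a -> b <= y -> {subset `[a, b] <= `[x, y]}.
  move=> xa b_y t; rewrite !in_itv/= => /andP[ta tb].
  by rewrite (le_trans xa)//= (le_trans tb).
have mvt (a b : R) (h dh : R -> R) : x <= a -> b <= y -> a <= b ->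
    (forall t, t \in `[x, y] -> is_derive t 1 h (dh t)) ->
    exists2 c, c \in `[a, b] & h b - h a = dh c * (b - a).
  move=> xa b_y ab hh.
  by have := mvt_segment ab (fun t tab => hh t (sub a b xa b_y t tab)).
have [c1 c1I E1] := mvt x z f df (lexx x) zy xz df1.
have [c2 c2I E2] := mvt z y f df xz (lexx y) zy df1.
have c12 : c1 <= c2.
  by move: c1I c2I; rewrite !in_itv/= => /andP[_ +] /andP[+ _]; exact: le_trans.
have xc1 : x <= c1 by move: c1I; rewrite in_itv/= => /andP[].
have c2y : c2 <= y by move: c2I; rewrite in_itv/= => /andP[].
have [c3 c3I E3] := mvt c1 c2 df ddf xc1 c2y c12 df2.
have : 0 <= df c2 - df c1.
  by rewrite E3 mulr_ge0 ?subr_ge0// dd//; exact: sub c3I.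
rewrite /convexity_gap -/z => dc.
have -> : l * f x + (1 - l) * f y - f z =
    (1 - l) * (f y - f z) - l * (f z - f x) by ring.
rewrite E1 E2 ezx eyz.
have -> : (1 - l) * (df c2 * (l * (y - x))) - l * (df c1 * ((1 - l) * (y - x)))
   = l * (1 - l) * (y - x) * (df c2 - df c1) by ring.
by rewrite !mulr_ge0// subr_ge0.
Qed.

Lemma convexity_gap_ge0 f (df ddf : R -> R) l x y : 0 <= l <= 1 ->
  (forall t, Num.min x y <= t <= Num.max x y -> is_derive t 1 f (df t)) ->
  (forall t, Num.min x y <= t <= Num.max x y -> is_derive t 1 df (ddf t)) ->
  (forall t, Num.min x y <= t <= Num.max x y -> 0 <= ddf t) ->
  0 <= convexity_gap l x y f.
Proof.
move=> l01 df1 df2 dd; have [xy|yx|xy] := ltgtP x y.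
- apply: (@convexity_gap_ge0_lt f df ddf _ _ _ l01 xy) => t.
  + by rewrite in_itv /= => ht; apply: df1; rewrite (min_l (ltW xy)) (max_r (ltW xy)).
  + by rewrite in_itv /= => ht; apply: df2; rewrite (min_l (ltW xy)) (max_r (ltW xy)).
  + by rewrite in_itv /= => ht; apply: dd; rewrite (min_l (ltW xy)) (max_r (ltW xy)).
- have -> : convexity_gap l x y f = convexity_gap (1 - l) y x f.
    rewrite /convexity_gap (_ : 1 - (1 - l) = l); last by ring.
    by rewrite [l * x + _]addrC; ring.
  have l01' : 0 <= 1 - l <= 1 by lra.
  apply: (@convexity_gap_ge0_lt f df ddf _ _ _ l01' yx).
  + move=> t; rewrite in_itv /= => ht; apply: df1.
    by rewrite (min_r (ltW yx)) (max_l (ltW yx)).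
  + move=> t; rewrite in_itv /= => ht; apply: df2.
    by rewrite (min_r (ltW yx)) (max_l (ltW yx)).
  + move=> t; rewrite in_itv /= => ht; apply: dd.
    by rewrite (min_r (ltW yx)) (max_l (ltW yx)).
- rewrite xy /convexity_gap (_ : l * y + (1 - l) * y = y); last by ring.
  by rewrite -mulrDl subrKC mul1r subrr.
Qed.

Lemma convexity_gap_ge f (df ddf : R -> R) l x y m : 0 <= l <= 1 ->
  (forall t, Num.min x y <= t <= Num.max x y -> is_derive t 1 f (df t)) ->
  (forall t, Num.min x y <= t <= Num.max x y -> is_derive t 1 df (ddf t)) ->
  (forall t, Num.min x y <= t <= Num.max x y -> m <= ddf t) ->
  m * (l * (1 - l) * (x - y) ^+ 2 / 2) <= convexity_gap l x y f.
Proof.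
move=> l01 df1 df2 dd.
pose g (t : R) := f t - (m / 2) * (t * t).
have : 0 <= convexity_gap l x y g.
  apply: (@convexity_gap_ge0 _ (fun t => df t - m * t) (fun t => ddf t - m) _ _ _ l01).
  - move=> t ht; have ft := df1 t ht.
    rewrite /g; apply: is_derive_eq; rewrite /GRing.scale /=.
    by field.
  - move=> t ht; have ft := df2 t ht.
    apply: is_derive_eq; rewrite /GRing.scale /=; ring.
  - by move=> t ht; rewrite subr_ge0 dd.
rewrite -[_ <= convexity_gap _ _ _ f]subr_ge0.
by congr (_ <= _); rewrite /convexity_gap /g; by field.
Qed.

Lemma convexity_gap_le f (df ddf : R -> R) l x y m : 0 <= l <= 1 ->
  (forall t, Num.min x y <= t <= Num.max x y -> is_derive t 1 f (df t)) ->
  (forall t, Num.min x y <= t <= Num.max x y -> is_derive t 1 df (ddf t)) ->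
  (forall t, Num.min x y <= t <= Num.max x y -> ddf t <= m) ->
  convexity_gap l x y f <= m * (l * (1 - l) * (x - y) ^+ 2 / 2).
Proof.
move=> l01 df1 df2 dd.
have := @convexity_gap_ge (fun t => - f t) (fun t => - df t)
  (fun t => - ddf t) l x y (- m) l01.
rewrite mulNr -lerN2 opprK.
rewrite (_ : - convexity_gap l x y (fun t => - f t) = convexity_gap l x y f).
  apply.
  - by move=> t /df1 ?; exact: is_deriveN.
  - by move=> t /df2 ?; exact: is_deriveN.
  - by move=> t /dd; rewrite lerN2.
by rewrite /convexity_gap; ring.
Qed.

End convexity_gap.

(** * Fejer kernels and their second primitives *)

Section trigonometric_sums.
Context {R : realType}.
Implicit Types (c : nat -> R) (t : R).

Let is_derive_bigsum n (h : 'I_n -> R -> R) t (dh : 'I_n -> R) :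
  (forall i, is_derive t 1 (h i) (dh i)) ->
  is_derive t 1 (fun s => \sum_(i < n) h i s) (\sum_(i < n) dh i).
Proof.
move=> hh; rewrite (_ : (fun s => _) = \sum_(i < n) h i); first exact: is_derive_sum.
by apply/funext => s; rewrite fct_sumE.
Qed.

Lemma is_derive_cos_sum n c t : is_derive t 1
  (fun s => \sum_(k < n) c k * cos (k%:R * s))
  (- \sum_(k < n) c k * k%:R * sin (k%:R * t)).
Proof.
rewrite -sumrN; apply: is_derive_bigsum => i; apply: is_derive_eq.
rewrite /GRing.scale /=; ring.
Qed.

Lemma is_derive_sin_sum n c t : is_derive t 1
  (fun s => \sum_(k < n) c k * sin (k%:R * s))
  (\sum_(k < n) c k * k%:R * cos (k%:R * t)).
Proof.
apply: is_derive_bigsum => i; apply: is_derive_eq.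
rewrite /GRing.scale /=; ring.
Qed.

(** [j] times the classical Fejer kernel, that is the sum of (j - |k|) cos (k t) over |k| < j; the
    final [- j%:R] corrects the doubled term k = 0. *)
Definition fejer j t : R := 2 * (\sum_(k < j) (j%:R - k%:R) * cos (k%:R * t)) - j%:R.

(* The terms [k = 0] here and in [riemann_cos] vanish because [0^-1 = 0]. *)
Definition fejer_int j t : R :=
  j%:R * t ^+ 2 / 2 - 2 * \sum_(k < j) (j%:R - k%:R) / k%:R ^+ 2 * cos (k%:R * t).

Lemma fejer_intE j t : is_derive t 1 (fejer_int j)
  (j%:R * t + 2 * \sum_(k < j) (j%:R - k%:R) / k%:R ^+ 2 * k%:R * sin (k%:R * t)).
Proof.
have h := is_derive_cos_sum j (fun k => (j%:R - k%:R) / k%:R ^+ 2) t.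
rewrite /fejer_int; apply: is_derive_eq; rewrite /GRing.scale /=; by field.
Qed.

Lemma is_derive_fejer j t : is_derive t 1
  (fun t => j%:R * t + 2 * \sum_(k < j) (j%:R - k%:R) / k%:R ^+ 2 * k%:R * sin (k%:R * t))
  (fejer j t).
Proof.
have h := is_derive_sin_sum j (fun k => (j%:R - k%:R) / k%:R ^+ 2 * k%:R) t.
apply: is_derive_eq; rewrite /GRing.scale /= /fejer.
case: j {h} => [|j]; first by rewrite !big_ord0; ring.
rewrite !big_ord_recl /= !mulr0 !mul0r cos0 add0r.
rewrite (eq_bigr (fun i : 'I_j =>
  (j.+1%:R - (bump 0 i)%:R) * cos ((bump 0 i)%:R * t))); first by ring.
by move=> i _; field; rewrite pnatr_eq0.
Qed.

(** The Dirichlet kernels [D] telescope after multiplication by 1 - cos t, and [fejer j] is the sum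
    of the first [j] of them. Nonnegativity and the bound 2 / (1 - cos t), uniform in [j], can be
    read off. *)
Lemma fejerE j t : fejer j t * (1 - cos t) = 1 - cos (j%:R * t).
Proof.
pose D (j : nat) : R := 2 * (\sum_(k < j.+1) cos (k%:R * t)) - 1.
have DE i : D i * (1 - cos t) = cos (i%:R * t) - cos (i.+1%:R * t).
  elim: i => [|i IH].
    by rewrite /D big_ord_recr big_ord0 /= mul0r cos0 mul1r; ring.
  have -> : D i.+1 = D i + 2 * cos (i.+1%:R * t).
    by rewrite /D big_ord_recr /=; ring.
  rewrite mulrDl IH.
  have -> : i.+2%:R * t = i.+1%:R * t + t by rewrite -natr1; ring.
  have -> : i%:R * t = i.+1%:R * t - t by rewrite -natr1; ring.
  rewrite cosB cosD; ring.
elim: j => [|j IH]; first by rewrite /fejer big_ord0 mul0r cos0; ring.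
have -> : fejer j.+1 t = fejer j t + D j.
  rewrite /fejer /D -natr1.
  rewrite (eq_bigr (fun k : 'I_j.+1 => (j%:R - k%:R) * cos (k%:R * t) +
    cos (k%:R * t))); last by move=> k _; ring.
  rewrite big_split /= [X in 2 * (X + _)]big_ord_recr /= subrr mul0r addr0.
  ring.
rewrite mulrDl IH DE; ring.
Qed.

Lemma cos_lt1 t : 0 < t < 2 * pi -> cos t < 1.
Proof.
move=> t02; rewrite (_ : t = (t / 2) *+ 2); last by rewrite -mulr_natr; by field.
have s0 : 0 < sin (t / 2) by apply: sin_gt0_pi; lra.
rewrite cos_mulr2n cos2sin2; have : 0 < sin (t / 2) ^+ 2 by rewrite exprn_gt0.
by rewrite mulr2n; lra.
Qed.

Lemma fejer_ge0 j t : 0 < t < 2 * pi -> 0 <= fejer j t.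
Proof.
move=> /cos_lt1 ct; have c0 : 0 < 1 - cos t by rewrite subr_gt0.
by rewrite -(pmulr_lge0 _ c0) fejerE subr_ge0 cos_le1.
Qed.

Lemma fejer_le j t : 0 < t < 2 * pi -> fejer j t <= 2 / (1 - cos t).
Proof.
move=> /cos_lt1 ct; have c0 : 0 < 1 - cos t by rewrite subr_gt0.
by rewrite ler_pdivlMr// fejerE; have := cos_geN1 (j%:R * t); lra.
Qed.

Lemma sum_fejer_weights j : \sum_(k < j) (j%:R - k%:R) = j%:R * (j%:R + 1) / 2 :> R.
Proof.
elim: j => [|j IH]; first by rewrite big_ord0; by field.
rewrite (eq_bigr (fun k : 'I_j.+1 => (j%:R - k%:R) + 1)); last first.
  by move=> k _; rewrite -natr1; ring.
rewrite big_split /= big_ord_recr /= IH sumr_const card_ord -natr1; by field.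
Qed.

Lemma fejer_ge j t : 0 <= t -> j%:R * t <= 1 -> cos 1 * j%:R ^+ 2 <= fejer j t.
Proof.
move=> t0 jt1; have [->|j0] := posnP j.
  by rewrite /fejer big_ord0; lra.
have pi1 : 1 <= pi :> R by apply: le_trans (@pi_ge2 R); rewrite ler1n.
(* The term k = 0 is kept exactly, since cos 0 = 1; the others are bounded by cos (k t) >= cos 1.
   The surplus (1 - cos 1) j is what absorbs the [- j%:R] of [fejer]. *)
have : cos 1 * \sum_(k < j) (j%:R - k%:R) + (1 - cos 1) * j%:R <=
    \sum_(k < j) (j%:R - k%:R) * cos (k%:R * t) :> R.
  case: j j0 jt1 => // j _ jt1; rewrite !big_ord_recl/= !subr0 mul0r cos0 mulr1 mulrDr.
  rewrite [leLHS](_ : _ = j.+1%:R + cos 1 * \sum_(i < j) (j.+1%:R - (bump 0 i)%:R)); last by ring.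
  rewrite lerD2l mulr_sumr ler_sum// => i _.
  have kj : (bump 0 i)%:R <= j.+1%:R :> R by rewrite ler_nat /bump leq0n add1n ltnS ltnW.
  rewrite mulrC ler_wpM2l ?subr_ge0//.
  have kt1 : (bump 0 i)%:R * t <= 1 by rewrite (le_trans _ jt1)// ler_wpM2r.
  have kt0 : 0 <= (bump 0 i)%:R * t by rewrite mulr_ge0.
  have [->//|/eqP kt] := eqVneq ((bump 0 i)%:R * t) 1.
  apply: ltW; rewrite ltr_cos ?in_itv/= ?kt0 ?ler01 ?pi1//=.
    by rewrite lt_neqAle kt1 andbT; exact/eqP.
  exact: le_trans pi1.
rewrite sum_fejer_weights /fejer => h.
have : 0 <= (1 - cos 1) * j%:R :> R by rewrite mulr_ge0// subr_ge0 cos_le1.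
nra.
Qed.

End trigonometric_sums.

(** * Dominated convergence for series *)

Section tannery.
Context {R : realType}.
Implicit Types (u : nat -> nat -> R) (v M l : nat -> R).

Lemma dominated_series_cvg v M : cvgn (series M) -> (forall k, `|v k| <= M k) ->
  cvgn (series v).
Proof.
move=> cM vM; apply: normed_cvg; apply: series_le_cvg cM => // k.
  exact: normr_ge0.
exact: le_trans (normr_ge0 _) (vM k).
Qed.

Lemma dominated_series_tail v M K : cvgn (series M) -> (forall k, `|v k| <= M k) ->
  `|limn (series v) - series v K| <= limn (series M) - series M K.
Proof.
move=> cM vM.
have M0 k : 0 <= M k by exact: le_trans (normr_ge0 _) (vM k).
have ndM : nondecreasing_seq (series M).
  by apply: nondecreasing_series => k _ _; exact: M0.
have h : (fun n => `|series v n - series v K|) @ \oo -->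
    `|limn (series v) - series v K|.
  by apply: cvg_norm; apply: cvgB (cvg_cst _); exact: dominated_series_cvg vM.
apply: (cvgr_to_le h); exists K => // n /= Kn.
rewrite !sub_series_geq// (le_trans (ler_norm_sum _ _ _))//.
apply: (@le_trans _ _ (\sum_(K <= k < n) M k)); first exact: ler_sum.
by rewrite -sub_series_geq// lerB// nondecreasing_cvgn_le.
Qed.

Lemma tannery u M l : cvgn (series M) -> (forall n k, `|u n k| <= M k) ->
  (forall k, u ^~ k @ \oo --> l k) ->
  (fun n => limn (series (u n))) @ \oo --> limn (series l).
Proof.
move=> cM uM ul.
have lM k : `|l k| <= M k.
  by apply: (cvgr_to_le (cvg_norm (ul k))); apply: nearW => n; exact: uM.
have cK K : (fun n => series (u n) K) @ \oo --> series l K.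
  rewrite /series /=; elim: K => [|K IH].
    rewrite big_geq// (_ : (fun n => _) = cst 0); first exact: cvg_cst.
    by apply/funext => n; rewrite big_geq.
  rewrite big_nat_recr//= (_ : (fun n => _) =
    (fun n => \sum_(0 <= k < K) u n k) \+ u ^~ K); first exact: cvgD.
  by apply/funext => n; rewrite big_nat_recr.
have tail0 : (fun K => limn (series M) - series M K) @ \oo --> (0 : R).
  by rewrite -(subrr (limn (series M))); apply: cvgB => //; exact: cvg_cst.
apply/cvgrPdist_le => e e0.
have e3 : 0 < e / 3 by lra.
have [K _ /(_ K (leqnn K)) hK] : \forall K \near \oo, `|0 - (limn (series M) - series M K)| <= e / 3.
  by move/cvgrPdist_le : tail0 => /(_ _ e3).
rewrite sub0r normrN in hK; have {}hK := le_trans (ler_norm _) hK.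
have /cvgrPdist_le/(_ _ e3)[m _ hm] := cK K.
exists m => // n /= mn.
have h1 := le_trans (dominated_series_tail K cM (uM n)) hK.
have h2 := le_trans (dominated_series_tail K cM lM) hK.
have h3 := hm n mn.
rewrite (_ : _ - _ = (limn (series l) - series l K) +
  ((series l K - series (u n) K) - (limn (series (u n)) - series (u n) K))); last by ring.
apply: (le_trans (ler_normD _ _)); apply: (le_trans (lerD h2 (ler_normB _ _))).
move: h1 h3; lra.
Qed.

End tannery.

(** * Abel summation of k^(1-a) *)

Section riemann_weights.
Context {R : realType} (a : R) (ha : 0 < a < 1).

Let a0 : 0 < a. Proof. by case/andP: ha. Qed.
Let a1 : a < 1. Proof. by case/andP: ha. Qed.

Let b (k : nat) : R := k%:R `^ (1 - a).

Lemma powR_convex_gap2 (p x : R) : 0 < p < 1 -> 1 < x ->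
  p * (1 - p) * (x + 1) `^ (p - 2) <=
    2 * x `^ p - (x - 1) `^ p - (x + 1) `^ p.
Proof.
move=> /andP[p0 p1] x1.
have := @convexity_gap_ge R (fun t => - t `^ p) (fun t => - (p * t `^ (p - 1)))
  (fun t => - (p * ((p - 1) * t `^ (p - 1 - 1)))) (2^-1) (x - 1) (x + 1)
  (p * (1 - p) * (x + 1) `^ (p - 2)).
have e1 : x - 1 <= x + 1 by lra.
rewrite (min_l e1) (max_r e1) => h.
suff : p * (1 - p) * (x + 1) `^ (p - 2) *
  (2^-1 * (1 - 2^-1) * (x - 1 - (x + 1)) ^+ 2 / 2) <=
  convexity_gap 2^-1 (x - 1) (x + 1) (fun t => - t `^ p).
  rewrite /convexity_gap (_ : 2^-1 * (x - 1) + (1 - 2^-1) * (x + 1) = x); last by field.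
  rewrite (_ : 2^-1 * (1 - 2^-1) * (x - 1 - (x + 1)) ^+ 2 / 2 = 2^-1); last by field.
  lra.
apply: h; first by lra.
- move=> t /andP[t1 _]; apply: is_deriveN; apply: is_derive1_powR; lra.
- move=> t /andP[t1 _]; apply: is_deriveN.
  have t0 : 0 < t by lra.
  have := is_derive1_powR (p - 1) t0; exact: is_deriveZ.
- move=> t /andP[t1 t2].
  rewrite (_ : p - 1 - 1 = p - 2); last by lra.
  rewrite -mulrN -mulNr -mulrA opprB ler_wpM2l ?(ltW p0)//.
  rewrite ler_wpM2l ?subr_ge0 ?(ltW p1)//.
  have t0 : 0 < t by lra.
  rewrite (_ : p - 2 = - (2 - p)); last by ring.
  rewrite !powRN lef_pV2 ?posrE ?powR_gt0//; last by lra.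
  rewrite ge0_ler_powR// ?nnegrE; lra.
Qed.

Lemma powR_gap1 : 0 < 2 - 2 `^ (1 - a).
Proof.
rewrite subr_gt0 -[ltRHS](@powRr1 R 2)//.
rewrite /powR pnatr_eq0 /= ltr_expR ltr_pM2r; last by rewrite ln_gt0// ltr1n.
by rewrite gtrBl.
Qed.

(** Minus the second difference of the concave sequence k^(1-a) at k = j + 1. These are the
    coefficients that write k^(1-a) as a positive combination of the functions min (j + 1, k). *)
Definition riemann_weight (j : nat) : R :=
  2 * j.+1%:R `^ (1 - a) - j%:R `^ (1 - a) - j.+2%:R `^ (1 - a).

Lemma riemann_weight_ge : exists2 c : R, 0 < c &
  forall j, c * j.+1%:R `^ (- 1 - a) <= riemann_weight j.
Proof.
(* At j = 0 the weight is exactly 2 - 2^(1-a), and [powR_convex_gap2], which needs x > 1, does not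
   apply. For later indices the convexity bound is taken at the right end point [j.+3]; since
   [j.+3 <= 2 * j.+2], returning to [j.+2] costs a factor 2^(-1-a) >= 1/4. *)
exists (Num.min (a * (1 - a) / 4) (2 - 2 `^ (1 - a))).
  by rewrite lt_min powR_gap1 andbT divr_gt0// mulr_gt0// subr_gt0.
case=> [|j].
  rewrite /riemann_weight powR1 mulr1 powR0 ?subr0; last by rewrite gt_eqF// subr_gt0.
  by rewrite mulr1 ge_min lexx orbT.
rewrite /riemann_weight.
have := @powR_convex_gap2 (1 - a) j.+2%:R.
have -> : (1 - a) * (1 - (1 - a)) * (j.+2%:R + 1) `^ (1 - a - 2) =
  (a * (1 - a)) * j.+3%:R `^ (- 1 - a).
  by rewrite natr1 (_ : 1 - a - 2 = - 1 - a); [ring|lra].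
have -> : j.+2%:R - 1 = j.+1%:R :> R by rewrite -natr1 addrK.
have p01 : 0 < 1 - a < 1 by rewrite subr_gt0 a1 gtrBl.
have n1 : 1 < j.+2%:R :> R by rewrite ltr1n.
rewrite natr1 => /(_ p01 n1); apply: le_trans.
apply: (@le_trans _ _ (a * (1 - a) / 4 * j.+2%:R `^ (-1 - a))).
  by rewrite ler_wpM2r ?powR_ge0// ge_min lexx.
rewrite -mulrA ler_wpM2l//; first by rewrite mulr_ge0 ?subr_ge0 ?ltW.
apply: (@le_trans _ _ ((2 * j.+2%:R) `^ (- 1 - a))).
  rewrite powRM// ler_wpM2r ?powR_ge0//.
  rewrite (_ : 4^-1 = 2 `^ (- 2)); last first.
    by rewrite powRN powR_mulrn// -natrX.
  rewrite ler_powR//; [by rewrite ler1n|lra].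
rewrite (_ : - 1 - a = - (1 + a)); last by ring.
rewrite !powRN lef_pV2 ?posrE ?powR_gt0 ?mulr_gt0//.
rewrite ge0_ler_powR ?nnegrE ?mulr_ge0//; first by lra.
by rewrite -natrM ler_nat; lia.
Qed.

Lemma riemann_weight_ge0 j : 0 <= riemann_weight j.
Proof.
have [c c0 /(_ j)] := riemann_weight_ge; apply: le_trans.
by rewrite mulr_ge0 ?powR_ge0// ltW.
Qed.

(** Two summations by parts. The boundary term is min (k, n) times an increment of n^(1-a), which
    [powR_nat_increment] bounds by a negative power, so that for fixed [k] it vanishes in the
    limit. *)
Lemma sum_riemann_weight n k :
  \sum_(j < n) riemann_weight j * (minn j.+1 k)%:R =
  (minn k n)%:R `^ (1 - a) - (minn k n)%:R * (n.+1%:R `^ (1 - a) - n%:R `^ (1 - a)).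
Proof.
have p0 : 0 `^ (1 - a) = 0 :> R by rewrite powR0// gt_eqF// subr_gt0.
elim: n => [|n IH]; first by rewrite big_ord0 minn0 p0 mul0r subr0.
rewrite big_ord_recr /= IH /riemann_weight; have [kn|nk] := leqP k n.
  rewrite (minn_idPr (leq_trans kn (leqnSn n))) (minn_idPl (leq_trans kn (leqnSn n))).
  ring.
rewrite (minn_idPr nk) (minn_idPl nk).
set p1 := n.+1%:R `^ _; set p2 := n.+2%:R `^ _; rewrite -natr1; ring.
Qed.

Lemma powR_nat_increment n : n.+2%:R `^ (1 - a) - n.+1%:R `^ (1 - a) <= n.+1%:R `^ (- a) :> R.
Proof.
have := @MVT_segment R (fun t => t `^ (1 - a)) (fun t => (1 - a) * t `^ (1 - a - 1))
  n.+1%:R n.+2%:R.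
rewrite ler_nat leqnSn => /(_ isT) [].
- move=> t; rewrite in_itv/= => /andP[nt _]; apply: is_derive1_powR.
  exact: le_lt_trans nt.
- apply: derivable_within_continuous => t; rewrite in_itv/= => /andP[nt _].
  have t0 : 0 < t by exact: lt_le_trans nt.
  by have [] := is_derive1_powR (1 - a) t0.
move=> t; rewrite in_itv/= => /andP[nt _] ->.
rewrite -natrB// subSnn mulr1.
rewrite (_ : 1 - a - 1 = - a); last by ring.
have t0 : 0 < t by exact: lt_le_trans nt.
apply: (@le_trans _ _ (1 * t `^ (- a))).
  by rewrite ler_wpM2r ?powR_ge0// gerBl ltW.
rewrite mul1r !powRN lef_pV2 ?posrE ?powR_gt0//.
by rewrite ge0_ler_powR ?nnegrE// ltW.
Qed.

Lemma cvg_natr_powRN : (fun n => n.+1%:R `^ (- a)) @ \oo --> (0 : R).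
Proof.
apply/cvgrPdist_le => e e0.
near=> n; rewrite sub0r normrN ger0_norm ?powR_ge0// powRN.
rewrite -[leRHS]invrK lef_pV2 ?posrE ?invr_gt0 ?powR_gt0//.
have -> : e^-1 = (e^-1 `^ a^-1) `^ a.
  by rewrite -powRrM mulVf ?gt_eqF// powRr1// invr_ge0 ltW.
rewrite ge0_ler_powR ?nnegrE ?powR_ge0 ?(ltW a0)//.
apply: (@le_trans _ _ n%:R); last by rewrite ler_nat.
near: n; exact: nbhs_infty_ger.
Unshelve. all: by end_near. Qed.

Lemma cvg_sum_riemann_weight k :
  (fun n => \sum_(j < n) riemann_weight j * (minn j.+1 k)%:R) @ \oo -->
    k%:R `^ (1 - a).
Proof.
rewrite -[X in _ --> X]subr0 -[X in _ --> _ - X](mulr0 k%:R).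
have c1 : (fun n => n.+1%:R `^ (1 - a) - n%:R `^ (1 - a)) @ \oo --> (0 : R).
  rewrite -(@cvg_shiftn 1) /=.
  apply: (squeeze_cvgr _ (cvg_cst 0) cvg_natr_powRN); apply: nearW => n.
  rewrite addn1 powR_nat_increment andbT subr_ge0.
  by rewrite ge0_ler_powR ?nnegrE ?subr_ge0 ?(ltW a1)// ler_nat.
have h := cvgB (@cvg_cst R (k%:R `^ (1 - a)) nat \oo _) (cvgM (@cvg_cst R k%:R nat \oo _) c1).
apply: (cvg_trans _ (h _ _ _ _)); apply: near_eq_cvg; exists k => // n /= kn.
by rewrite sum_riemann_weight (minn_idPl kn).
Qed.

Lemma sum_riemann_weight_le n k :
  0 <= \sum_(j < n) riemann_weight j * (minn j.+1 k)%:R <= k%:R `^ (1 - a).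
Proof.
apply/andP; split.
  by apply: sumr_ge0 => j _; rewrite mulr_ge0 ?riemann_weight_ge0.
rewrite sum_riemann_weight.
have mono (m p : nat) : (m <= p)%N -> m%:R `^ (1 - a) <= p%:R `^ (1 - a) :> R.
  by move=> mp; rewrite ge0_ler_powR ?nnegrE ?subr_ge0 ?(ltW a1)// ler_nat.
rewrite lerBlDr (le_trans (mono _ k _)) ?geq_minl//.
by rewrite lerDl mulr_ge0// subr_ge0 mono.
Qed.

Lemma cvg_riemann_series : cvgn (series (fun k => (k%:R `^ (1 + a))^-1 : R)).
Proof.
pose u (k : nat) : R := (k%:R `^ (1 + a))^-1.
have u0 k : 0 <= u k by rewrite invr_ge0 powR_ge0.
apply: nondecreasing_is_cvgn; first by apply: nondecreasing_series.
(* By the mean value theorem the terms are dominated by a telescoping sequence, the increments of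
   t^(-a) / a. *)
have step n : u n.+2 <= a^-1 * (n.+1%:R `^ (- a) - n.+2%:R `^ (- a)).
  have := @MVT_segment R (fun t => t `^ (- a)) (fun t => - a * t `^ (- a - 1))
    n.+1%:R n.+2%:R.
  rewrite ler_nat leqnSn => /(_ isT) [].
  - move=> t; rewrite in_itv/= => /andP[nt _]; apply: is_derive1_powR.
    exact: le_lt_trans nt.
  - apply: derivable_within_continuous => t; rewrite in_itv/= => /andP[nt _].
    have t0 : 0 < t by exact: lt_le_trans nt.
    by have [] := is_derive1_powR (- a) t0.
  move=> t; rewrite in_itv/= => /andP[nt tn] E.
  rewrite -opprB E -natrB// subSnn mulr1.
  rewrite mulNr opprK mulKf ?gt_eqF// /u.
  have t0 : 0 < t by exact: lt_le_trans nt.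
  rewrite (_ : - a - 1 = - (1 + a)); last by ring.
  rewrite powRN lef_pV2 ?posrE ?powR_gt0//.
  have q : 0 <= 1 + a by rewrite addr_ge0 ?ltW.
  by apply: (ge0_ler_powR q) => //; rewrite ?nnegrE ?(ltW t0).
have bnd n : series u n.+2 <= u 0%N + u 1%N + a^-1 * (1 - n.+1%:R `^ (- a)).
  elim: n => [|n IH].
    by rewrite /series /= !big_nat_recr// big_geq//= powR1; lra.
  rewrite /series /= big_nat_recr//=; have := lerD IH (step n).
  rewrite /series /=; lra.
exists (u 0%N + u 1%N + a^-1) => _ [n _ <-].
have nd : nondecreasing_seq (series u) by exact: nondecreasing_series.
apply: (le_trans (nd n n.+2 _)); first by rewrite (leq_trans (leqnSn n)).
apply: (le_trans (bnd n)); rewrite lerD2l -[leRHS]mulr1 ler_wpM2l ?invr_ge0 ?(ltW a0)//.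
Qed.

End riemann_weights.

Lemma is_cvg_seriesMl (R : realType) (c : R) (u : nat -> R) :
  cvgn (series u) -> cvgn (series (fun k => c * u k)).
Proof.
move=> cu; rewrite (_ : series _ = fun n => c * series u n).
  by apply: is_cvgM => //; exact: is_cvg_cst.
by apply/funext => n; rewrite /series /= mulr_sumr.
Qed.

Lemma cvg_series_finite (R : realType) (g : nat -> R) m :
  (forall k, (m <= k)%N -> g k = 0) -> series g @ \oo --> series g m.
Proof.
move=> g0; apply: cvg_near_cst; exists m => // n /= mn.
apply/eqP; rewrite -subr_eq0 sub_series_geq//; apply/eqP.
by rewrite big_nat_cond big1// => k /andP[/andP[mk _] _]; exact: g0.
Qed.

Lemma series_if_ord (R : realType) (g : nat -> R) m :
  series (fun k => if (k < m)%N then g k else 0) m = \sum_(k < m) g k.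
Proof. by rewrite /series /= big_mkord; apply: eq_bigr => i _; rewrite ltn_ord. Qed.

Lemma convexity_gap_sum (R : realType) (l x y : R) n (c : nat -> R) (f : nat -> R -> R) :
  convexity_gap l x y (fun t => \sum_(k < n) c k * f k t) =
  \sum_(k < n) c k * convexity_gap l x y (f k).
Proof.
rewrite /convexity_gap !mulr_sumr -big_split -sumrB; apply: eq_bigr => i _ /=; ring.
Qed.

(** The real part of the polylogarithm of order 1 + a at e^(i t). *)
Definition riemann_cos (R : realType) (a t : R) : R :=
  limn (series (fun k => cos (k%:R * t) / k%:R `^ (1 + a))).

Lemma cvg_riemann_cos (R : realType) (a t : R) : 0 < a < 1 ->
  cvgn (series (fun k => cos (k%:R * t) / k%:R `^ (1 + a))).
Proof.
move=> ha; apply: dominated_series_cvg (cvg_riemann_series ha) _ => k.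
rewrite normrM normfV (ger0_norm (powR_ge0 _ _)) ler_piMl ?invr_ge0 ?powR_ge0//.
exact: cos_max.
Qed.

Lemma cvg_inv_square_series (R : realType) :
  cvgn (series (fun k => (k%:R ^+ 2)^-1 : R)).
Proof.
have h : 0 < (2^-1 : R) < 1 by lra.
apply: dominated_series_cvg (cvg_riemann_series h) _ => k.
have [->|k0] := posnP k; first by rewrite expr0n /= invr0 normr0 invr_ge0 powR_ge0.
have k1 : 1 <= k%:R :> R by rewrite ler1n.
rewrite ger0_norm ?invr_ge0 ?exprn_ge0// lef_pV2 ?posrE ?exprn_gt0 ?powR_gt0 ?ltr0n//.
by rewrite -powR_mulrn// ler_powR//; lra.
Qed.

(** * Convexity gaps of cosine series *)

Section riemann_cos_convexity.
Context {R : realType}.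
Variables (l x y : R).
Hypotheses (l01 : 0 <= l <= 1) (x02 : 0 < x < 2 * pi) (y02 : 0 < y < 2 * pi).

(** [w] is the gap of t^2 / 2, and [v k] is the opposite of the gap of cos (k t). All series below
    are in terms of these numbers, with [x], [y] and [l] fixed. *)
Let w := l * (1 - l) * (x - y) ^+ 2 / 2.
Let v (k : nat) := - convexity_gap l x y (fun t => cos (k%:R * t)).

Let v_le2 k : `|v k| <= 2.
Proof.
rewrite /v /convexity_gap normrN.
have c1 t := cos_max (k%:R * t : R).
case/andP: l01 => l0 l1; apply: (le_trans (ler_normB _ _)).
have -> : 2 = (l * 1 + (1 - l) * 1) + 1 :> R by ring.
rewrite lerD// (le_trans (ler_normD _ _))// !normrM (ger0_norm l0) (@ger0_norm _ (1 - l)) ?subr_ge0//.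
by rewrite lerD// ler_wpM2l// subr_ge0.
Qed.

Let between t : Num.min x y <= t <= Num.max x y -> 0 < t < 2 * pi.
Proof.
case/andP: x02 => ? ?; case/andP: y02 => ? ? /andP[mt tM].
by rewrite (lt_le_trans _ mt) ?lt_min; [rewrite (le_lt_trans tM)// gt_max|]; apply/andP.
Qed.

Lemma convexity_gap_fejer_int j : convexity_gap l x y (fejer_int j) =
  j%:R * w + 2 * \sum_(k < j) (j%:R - k%:R) / k%:R ^+ 2 * v k.
Proof.
have := convexity_gap_sum l x y j (fun k => (j%:R - k%:R) / k%:R ^+ 2)
  (fun k t => cos (k%:R * t)).
rewrite (eq_bigr (fun k : 'I_j => - ((j%:R - k%:R) / k%:R ^+ 2 * v k))); last first.
  by move=> k _; rewrite /v; ring.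
rewrite sumrN => /eqP; rewrite -eqr_oppLR => /eqP <-.
rewrite /convexity_gap /fejer_int /w; by field.
Qed.

Let fejer_gap_ge0 j : 0 <= convexity_gap l x y (fejer_int j).
Proof.
have := @convexity_gap_ge R _ _ _ l x y 0 l01 (fun t _ => fejer_intE j t)
  (fun t _ => is_derive_fejer j t).
by rewrite mul0r; apply => t /between; exact: fejer_ge0.
Qed.

(** The segment between [x] and [y] is a compact part of (0, 2 pi), where 1 - cos is bounded away
    from 0; so the second derivatives [fejer j] are bounded uniformly in [j]. *)
Let fejer_gap_bounded : exists B : R, forall j,
  `|convexity_gap l x y (fejer_int j)| <= B.
Proof.
have mM : Num.min x y <= Num.max x y by rewrite ge_min !le_max lexx.
have cT : {within `[Num.min x y, Num.max x y], continuous (@cos R)}.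
  by apply: continuous_subspaceT => t; exact: continuous_cos.
have [c cI hc] := EVT_max mM cT.
have c02 : 0 < c < 2 * pi by apply: between; move: cI; rewrite in_itv.
have cc := cos_lt1 c02.
exists (2 / (1 - cos c) * w) => j; rewrite ger0_norm//.
apply: (@convexity_gap_le R _ _ _ l x y _ l01 (fun t _ => fejer_intE j t)
  (fun t _ => is_derive_fejer j t)) => t tI.
have t02 := between tI.
apply: (le_trans (fejer_le j t02)).
have ct := cos_lt1 t02.
have tc : cos t <= cos c by apply: hc; rewrite in_itv.
by rewrite ler_pM2l// lef_pV2 ?posrE ?subr_gt0// lerB.
Qed.

(** The gap form of the expansion of t^2/4 - pi t/2 + pi^2/6 into the cosines cos (k t) / k^2. The
    gap of [fejer_int j] divided by [j] is [w] plus twice a Cesaro mean of the series; it tends to 0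
    because the gap stays bounded. *)
Let series_v : series (fun k => v k / k%:R ^+ 2) @ \oo --> - (w / 2).
Proof.
have cM : cvgn (series (fun k => 2 * (k%:R ^+ 2)^-1 : R)).
  by apply: is_cvg_seriesMl; exact: cvg_inv_square_series.
have vM k : `|v k / k%:R ^+ 2| <= 2 * (k%:R ^+ 2)^-1.
  by rewrite normrM (@ger0_norm _ (k%:R ^+ 2)^-1) ?invr_ge0 ?sqr_ge0// ler_wpM2r ?invr_ge0 ?sqr_ge0.
have cv := dominated_series_cvg cM vM.
suff <- : limn (series (fun k => v k / k%:R ^+ 2)) = - (w / 2) by [].
pose u n k := if (k < n.+1)%N then (1 - k%:R / n.+1%:R) * (v k / k%:R ^+ 2) else 0.
have uM n k : `|u n k| <= 2 * (k%:R ^+ 2)^-1.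
  rewrite /u; case: ifPn => [kn|_]; last first.
    by rewrite normr0 mulr_ge0 ?invr_ge0 ?sqr_ge0.
  rewrite normrM (le_trans _ (vM k))// ler_piMl//.
  have : k%:R / n.+1%:R <= 1 :> R by rewrite ler_pdivrMr// mul1r ler_nat ltnW.
  have : 0 <= k%:R / n.+1%:R :> R by rewrite divr_ge0.
  by move=> ? ?; rewrite ger0_norm ?subr_ge0// gerBl.
have ul k : u ^~ k @ \oo --> v k / k%:R ^+ 2.
  have h : (fun n => (1 - k%:R * harmonic n) * (v k / k%:R ^+ 2)) @ \oo -->
      (1 - k%:R * 0) * (v k / k%:R ^+ 2).
    apply: cvgM; last exact: cvg_cst.
    apply: cvgB; first exact: cvg_cst.
    by apply: cvgM; [exact: cvg_cst|exact: cvg_harmonic].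
  rewrite mulr0 subr0 mul1r in h; apply: cvg_trans h.
  by apply: near_eq_cvg; exists k => // n /= kn; rewrite /u ltnS kn.
have T := tannery cM uM ul.
have E n : limn (series (u n)) =
    (convexity_gap l x y (fejer_int n.+1) * harmonic n - w) / 2.
  rewrite (cvg_lim _ (@cvg_series_finite _ (u n) n.+1 _))//; last first.
    by move=> k nk; rewrite /u ltnNge nk.
  rewrite series_if_ord convexity_gap_fejer_int /=.
  have -> : \sum_(k < n.+1) (n.+1%:R - k%:R) / k%:R ^+ 2 * v k =
      n.+1%:R * \sum_(k < n.+1) (1 - k%:R / n.+1%:R) * (v k / k%:R ^+ 2).
    rewrite mulr_sumr; apply: eq_bigr => k _.
    rewrite (_ : n.+1%:R - k%:R = n.+1%:R * (1 - k%:R / n.+1%:R)); first by ring.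
    by field; rewrite addrC natr1 pnatr_eq0.
  by field; rewrite addrC natr1 pnatr_eq0.
have [B hB] := fejer_gap_bounded.
have g0 : (fun n => convexity_gap l x y (fejer_int n.+1) * harmonic n) @ \oo --> 0.
  have hB0 : (fun n => B * harmonic n) @ \oo --> B * 0.
    by apply: cvgM; [exact: cvg_cst|exact: cvg_harmonic].
  rewrite mulr0 in hB0; apply: (squeeze_cvgr _ (cvg_cst 0) hB0).
  apply: nearW => n; rewrite mulr_ge0//= ler_wpM2r//.
  exact: le_trans (ler_norm _) (hB _).
have L : (fun n => limn (series (u n))) @ \oo --> (0 - w) / 2.
  under eq_fun do rewrite E.
  apply: cvgM; last exact: cvg_cst.
  by apply: cvgB => //; exact: cvg_cst.
have -> : - (w / 2) = (0 - w) / 2 by rewrite sub0r mulNr.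
exact: (cvg_unique _ T L).
Qed.

(** Since min (j, k) is j minus the positive part of j - k, this is [j] copies of [series_v] minus a
    finite sum. So the cosine series with coefficients min (j, k) / k^2 has half the gap of
    [fejer_int j]. *)
Let series_minn_v j : series (fun k => (minn j k)%:R * (v k / k%:R ^+ 2)) @ \oo -->
  - convexity_gap l x y (fejer_int j) / 2.
Proof.
pose g k := if (k < j)%N then (j%:R - k%:R) * (v k / k%:R ^+ 2) else 0.
have cg : series g @ \oo --> \sum_(k < j) (j%:R - k%:R) * (v k / k%:R ^+ 2).
  rewrite -(series_if_ord (fun k => (j%:R - k%:R) * (v k / k%:R ^+ 2))).
  apply: cvg_series_finite => k jk.
  by rewrite /g ltnNge jk.
have -> : - convexity_gap l x y (fejer_int j) / 2 =
    j%:R * - (w / 2) - \sum_(k < j) (j%:R - k%:R) * (v k / k%:R ^+ 2).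
  rewrite convexity_gap_fejer_int.
  rewrite (eq_bigr (fun k : 'I_j => (j%:R - k%:R) * (v k / k%:R ^+ 2))); last first.
    by move=> k _; ring.
  by field.
have -> : series (fun k => (minn j k)%:R * (v k / k%:R ^+ 2)) =
    (fun n => j%:R * series (fun k => v k / k%:R ^+ 2) n - series g n).
  apply/funext => n; rewrite /series /= mulr_sumr -sumrB; apply: eq_bigr => k _.
  rewrite /g; case: (ltnP k j) => kj; first by ring.
  by rewrite subr0.
by apply: (cvgB _ cg); apply: (cvgM _ series_v); exact: cvg_cst.
Qed.

(** Write k^(-1-a) as k^(1-a) / k^2 and expand k^(1-a) in the functions min (j + 1, k). [tannery],
    with majorant 2 k^(-1-a), exchanges the two sums, and each j contributes the gap of a twice
    integrated Fejer kernel. *)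
Lemma convexity_gap_riemann_cos_ge (a : R) J : 0 < a < 1 ->
  \sum_(j < J) riemann_weight a j * (convexity_gap l x y (fejer_int j.+1) / 2) <=
  convexity_gap l x y (riemann_cos a).
Proof.
move=> ha.
pose u n k : R := (\sum_(j < n) riemann_weight a j * (minn j.+1 k)%:R) * (v k / k%:R ^+ 2).
have cM : cvgn (series (fun k => 2 * (k%:R `^ (1 + a))^-1 : R)).
  by apply: is_cvg_seriesMl; exact: cvg_riemann_series.
have powE k : k%:R `^ (1 - a) / k%:R ^+ 2 = (k%:R `^ (1 + a))^-1 :> R.
  have [->|k0] := posnP k.
    by rewrite expr0n /= invr0 mulr0 powR0 ?invr0//; lra.
  rewrite -powR_mulrn// -!powRN -powRD; last by rewrite pnatr_eq0 -lt0n k0 implybT.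
  by congr (_ `^ _); ring.
have uM n k : `|u n k| <= 2 * (k%:R `^ (1 + a))^-1.
  have /andP[s0 s1] := sum_riemann_weight_le ha n k.
  rewrite /u -powE !normrM (ger0_norm s0) (@ger0_norm _ (k%:R ^+ 2)^-1) ?invr_ge0 ?sqr_ge0//.
  by rewrite !mulrA ler_wpM2r ?invr_ge0 ?sqr_ge0// mulrC ler_pM.
have ul k : u ^~ k @ \oo --> v k / k%:R `^ (1 + a).
  have -> : v k / k%:R `^ (1 + a) = k%:R `^ (1 - a) * (v k / k%:R ^+ 2).
    by rewrite -powE; ring.
  by apply: cvgM; [exact: cvg_sum_riemann_weight|exact: cvg_cst].
have T := tannery cM uM ul.
have E n : limn (series (u n)) =
    - \sum_(j < n) riemann_weight a j * (convexity_gap l x y (fejer_int j.+1) / 2).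
  apply: (cvg_lim (@Rhausdorff R)).
  rewrite -sumrN (_ : series (u n) = (fun m => \sum_(j < n) riemann_weight a j *
     series (fun k => (minn j.+1 k)%:R * (v k / k%:R ^+ 2)) m)); last first.
    apply/funext => m; rewrite /series /= /u.
    under eq_bigr do rewrite mulr_suml.
    rewrite exchange_big /=; apply: eq_bigr => j _; rewrite mulr_sumr.
    by apply: eq_bigr => k _; exact: esym (mulrA _ _ _).
  elim: n => [|n IH].
    by rewrite big_ord0; under eq_fun do rewrite big_ord0; exact: cvg_cst.
  rewrite big_ord_recr/=; under eq_fun do rewrite big_ord_recr/=.
  apply: cvgD => //; rewrite -mulrN -mulNr.
  by apply: cvgM; [exact: cvg_cst|exact: series_minn_v].
have G : convexity_gap l x y (riemann_cos a) =
    - limn (series (fun k => v k / k%:R `^ (1 + a))).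
  apply/esym/eqP; rewrite eqr_oppLR; apply/eqP; apply: (cvg_lim (@Rhausdorff R)).
  rewrite (_ : series _ = fun n => - (l * series (fun k => cos (k%:R * x) / k%:R `^ (1 + a)) n +
    (1 - l) * series (fun k => cos (k%:R * y) / k%:R `^ (1 + a)) n -
    series (fun k => cos (k%:R * (l * x + (1 - l) * y)) / k%:R `^ (1 + a)) n)).
    apply: cvgN; apply: cvgB; last exact: cvg_riemann_cos.
    apply: cvgD; apply: cvgM; try exact: cvg_cst; exact: cvg_riemann_cos.
  apply/funext => n; rewrite /series /= !mulr_sumr -big_split -sumrB -sumrN /=.
  by apply: eq_bigr => k _; rewrite /v /convexity_gap; ring.
rewrite G -[leLHS]opprK -E lerN2.
(* All weights and gaps are nonnegative, so any finite number of terms already gives a lower bound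
   for the limit. *)
have ndE : nonincreasing_seq (fun n => limn (series (u n))).
  apply/nonincreasing_seqP => n; rewrite !E lerN2 big_ord_recr /= lerDl.
  by rewrite mulr_ge0 ?riemann_weight_ge0// divr_ge0.
rewrite -(cvg_lim (@Rhausdorff R) T); apply: nonincreasing_cvgn_ge => //.
by apply/cvg_ex; eexists; exact: T.
Qed.

Lemma convexity_gap_fejer_int_ge j : j.+1%:R * Num.max x y <= 1 ->
  cos 1 * j.+1%:R ^+ 2 * w <= convexity_gap l x y (fejer_int j.+1).
Proof.
move=> jT; apply: (@convexity_gap_ge R _ _ _ l x y _ l01 (fun t _ => fejer_intE j.+1 t)
  (fun t _ => is_derive_fejer j.+1 t)) => t tI.
have /andP[t0 _] := between tI.
apply: fejer_ge; first exact: ltW.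
by apply: le_trans jT; rewrite ler_wpM2l//; case/andP: tI.
Qed.

Lemma convexity_gap_fejer_int1 : convexity_gap l x y (fejer_int 1) = w.
Proof.
by rewrite convexity_gap_fejer_int big_ord_recr big_ord0 /= expr0n /= invr0; ring.
Qed.

End riemann_cos_convexity.

Lemma riemann_cos_strongly_convex (R : realType) (a : R) : 0 < a < 1 ->
  exists2 c : R, 0 < c & forall l x y, 0 <= l <= 1 ->
    0 < x < 2 * pi -> 0 < y < 2 * pi ->
    c * (l * (1 - l) * (x - y) ^+ 2) * Num.max x y `^ (a - 2) <=
    convexity_gap l x y (riemann_cos a).
Proof.
move=> ha; have [c0 c0_gt0 hc0] := riemann_weight_ge ha.
have cos1 : 0 < cos 1 :> R := cos1_gt0 R.
have cos1le : cos 1 <= 1 :> R := cos_le1 1.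
(* In the case T <= 1, 32 is 4 times 2 times 4: two halvings of [w], the 1/2 in the sum of the first
   J integers, and 2^(a-2) >= 1/4 when J is compared with 1 / (2 T). *)
exists (c0 * cos 1 / 32); first by rewrite divr_gt0// mulr_gt0.
move=> l x y l01 x02 y02.
set w := l * (1 - l) * (x - y) ^+ 2; set T := Num.max x y.
have w0 : 0 <= w.
  by case/andP: l01 => ? ?; rewrite mulr_ge0 ?sqr_ge0// mulr_ge0// subr_ge0.
have T0 : 0 < T by rewrite lt_max; case/andP: x02 => ->.
(* When T > 1 no kernel order j satisfies j T <= 1. The first term suffices: the kernel of order 1
   is constant, and T^(a-2) <= 1. *)
have [T1|T1] := lerP T 1; last first.
  apply: (le_trans _ (convexity_gap_riemann_cos_ge l01 x02 y02 1 ha)).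
  rewrite big_ord_recr big_ord0 /= add0r convexity_gap_fejer_int1// -/w.
  have := hc0 0%N; rewrite powR1 mulr1 => h0.
  have Ta : T `^ (a - 2) <= 1.
    rewrite -[leRHS](powRr0 T); apply: ler_powR; [exact: ltW|lra].
  apply: (@le_trans _ _ (c0 * (w / 2 / 2))); last by rewrite ler_wpM2r// !divr_ge0.
  apply: (@le_trans _ _ (c0 * cos 1 / 32 * w * 1)).
    by rewrite ler_wpM2l// mulr_ge0// divr_ge0// mulr_ge0// ltW.
  have : c0 * w * cos 1 <= c0 * w * 1 by rewrite ler_wpM2l// mulr_ge0// ltW.
  have : 0 <= c0 * w by rewrite mulr_ge0// ltW.
  lra.
have iT : 1 <= T^-1 by rewrite invf_ge1.
have iT0 : 0 <= T^-1 by exact: le_trans iT.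
have w1 : 0 <= c0 * cos 1 * w by apply: mulr_ge0 => //; apply: mulr_ge0; exact: ltW.
have w4 : 0 <= c0 * cos 1 * w / 4 by apply: divr_ge0.
have w8 : 0 <= c0 * cos 1 * w / 8 by apply: divr_ge0.
(* The largest order with J T <= 1: up to it the Fejer kernels are at least cos 1 times their order
   squared. The sum of j^(-1-a) j^2 for j <= J is then at least J^(2-a) / 2, and J >= 1 / (2 T)
   turns this into T^(a-2). *)
set J := Num.truncn T^-1.
have J0 : (0 < J)%N by rewrite truncn_gt0.
have /andP[J1 J2] := truncn_itv iT0.
have J3 : (2 * T)^-1 <= J%:R.
  rewrite invfM; have : 1 <= J%:R :> R by rewrite ler1n.
  by move: J2; rewrite -/J -natr1; lra.
apply: (le_trans _ (convexity_gap_riemann_cos_ge l01 x02 y02 J ha)).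
have JT (j : 'I_J) : j.+1%:R * T <= 1.
  by rewrite -ler_pdivlMr// mul1r (le_trans _ J1)// ler_nat.
apply: (@le_trans _ _ (\sum_(j < J) c0 * cos 1 * w / 4 * J%:R `^ (- a) * j.+1%:R)); last first.
  apply: ler_sum => j _.
  apply: (@le_trans _ _ (c0 * j.+1%:R `^ (- 1 - a) * (cos 1 * j.+1%:R ^+ 2 * (w / 2) / 2))); last first.
    rewrite ler_pM//.
    - by rewrite mulr_ge0 ?powR_ge0// ltW.
    - by rewrite divr_ge0// mulr_ge0 ?divr_ge0// mulr_ge0 ?sqr_ge0// ltW.
    - by rewrite ler_pM2r//; apply: convexity_gap_fejer_int_ge.
  have -> : c0 * j.+1%:R `^ (-1 - a) * (cos 1 * j.+1%:R ^+ 2 * (w / 2) / 2) =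
     c0 * cos 1 * w / 4 * (j.+1%:R `^ (-1 - a) * j.+1%:R ^+ 2) by field.
  rewrite -[leLHS]mulrA (ler_wpM2l w4)//.
  have -> : j.+1%:R `^ (-1 - a) * j.+1%:R ^+ 2 = j.+1%:R `^ (- a) * j.+1%:R :> R.
    rewrite -[X in _ = _ * X](@powRr1 _ j.+1%:R)// -powR_mulrn// -!powRD ?pnatr_eq0 ?implybT//.
    by congr (_ `^ _); ring.
  rewrite ler_wpM2r// !powRN lef_pV2 ?posrE ?powR_gt0 ?ltr0n//.
  have a0 : 0 <= a by lra.
  by rewrite ge0_ler_powR// ?nnegrE// ler_nat.
rewrite -mulr_sumr -natr_sum.
have -> : (\sum_(i < J) i.+1)%:R = J%:R * (J%:R + 1) / 2 :> R.
  elim: (J) => [|n IH]; first by rewrite big_ord0 mul0r mul0r.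
  by rewrite big_ord_recr /= natrD IH -natr1; field.
have S : (2 * T) `^ (a - 2) <= J%:R `^ (- a) * J%:R ^+ 2.
  have -> : J%:R `^ (- a) * J%:R ^+ 2 = J%:R `^ (2 - a) :> R.
    rewrite -powR_mulrn// -powRD ?pnatr_eq0 -?lt0n ?J0 ?implybT//.
    by congr (_ `^ _); ring.
  rewrite (_ : a - 2 = (2 - a) * -1); last by ring.
  have TT : 0 <= 2 * T by rewrite mulr_ge0// ltW.
  rewrite powRrM powRAC (powR_inv1 TT) ge0_ler_powR ?nnegrE ?invr_ge0//; lra.
rewrite (powRM (a - 2) (ler0n _ 2) (ltW T0)) in S.
have P : 4^-1 <= 2 `^ (a - 2) :> R.
  rewrite (_ : 4^-1 = 2 `^ (- 2)); last by rewrite powRN powR_mulrn// -natrX.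
  by rewrite ler_powR ?ler1n//; lra.
have Q : 4^-1 * T `^ (a - 2) <= J%:R `^ (- a) * J%:R ^+ 2.
  by apply: le_trans S; rewrite ler_wpM2r ?powR_ge0.
apply: (@le_trans _ _ (c0 * cos 1 * w / 8 * (J%:R `^ (- a) * J%:R ^+ 2))).
  have -> : c0 * cos 1 / 32 * w * T `^ (a - 2) = c0 * cos 1 * w / 8 * (4^-1 * T `^ (a - 2)).
    by field.
  by rewrite (ler_wpM2l w8).
have -> : c0 * cos 1 * w / 4 * J%:R `^ (- a) * (J%:R * (J%:R + 1) / 2) =
  c0 * cos 1 * w / 8 * (J%:R `^ (- a) * (J%:R ^+ 2 + J%:R)) by field.
rewrite (ler_wpM2l w8)//.
by rewrite ler_wpM2l ?powR_ge0// lerDl.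
Qed.

(** * Lebesgue measure on tuples *)

Section lebesgue_affine.
Context {R : realType}.
Local Notation mu := (@lebesgue_measure R).

Let affine (a b : R) : measurableTypeR R -> measurableTypeR R := fun t => a * t + b.

Let measurable_affine a b : measurable_fun setT (affine a b).
Proof. by apply: measurable_funD => //; exact: measurable_funM. Qed.

Lemma lebesgue_measure_affine (a b : R) (A : set (measurableTypeR R)) :
  0 < a -> measurable A ->
  mu ((fun t => a * t + b) @^-1` A) = ((a^-1)%:E * mu A)%E.
Proof.
move=> a0 mA.
have a0' : 0 <= a by exact: ltW.
have h : mu A = mscale (NngNum a0') (pushforward mu (affine a b)) A.
  move=> m; apply: lebesgue_measure_unique => //= _ [[c d]] _ <-.
  rewrite /mscale /= /pushforward.
  rewrite (_ : _ @^-1` _ = `](c - b) / a, (d - b) / a]%classic); last first.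
    apply/seteqP; split=> t /=; rewrite /affine !in_itv/=.
      by rewrite ltr_pdivrMr// ler_pdivlMr// ltrBlDr lerBrDr mulrC.
    by rewrite ltr_pdivrMr// ler_pdivlMr// ltrBlDr lerBrDr mulrC.
  rewrite !lebesgue_measure_itv/= !lte_fin ltr_pM2r ?invr_gt0// ltrD2r.
  case: ifPn => _; last by rewrite mule0.
  by rewrite -!EFinD -EFinM; congr EFin; field; rewrite gt_eqF.
rewrite (h (measurable_affine a b)) /mscale /= muleA -EFinM mulVf ?gt_eqF// mul1e /pushforward.
by [].
Qed.

Lemma ge0_integral_shift (f : measurableTypeR R -> \bar R) (c : R) :
  measurable_fun setT f -> (forall t, 0 <= f t)%E ->
  (\int[mu]_t f ((t : R) + c)%R = \int[mu]_t f t)%E.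
Proof.
move=> mf f0.
have ma := measurable_affine 1 c.
transitivity (\int[pushforward mu (affine 1 c)]_t f t)%E.
  rewrite ge0_integral_pushforward// preimage_setT.
  by apply: eq_integral => t _; rewrite /affine /= mul1r.
apply: eq_measure_integral => //= A mA _.
by have := lebesgue_measure_affine c ltr01 mA; rewrite invr1 mul1e.
Qed.

Lemma ge0_integral_reflect (f : measurableTypeR R -> \bar R) (c : R) :
  measurable_fun setT f -> (forall t, 0 <= f t)%E ->
  (\int[mu]_t f (c - (t : R))%R = \int[mu]_t f t)%E.
Proof.
move=> mf f0.
have mN : measurable_fun setT (-%R : measurableTypeR R -> measurableTypeR R) by [].
transitivity (\int[mu]_t f (- (t : R))%R)%E; last first.
  transitivity (\int[pushforward mu (-%R : measurableTypeR R -> measurableTypeR R)]_t f t)%E.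
    by rewrite ge0_integral_pushforward// preimage_setT.
  apply: eq_measure_integral => //= A mA _; exact: lebesgue_measureN.
rewrite -[RHS](@ge0_integral_shift (fun t => f (- (t : R))) (- c))//.
  by apply: eq_integral => t _; rewrite opprD opprK addrC.
exact: measurableT_comp.
Qed.

End lebesgue_affine.

Section lebesgue_tuple.
Context {R : realType}.
Local Notation T n := (n.-tuple (measurableTypeR R)).
Local Notation mu := (@lebesgue_measure R).

Definition cube n (b : R) : set (T n) := [set y | all (fun t => `|t| <= b) (y : seq R)].
Arguments cube : clear implicits.

Lemma cubeS n b (t : R) (s : T n) :
  cube n.+1 b (tuple_cons (s, t)) <-> (`|t| <= b) /\ cube n b s.
Proof. by rewrite /cube/=; split=> [/andP//|[? ?]]; exact/andP. Qed.

Lemma cube_tnth n b (y : T n) : cube n b y <-> forall i, `|tnth y i| <= b.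
Proof. by rewrite /cube /=; split=> [/all_tnthP//|h]; exact/all_tnthP. Qed.

Lemma measurable_cube n b : measurable (cube n b).
Proof.
rewrite (_ : cube n b = \bigcap_(i : 'I_n) (fun y => `|tnth y i|) @^-1` `]-oo, b]).
  apply: fin_bigcap_measurable => // i _; rewrite -[X in measurable X]setTI.
  have : measurable_fun setT (fun y : T n => `|tnth y i|).
    by apply: measurableT_comp => //; exact: measurable_tnth.
  by apply => //; exact: measurable_itv.
apply/seteqP; split => y.
  by move=> /cube_tnth h i _ /=; rewrite in_itv/=.
by move=> h; apply/cube_tnth => i; have := h i I; rewrite /= in_itv.
Qed.

Lemma lebesgue_cube n b : 0 <= b -> lebesgue_tuple n (cube n b) = ((2 * b) ^+ n)%:E.
Proof.
move=> b0; elim: n => [|n IH].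
  by rewrite /= diracE mem_set//= /cube /= tuple0.
rewrite /= /lebesgue_cons /pushforward.
rewrite (_ : _ @^-1` _ = cube n b `*` `[- b, b]); last first.
  apply/seteqP; split=> -[s t] /=.
    by move=> /cubeS[tb sb]; split => //=; rewrite in_itv/= -ler_norml.
  by move=> [sb]; rewrite in_itv/= -ler_norml => tb; exact/cubeS.
rewrite product_measure1E//; last exact: measurable_cube.
pose J : set (measurableTypeR R) := `[- b, b]%classic.
have I : mu J = (2 * b)%:E.
  rewrite /J lebesgue_measure_itv/= lte_fin -EFinD opprK.
  case: ifPn => [_|]; first by rewrite mulr_natl mulr2n.
  rewrite -leNgt => bb; have -> : b = 0 by lra.
  by rewrite mulr0.
change (lebesgue_tuple n (cube n b) * mu J = ((2 * b) ^+ n.+1)%:E)%E.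
by rewrite IH I -EFinM exprSr.
Qed.

Lemma lebesgue_tuple_sigma_finite n : sigma_finite setT (@lebesgue_tuple R n).
Proof.
exists (fun k => cube n k%:R).
  apply/esym; rewrite -subTset => y _.
  have [k hk] : exists k : nat, \sum_(t <- (y : seq R)) `|t| <= k%:R.
    by exists (Num.truncn (\sum_(t <- (y : seq R)) `|t|)).+1; apply: ltW; exact: truncnS_gt.
  exists k => //; apply/cube_tnth => i; apply: le_trans hk.
  rewrite (big_rem (tnth y i)) ?mem_tnth//= lerDl; exact: sumr_ge0.
by move=> k; split; [exact: measurable_cube|rewrite lebesgue_cube ?ltry].
Qed.

(* [lebesgue_tuple n] is only known as a measure; this alias also carries the
   sigma-finite structure required by the Tonelli theorems. *)
Definition lebesgue_tuple_sf n : set (T n) -> \bar R := lebesgue_tuple n.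

HB.instance Definition _ n := Measure.copy (@lebesgue_tuple_sf n) (@lebesgue_tuple R n).

HB.instance Definition _ n := Measure_isSigmaFinite.Build _ _ _
  (@lebesgue_tuple_sf n) (lebesgue_tuple_sigma_finite n).

Section tonelli.
Local Open Scope ereal_scope.
Variables (n : nat) (f : T n.+1 -> \bar R).
Hypotheses (mf : measurable_fun setT f) (f0 : forall y, 0 <= f y).

Let mg : measurable_fun setT (f \o @tuple_cons R n).
Proof. by apply: measurableT_comp => //; exact: measurable_tuple_cons. Qed.

Lemma integral_lebesgue_tupleS : \int[lebesgue_tuple n.+1]_y f y =
  \int[lebesgue_tuple n]_s \int[mu]_t f (tuple_cons (s, t)).
Proof.
transitivity (\int[(lebesgue_tuple n \x mu)]_p (f \o @tuple_cons R n) p).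
  rewrite /= /lebesgue_cons ge0_integral_pushforward//; last exact: measurable_tuple_cons.
exact: (@fubini_tonelli1 _ _ _ _ _ (@lebesgue_tuple_sf n) mu _ mg (fun p => f0 _)).
Qed.

Lemma integral_lebesgue_tupleS_swap : \int[lebesgue_tuple n.+1]_y f y =
  \int[mu]_t \int[lebesgue_tuple n]_s f (tuple_cons (s, t)).
Proof.
rewrite integral_lebesgue_tupleS.
exact: (@fubini_tonelli _ _ _ _ _ (@lebesgue_tuple_sf n) mu _ mg (fun p => f0 _)).
Qed.

Lemma measurable_integral_tail :
  measurable_fun setT (fun t => \int[lebesgue_tuple n]_s f (tuple_cons (s, t))).
Proof.
exact: (@measurable_fun_fubini_tonelli_G _ _ _ _ _ (@lebesgue_tuple_sf n) _ mg (fun p => f0 _)).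
Qed.

End tonelli.

Lemma measurable_tuple_consl n (t : R) :
  measurable_fun setT (fun s : T n => tuple_cons (s, t)).
Proof.
exact: (@measurable_cons _ _ _ _ (fun=> t : measurableTypeR R) n id
  (measurable_cst _) (@measurable_id _ _ _)).
Qed.

Definition tuple_rcons n (p : T n * measurableTypeR R) : T n.+1 := [tuple of rcons p.1 p.2].

Lemma measurable_tuple_rcons n : measurable_fun setT (@tuple_rcons n).
Proof.
apply/measurable_fun_tnthP => i; have [iN|iN] := ltnP i n.
  rewrite (_ : _ \o _ = (fun p => tnth p.1 (Ordinal iN))).
    apply: (measurableT_comp (f := (@tnth n (measurableTypeR R))^~ (Ordinal iN))) => //.
    exact: measurable_tnth.
  by apply/funext => p /=; rewrite !(tnth_nth 0) /= nth_rcons size_tuple iN.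
rewrite (_ : _ \o _ = snd)//.
apply/funext => p /=; rewrite !(tnth_nth 0) /= nth_rcons size_tuple ltnNge iN /=.
by rewrite eqn_leq iN -ltnS ltn_ord.
Qed.

(** [lebesgue_tuple] grows by prepending coordinates, whereas a rotation drops the head and appends
    at the end; so Tonelli is also required for the last coordinate. *)
Lemma integral_lebesgue_tuple_rcons n (f : T n.+1 -> \bar R) :
  measurable_fun setT f -> (forall y, 0 <= f y)%E ->
  (\int[lebesgue_tuple n.+1]_y f y =
   \int[lebesgue_tuple n]_s \int[mu]_t f (tuple_rcons (s, t)))%E.
Proof.
elim: n f => [|n IH] f mf f0.
  rewrite (integral_lebesgue_tupleS mf f0); apply: eq_integral => s _.
  apply: eq_integral => t _; congr f; apply/val_inj => /=.
  by rewrite (tuple0 s).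
have mg : measurable_fun setT (f \o @tuple_rcons n.+1).
  by apply: measurableT_comp => //; exact: measurable_tuple_rcons.
have mr : measurable_fun setT (fun y => \int[mu]_t f (tuple_rcons (y, t)))%E.
  exact: (@measurable_fun_fubini_tonelli_F _ _ _ _ _ mu _ mg (fun p => f0 _)).
have r0 (y : T n.+1) : (0 <= \int[mu]_t f (tuple_rcons (y, t)))%E by exact: integral_ge0.
rewrite (integral_lebesgue_tupleS_swap mf f0) (integral_lebesgue_tupleS_swap mr r0).
apply: eq_integral => t _.
have mt : measurable_fun setT (fun y => f (tuple_cons (y, t))).
  by apply: measurableT_comp => //; exact: measurable_tuple_consl.
rewrite (IH _ mt (fun y => f0 _)).
by apply: eq_integral => s _; apply: eq_integral => u _; congr f; exact/val_inj.
Qed.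

Definition tuple_shift n (c : R) (y : T n) : T n := [tuple of map (fun t => t + c) y].

Lemma measurable_tuple_shift n c : measurable_fun setT (@tuple_shift n c).
Proof.
apply/measurable_fun_tnthP => i.
rewrite (_ : _ \o _ = fun y => tnth y i + c); last first.
  by apply/funext => y /=; rewrite tnth_map.
by apply: measurable_funD => //; exact: measurable_tnth.
Qed.

Lemma integral_lebesgue_tuple_shift n c (f : T n -> \bar R) :
  measurable_fun setT f -> (forall y, 0 <= f y)%E ->
  (\int[lebesgue_tuple n]_y f (tuple_shift c y) = \int[lebesgue_tuple n]_y f y)%E.
Proof.
elim: n f => [|n IH] f mf f0.
  by apply: eq_integral => y _; congr f; apply/val_inj; rewrite /= (tuple0 y).
have mfs : measurable_fun setT (f \o @tuple_shift n.+1 c).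
  by apply: measurableT_comp => //; exact: measurable_tuple_shift.
rewrite (integral_lebesgue_tupleS_swap mfs (fun y => f0 _)) (integral_lebesgue_tupleS_swap mf f0).
have mt := measurable_integral_tail mf f0.
have t0 (t : measurableTypeR R) : (0 <= \int[lebesgue_tuple n]_s f (tuple_cons (s, t)))%E.
  exact: integral_ge0.
rewrite -(ge0_integral_shift c mt t0).
apply: eq_integral => t _.
have ms : measurable_fun setT (fun s => f (tuple_cons (s, (t : R) + c))).
  by apply: measurableT_comp => //; exact: measurable_tuple_consl.
rewrite -(IH _ ms (fun s => f0 _)).
by apply: eq_integral => s _; congr f; exact/val_inj.
Qed.

(* In cyclic coordinates on a circle of length [L] this makes the first particle
   the new origin and lists the old origin last. *)
Definition tuple_rotate (L : R) m (y : T m.+1) : T m.+1 :=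
  tuple_rcons (tuple_shift (- thead y) [tuple of behead y], L - thead y).

Lemma measurable_tuple_rotate L m : measurable_fun setT (@tuple_rotate L m).
Proof.
apply/measurable_fun_tnthP => i; have [iN|iN] := ltnP i m.
  have iN' : (i.+1 < m.+1)%N by [].
  rewrite (_ : _ \o _ = (fun y => tnth y (Ordinal iN') - tnth y ord0)); last first.
    apply/funext => y /=; rewrite !(tnth_nth 0) /= nth_rcons size_map size_behead size_tuple /= iN.
    by rewrite (nth_map 0) ?size_behead ?size_tuple// nth_behead /thead (tnth_nth 0).
  by apply: measurable_funB; exact: measurable_tnth.
rewrite (_ : _ \o _ = (fun y => L - tnth y ord0)); last first.
  apply/funext => y /=; rewrite !(tnth_nth 0) /= nth_rcons size_map size_behead size_tuple /=.
  by rewrite ltnNge iN /= eqn_leq iN -ltnS ltn_ord /= /thead (tnth_nth 0).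
by apply: measurable_funB => //; exact: measurable_tnth.
Qed.

(** For a fixed head t, the rotation translates the tail by -t and appends L - t: a translation in
    the tail followed by a reflection in t. *)
Lemma integral_lebesgue_tuple_rotate (L : R) m (f : T m.+1 -> \bar R) :
  measurable_fun setT f -> (forall y, 0 <= f y)%E ->
  (\int[lebesgue_tuple m.+1]_y f (tuple_rotate L y) =
   \int[lebesgue_tuple m.+1]_y f y)%E.
Proof.
move=> mf f0.
have mfr : measurable_fun setT (f \o @tuple_rotate L m).
  by apply: measurableT_comp => //; exact: measurable_tuple_rotate.
have mg : measurable_fun setT (f \o @tuple_rcons m).
  by apply: measurableT_comp => //; exact: measurable_tuple_rcons.
pose G (t : measurableTypeR R) : \bar R := (\int[lebesgue_tuple m]_s f (tuple_rcons (s, t)))%E.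
have mG : measurable_fun setT G.
  exact: (@measurable_fun_fubini_tonelli_G _ _ _ _ _ (@lebesgue_tuple_sf m) _ mg (fun p => f0 _)).
have G0 t : (0 <= G t)%E by exact: integral_ge0.
rewrite (integral_lebesgue_tupleS_swap mfr (fun y => f0 _)).
rewrite (integral_lebesgue_tuple_rcons mf f0).
rewrite (@fubini_tonelli _ _ _ _ _ (@lebesgue_tuple_sf m) mu _ mg (fun p => f0 _)).
rewrite -[RHS](ge0_integral_reflect L mG G0).
apply: eq_integral => t _; rewrite /G.
have ms : measurable_fun setT (fun s => f (tuple_rcons (s, L - (t : R)))).
  have mp : measurable_fun setT (fun s : T m => (s, (L - (t : R)) : measurableTypeR R)).
    exact: (measurable_fun_pair (@measurable_id _ _ _) (measurable_cst _)).
  exact: (measurableT_comp mg mp).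
rewrite -(integral_lebesgue_tuple_shift (- (t : R)) ms (fun s => f0 _)).
apply: eq_integral => s _; congr f; apply/val_inj => /=.
by rewrite theadE.
Qed.

End lebesgue_tuple.
Arguments cube {R} n b.

(** * The Prekopa-Leindler inequality *)

Section brunn_minkowski.
Context {R : realType}.
Local Notation mu := (@lebesgue_measure R).
Local Notation MR := (measurableTypeR R).

(** For a0 near the supremum of [A] and b0 near the infimum of [B], the sets l A + (1 - l) b0 and l
    a0 + (1 - l) B meet in little more than one point, and both lie in [C]. [C] is any measurable
    set containing the Minkowski combination, whose own measurability is not at hand. *)
Lemma brunn_minkowski1 (l M : R) (A B C : set MR) : 0 < l < 1 ->
  measurable A -> measurable B -> measurable C -> A !=set0 -> B !=set0 ->
  A `<=` `[- M, M] -> B `<=` `[- M, M] ->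
  (forall x y, A x -> B y -> C (l * (x : R) + (1 - l) * (y : R))) ->
  (l%:E * mu A + (1 - l)%:E * mu B <= mu C)%E.
Proof.
move=> /andP[l0 l1] mA mB mC A0 B0 AM BM ABC.
have l1' : 0 < 1 - l by rewrite subr_gt0.
apply/lee_addgt0Pr => e e0.
have supA : has_sup (A : set R).
  by split => //; exists M => x /AM /=; rewrite in_itv => /andP[].
have infB : has_inf (B : set R).
  by split => //; exists (- M) => x /BM /=; rewrite in_itv => /andP[].
have [a0 Aa0 ha0] := sup_adherent e0 supA.
have [b0 Bb0 hb0] := inf_adherent e0 infB.
pose A1 : set MR := A `&` `]-oo, a0]; pose B1 : set MR := B `&` `]b0, +oo[.
have mA1 : measurable A1 by exact: measurableI.
have mB1 : measurable B1 by exact: measurableI.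
have hA : (mu A <= mu A1 + e%:E)%E.
  apply: (@le_trans _ _ (mu (A1 `|` `]a0, a0 + e]))).
    apply: le_measure; rewrite ?inE//; first exact: measurableU.
    move=> x Ax; have [xa|ax] := leP x a0; [left|right] => /=.
      by split=> //=; rewrite in_itv.
    rewrite in_itv/= ax/=; have := sup_upper_bound supA Ax; move: ha0.
    by rewrite ltrBlDr => /ltW ha /le_trans; apply.
  apply: (le_trans (measureU2 _ _ _)) => //.
  have hI : mu `]a0, a0 + e]%classic = e%:E.
    by rewrite lebesgue_measure_itv/= lte_fin ltrDl e0 -EFinD addrAC subrr add0r.
  by rewrite -[e%:E]hI.
have hB : (mu B <= mu B1 + e%:E)%E.
  apply: (@le_trans _ _ (mu (B1 `|` `[b0 - e, b0]))).
    apply: le_measure; rewrite ?inE//; first exact: measurableU.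
    move=> x Bx; have [xb|bx] := leP x b0; [right|left] => /=.
      rewrite in_itv/= xb andbT; have := inf_lbound infB.2 Bx; move: hb0.
      by rewrite -ltrBlDr => /ltW ha; apply: le_trans.
    by split=> //=; rewrite in_itv/= bx.
  apply: (le_trans (measureU2 _ _ _)) => //.
  have hI : mu `[b0 - e, b0]%classic = e%:E.
    rewrite lebesgue_measure_itv/= lte_fin ltrBlDr ltrDl e0 -EFinD.
    by rewrite opprB addrC subrK.
  by rewrite -[e%:E]hI.
pose z := l * a0 + (1 - l) * b0.
(* The two images l A1 + (1 - l) b0 and l a0 + (1 - l) B1, written as preimages; they are separated
   by [z], since A1 ends at a0 and B1 starts after b0. *)
pose C1 : set MR := (fun c : R => l^-1 * c + - (l^-1 * ((1 - l) * b0))) @^-1` A1.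
pose C2 : set MR := (fun c : R => (1 - l)^-1 * c + - ((1 - l)^-1 * (l * a0))) @^-1` B1.
have mC1 : mu C1 = (l%:E * mu A1)%E.
  by rewrite lebesgue_measure_affine ?invr_gt0// invrK.
have mC2 : mu C2 = ((1 - l)%:E * mu B1)%E.
  by rewrite lebesgue_measure_affine ?invr_gt0// invrK.
have maff (p q : R) (D : set MR) : measurable D ->
    measurable ((fun c : R => p * c + q) @^-1` D : set MR).
  move=> mD; rewrite -[X in measurable X]setTI.
  have : measurable_fun setT (fun c : MR => p * (c : R) + q : MR).
    by apply: measurable_funD => //; exact: measurable_funM.
  exact.
have CC : (mu C1 + mu C2 <= mu C)%E.
  rewrite -measureU; [|exact: maff|exact: maff|].
    apply: le_measure; rewrite ?inE//; first by apply: measurableU; exact: maff.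
    move=> c [[Ac _]|[Bc _]].
      have := ABC _ _ Ac Bb0.
      rewrite (_ : _ + _ = c)//; field; by rewrite gt_eqF.
    have := ABC _ _ Aa0 Bc.
    rewrite (_ : _ + _ = c)//; field; by rewrite gt_eqF.
  apply/seteqP; split=> // c [[_ /=]] + [_ /=].
  rewrite !in_itv/= andbT -!mulrBr ler_pdivrMl// ltr_pdivlMl//.
  move=> h1 h2; have : c <= z by rewrite /z; lra.
  by rewrite leNgt => /negP; apply; rewrite /z; lra.
apply: (@le_trans _ _ (l%:E * (mu A1 + e%:E) + (1 - l)%:E * (mu B1 + e%:E))%E).
  by apply: leeD; (apply: lee_wpmul2l; first by rewrite lee_fin ltW).
rewrite !ge0_muleDr ?lee_fin ?(ltW e0)// addeACA -mC1 -mC2 -!EFinM -EFinD.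
by rewrite -mulrDl subrKC mul1r leeD2r.
Qed.

End brunn_minkowski.

(** * The layer-cake formula *)

Section layer_cake.
Context d (T : measurableType d) {R : realType}.
Variable m : {sigma_finite_measure set T -> \bar R}.

Let layer (f : T -> R) : set (T * measurableTypeR R) :=
  [set p | (0 <= (p.2 : R)) && ((p.2 : R) < f p.1)].

Let measurable_layer2 (f : T -> R) : measurable_fun setT f -> measurable (layer f).
Proof.
move=> mf; rewrite (_ : layer f = (snd @^-1` `[0, +oo[) `&` [set p | (p.2 : R) < f p.1]).
  apply: measurableI; first by rewrite -[X in measurable X]setTI; exact: measurable_snd.
  have h : measurable_fun setT (fun p : T * measurableTypeR R => (p.2 : R) < f p.1).
    by apply: measurable_fun_ltr => //; exact: measurableT_comp.
  by rewrite -[X in measurable X]setTI; apply: (h measurableT [set true]).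
apply/seteqP; split=> p /=; rewrite in_itv/= andbT; first by move=> /andP[].
by move=> [? ?]; exact/andP.
Qed.

Let ysection_layer (f : T -> R) (t : R) :
  [set x | (0 <= t < f x)%R] = ysection (layer f) t.
Proof. by apply/seteqP; split=> x; rewrite /ysection /= inE. Qed.

Lemma measurable_superlevel (f : T -> R) (t : R) : measurable_fun setT f ->
  measurable [set x | (0 <= t < f x)%R].
Proof. by move=> mf; rewrite ysection_layer; apply: measurable_ysection; exact: measurable_layer2. Qed.

Lemma measurable_fun_superlevel (f : T -> R) : measurable_fun setT f ->
  measurable_fun setT (fun t : measurableTypeR R => m [set x | (0 <= (t : R) < f x)%R]).
Proof.
move=> mf; rewrite (_ : (fun t => _) = m \o ysection (layer f)).
  by apply: measurable_fun_ysection; exact: measurable_layer2.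
by apply/funext => t /=; rewrite ysection_layer.
Qed.

Lemma layer_cake (f : T -> R) : measurable_fun setT f -> (forall x, 0 <= f x) ->
  (\int[m]_x (f x)%:E = \int[lebesgue_measure]_t m [set x | (0 <= t < f x)%R])%E.
Proof.
move=> mf f0; have mA := measurable_layer2 mf.
have mi : measurable_fun setT (fun p => (\1_(layer f) p)%:E : \bar R).
  by apply/measurable_EFinP; exact: measurable_indic.
have i0 (p : T * measurableTypeR R) : (0 <= (\1_(layer f) p)%:E :> \bar R)%E.
  by rewrite lee_fin.
have E := @fubini_tonelli _ _ _ _ _ m (@lebesgue_measure R) _ mi i0.
transitivity (\int[m]_x \int[lebesgue_measure]_t (\1_(layer f) (x, t))%:E)%E.
  apply: eq_integral => x _.
  rewrite (_ : (fun t => (\1_(layer f) (x, t))%:E) =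
      (fun t => (\1_(`[0, f x[%classic : set R) t)%:E)).
    have hI : lebesgue_measure `[0, f x[%classic = (f x)%:E.
      rewrite lebesgue_measure_itv/= lte_fin.
      case: ltP (f0 x) => [_ _|h1 h2]; first by rewrite sube0.
      by rewrite (le_anti (introT andP (conj h1 h2))).
    by rewrite integral_indic// setIT -[LHS]hI.
  by apply/funext => t; rewrite !indicE; congr ((_ _)%:R%:E).
rewrite E; apply: eq_integral => t _.
rewrite (_ : (fun x => (\1_(layer f) (x, t))%:E) =
    (fun x => (\1_[set x | 0 <= t < f x] x)%:E)).
  by rewrite integral_indic ?setIT//; exact: measurable_superlevel.
by apply/funext => x; rewrite !indicE; congr ((_ _)%:R%:E); apply/idP/idP; rewrite !inE.
Qed.

End layer_cake.

Lemma weighted_AM_GM (R : realType) (l x y : R) : 0 < l < 1 -> 0 <= x -> 0 <= y ->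
  x `^ l * y `^ (1 - l) <= l * x + (1 - l) * y.
Proof.
move=> /andP[l0 l1] x0 y0.
have l1' : 0 < 1 - l by rewrite subr_gt0.
have := @conjugate_powR R (x `^ l) (y `^ (1 - l)) l^-1 (1 - l)^-1
  (powR_ge0 _ _) (powR_ge0 _ _).
rewrite !invr_gt0 => /(_ l0 l1'); rewrite !invrK subrKC => /(_ erefl).
rewrite -!powRrM !divff ?gt_eqF// !powRr1//.
by rewrite [x * l]mulrC [y * _]mulrC.
Qed.

(** * From one dimension to n dimensions *)

Section bounded_support.
Context {R : realType}.
Local Notation T n := (n.-tuple (measurableTypeR R)).
Local Notation MR := (measurableTypeR R).
Local Notation mu := (@lebesgue_measure R).

(** This class keeps all integrals finite, so that real powers of integrals make sense, and it is
    stable under freezing the first coordinate or integrating out the others, as induction on the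
    dimension requires. *)
Definition bounded_support n (f : T n -> R) : Prop :=
  measurable_fun setT f /\ exists M b, [/\ 0 <= M, 0 <= b &
    forall y, 0 <= f y <= M /\ (f y != 0 -> cube n b y)].

Definition bounded_support1 (f : MR -> R) : Prop :=
  measurable_fun setT f /\ exists M b, [/\ 0 <= M, 0 <= b &
    forall t, 0 <= f t <= M /\ (f t != 0 -> `|t : R| <= b)].

Lemma bounded_support_integral n (f : T n -> R) M b : measurable_fun setT f ->
  0 <= M -> 0 <= b -> (forall y, 0 <= f y <= M /\ (f y != 0 -> cube n b y)) ->
  (0 <= \int[lebesgue_tuple n]_y (f y)%:E <= (M * (2 * b) ^+ n)%:E)%E.
Proof.
move=> mf M0 b0 fP; apply/andP; split.
  by apply: integral_ge0 => y _; rewrite lee_fin; have [/andP[]] := fP y.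
have mc := @measurable_cube R n b.
apply: (@le_trans _ _ (\int[lebesgue_tuple n]_y (M%:E * (\1_(cube n b) y)%:E))%E).
  apply: ge0_le_integral => //.
  - by move=> y _; rewrite lee_fin; have [/andP[]] := fP y.
  - exact/measurable_EFinP.
  - by apply/measurable_EFinP; apply: measurable_funM => //; exact: measurable_indic.
  move=> y _; rewrite -EFinM lee_fin indicE; have [/andP[f0 fM] fc] := fP y.
  have [fy|/fc/mem_set ->] := eqVneq (f y) 0; first by rewrite fy mulr_ge0.
  by rewrite mulr1.
rewrite ge0_integralZl_EFin//; last by apply/measurable_EFinP; exact: measurable_indic.
by rewrite integral_indic// setIT EFinM lee_wpmul2l ?lee_fin// lebesgue_cube.
Qed.

Lemma bounded_support_fin n (f : T n -> R) : bounded_support f ->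
  (\int[lebesgue_tuple n]_y (f y)%:E)%E = (\int[lebesgue_tuple n]_y f y)%:E.
Proof.
move=> [mf [M [b [M0 b0 fP]]]].
have /andP[i0 iM] := bounded_support_integral mf M0 b0 fP.
rewrite /Rintegral fineK// ge0_fin_numE//; exact: le_lt_trans iM (ltry _).
Qed.

Lemma bounded_support1_fin (f : MR -> R) : bounded_support1 f ->
  (\int[mu]_t (f t)%:E)%E = (\int[mu]_t f t)%:E.
Proof.
move=> [mf [M [b [M0 b0 fP]]]].
rewrite /Rintegral fineK// ge0_fin_numE; last first.
  by apply: integral_ge0 => y _; rewrite lee_fin; have [/andP[]] := fP y.
pose J : set MR := `[- b, b]%classic.
have mJ : measurable J by exact: measurable_itv.
apply: (@le_lt_trans _ _ (\int[mu]_y (M%:E * (\1_J y)%:E))%E).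
  apply: ge0_le_integral => //.
  - by move=> y _; rewrite lee_fin; have [/andP[]] := fP y.
  - exact/measurable_EFinP.
  - by apply/measurable_EFinP; apply: measurable_funM => //; exact: measurable_indic.
  move=> y _; rewrite -EFinM lee_fin indicE; have [/andP[f0 fM] fc] := fP y.
  have [fy|/fc yb] := eqVneq (f y) 0; first by rewrite fy mulr_ge0.
  by rewrite mem_set ?mulr1// /J /= in_itv/= -ler_norml.
rewrite ge0_integralZl_EFin//; last by apply/measurable_EFinP; exact: measurable_indic.
have hJ : (mu J < +oo)%E by rewrite /J lebesgue_measure_itv/=; case: ifP => _; rewrite ltry.
rewrite integral_indic// setIT.
by rewrite lte_mul_pinfty// ?lee_fin.
Qed.

(** When [f] and [g] both have supremum 1, their superlevel sets are nonempty for exactly the same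
    levels 0 <= t < 1. [brunn_minkowski1] then applies level by level, and [layer_cake] integrates
    the result. *)
Let prekopa_leindler_normalized (l : R) (f g h : MR -> R) : 0 < l < 1 ->
  bounded_support1 f -> bounded_support1 g -> bounded_support1 h ->
  (forall t, f t <= 1) -> (forall t, g t <= 1) ->
  (forall e, e < 1 -> exists t, e < f t) -> (forall e, e < 1 -> exists t, e < g t) ->
  (forall x y : R, f x `^ l * g y `^ (1 - l) <= h (l * x + (1 - l) * y)) ->
  l * (\int[mu]_t f t) + (1 - l) * (\int[mu]_t g t) <= \int[mu]_t h t.
Proof.
move=> l01 bf bg bh f1 g1 fsup gsup fgh.
have /andP[l0 l1] := l01.
have l1' : 0 < 1 - l by rewrite subr_gt0.
have ge0 u : bounded_support1 u -> forall t, 0 <= u t.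
  by move=> [_ [M [b [_ _ uP]]]] t; have [/andP[]] := uP t.
have level u : bounded_support1 u -> forall t : R, measurable [set x : MR | (0 <= t < u x)%R].
  by move=> [mu_ _] t; exact: measurable_superlevel.
have mlevel u : bounded_support1 u ->
    measurable_fun setT (fun t : MR => mu [set x : MR | (0 <= (t : R) < u x)%R]).
  by move=> [mu_ _]; exact: (measurable_fun_superlevel mu).
rewrite -lee_fin EFinD !EFinM -!bounded_support1_fin//.
rewrite (layer_cake mu bf.1 (ge0 _ bf)) (layer_cake mu bg.1 (ge0 _ bg)).
rewrite (layer_cake mu bh.1 (ge0 _ bh)).
rewrite -ge0_integralZl_EFin ?(ltW l0)//; last exact: mlevel.
rewrite -ge0_integralZl_EFin ?(ltW l1')//; last exact: mlevel.
rewrite -ge0_integralD//; last 4 first.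
- by move=> t _; rewrite mule_ge0// lee_fin ltW.
- by apply: measurable_funeM; exact: mlevel.
- by move=> t _; rewrite mule_ge0// lee_fin ltW.
- by apply: measurable_funeM; exact: mlevel.
apply: ge0_le_integral => //.
- by move=> t _; rewrite adde_ge0// mule_ge0// lee_fin ltW.
- by apply: emeasurable_funD; apply: measurable_funeM; exact: mlevel.
- exact: mlevel.
move=> t _.
have out u : (forall x, u x <= 1) -> ((t : R) < 0) || (1 <= (t : R)) ->
    [set x : MR | (0 <= (t : R) < u x)%R] = set0.
  move=> u1 t01; apply/seteqP; split=> x //= /andP[t0 tu]; move: t01; rewrite ltNge t0 /= => t1.
  by move: tu; rewrite ltNge (le_trans (u1 x)).
have [t01|] := boolP (((t : R) < 0) || (1 <= (t : R))).
  by rewrite (out f)// (out g)// !measure0 !mule0 adde0.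
rewrite negb_or -leNgt -ltNge => /andP[t0 t1].
have [_ [Mf [b1 [_ _ fP]]]] := bf.
have [_ [Mg [b2 [_ _ gP]]]] := bg.
apply: (@brunn_minkowski1 _ _ (Num.max b1 b2)) => //; try exact: level.
- by have [x hx] := fsup t t1; exists x; rewrite /= t0.
- by have [x hx] := gsup t t1; exists x; rewrite /= t0.
- move=> x /= /andP[_ tf]; rewrite in_itv/= -ler_norml le_max.
  by have [_ ->] := fP x; rewrite ?gt_eqF// (le_lt_trans t0).
- move=> x /= /andP[_ tf]; rewrite in_itv/= -ler_norml le_max.
  by have [_ ->] := gP x; rewrite ?orbT ?gt_eqF// (le_lt_trans t0).
move=> x y /= /andP[_ tf] /andP[_ tg]; rewrite t0 /=.
apply: lt_le_trans (fgh x y).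
have fx0 : 0 < f x := le_lt_trans t0 tf.
have gy0 : 0 < g y := le_lt_trans t0 tg.
move: t0; rewrite le_eqVlt => /predU1P[<-|t0]; first by rewrite mulr_gt0// powR_gt0.
rewrite -[ltLHS](@powRr1 R t) ?(ltW t0)// -[X in t `^ X](subrKC l).
rewrite powRD; last by rewrite subrKC oner_eq0.
apply: (@lt_le_trans _ _ (f x `^ l * (t : R) `^ (1 - l))).
  by rewrite ltr_pM2r ?powR_gt0// gt0_ltr_powR// nnegrE ltW.
by rewrite ler_wpM2l ?powR_ge0// ge0_ler_powR ?nnegrE ?ltW.
Qed.

Lemma prekopa_leindler1 (l : R) (f g h : MR -> R) : 0 < l < 1 ->
  bounded_support1 f -> bounded_support1 g -> bounded_support1 h ->
  (forall x y : R, f x `^ l * g y `^ (1 - l) <= h (l * x + (1 - l) * y)) ->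
  (\int[mu]_t f t) `^ l * (\int[mu]_t g t) `^ (1 - l) <= \int[mu]_t h t.
Proof.
move=> l01 bf bg bh fgh; have /andP[l0 l1] := l01.
have l1' : 0 < 1 - l by rewrite subr_gt0.
have ge0 u : bounded_support1 u -> forall t, 0 <= u t.
  by move=> [_ [M [b [_ _ uP]]]] t; have [/andP[]] := uP t.
have Ige0 u : bounded_support1 u -> 0 <= \int[mu]_t u t.
  by move=> bu; apply: Rintegral_ge0 => t _; exact: ge0.
have supP u : bounded_support1 u -> has_sup (range u).
  move=> [_ [M [b [_ _ uP]]]]; split; first by exists (u 0), 0.
  by exists M => _ [t _ <-]; have [/andP[]] := uP t.
have ubP u : bounded_support1 u -> forall t, u t <= sup (range u).
  by move=> bu t; apply: (sup_upper_bound (supP u bu)); exists t.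
have sup0 u : bounded_support1 u -> 0 <= sup (range u).
  by move=> bu; apply: le_trans (ubP u bu 0); exact: ge0.
have null u : bounded_support1 u -> sup (range u) = 0 -> \int[mu]_t u t = 0.
  move=> bu u0; rewrite (_ : u = cst 0).
    by rewrite /Rintegral integral0.
  by apply/funext => t; apply/le_anti; rewrite ge0// -[leRHS]u0 ubP.
have [f0|f0] := eqVneq (sup (range f)) 0.
  by rewrite (null f)// powR0 ?gt_eqF// mul0r Ige0.
have [g0|g0] := eqVneq (sup (range g)) 0.
  by rewrite (null g)// (@powR0 _ (1 - l)) ?gt_eqF// mulr0 Ige0.
have {f0}f0 : 0 < sup (range f) by rewrite lt_neqAle eq_sym f0 sup0.
have {g0}g0 : 0 < sup (range g) by rewrite lt_neqAle eq_sym g0 sup0.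
have scale u c : 0 < c -> bounded_support1 u ->
    bounded_support1 (fun t => c * u t) /\
    \int[mu]_t (c * u t) = c * \int[mu]_t u t.
  move=> c0 bu; have [mu_ [M [b [M0 b0 uP]]]] := bu.
  have bcu : bounded_support1 (fun t => c * u t).
    split; first exact: measurable_funM.
    exists (c * M), b; split=> //; first by rewrite mulr_ge0// ltW.
    move=> t; have [/andP[u0 uM] ub] := uP t; split.
      by apply/andP; split; [exact: mulr_ge0 (ltW c0) u0|rewrite ler_pM2l].
    by rewrite mulf_eq0 negb_or => /andP[_]; exact: ub.
  split=> //; apply: EFin_inj; rewrite -bounded_support1_fin// EFinM.
  rewrite -bounded_support1_fin//.
  under eq_integral do rewrite EFinM.
  rewrite ge0_integralZl_EFin ?(ltW c0)//; first by move=> t _; rewrite lee_fin ge0.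
  exact/measurable_EFinP.
set F := sup (range f) in f0; set G := sup (range g) in g0.
(* Dividing [f], [g], [h] by [F], [G], [K] preserves the hypothesis and normalises both suprema;
   [weighted_AM_GM] then turns the arithmetic mean of the integrals into a geometric one. *)
pose K := F `^ l * G `^ (1 - l).
have K0 : 0 < K by rewrite mulr_gt0// powR_gt0.
have [bf' If] := scale f F^-1 (etrans (invr_gt0 F) f0) bf.
have [bg' Ig] := scale g G^-1 (etrans (invr_gt0 G) g0) bg.
have [bh' Ih] := scale h K^-1 (etrans (invr_gt0 K) K0) bh.
have inv (z r : R) : 0 < z -> z^-1 `^ r = (z `^ r)^-1.
  by move=> z0; rewrite -(powR_inv1 (ltW z0)) -(powR_inv1 (powR_ge0 _ _)) powRAC.
have N : l * (F^-1 * \int[mu]_t f t) + (1 - l) * (G^-1 * \int[mu]_t g t) <=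
    K^-1 * \int[mu]_t h t.
  rewrite -If -Ig -Ih; apply: (prekopa_leindler_normalized l01 bf' bg' bh').
  - by move=> t; rewrite mulrC ler_pdivrMr// mul1r ubP.
  - by move=> t; rewrite mulrC ler_pdivrMr// mul1r ubP.
  - move=> e e1; have eF : e * F < F by rewrite gtr_pMl.
    rewrite -subr_gt0 in eF; have [_ [t _ <-] ht] := sup_adherent eF (supP f bf).
    exists t; rewrite mulrC ltr_pdivlMr//.
    by apply: le_lt_trans ht; rewrite -/F; lra.
  - move=> e e1; have eG : e * G < G by rewrite gtr_pMl.
    rewrite -subr_gt0 in eG; have [_ [t _ <-] ht] := sup_adherent eG (supP g bg).
    exists t; rewrite mulrC ltr_pdivlMr//.
    by apply: le_lt_trans ht; rewrite -/G; lra.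
  - move=> x y; rewrite !powRM ?invr_ge0 ?(ltW f0) ?(ltW g0) ?ge0//.
    have -> : F^-1 `^ l * f x `^ l * (G^-1 `^ (1 - l) * g y `^ (1 - l)) =
        K^-1 * (f x `^ l * g y `^ (1 - l)).
      by rewrite !inv// /K invfM; ring.
    by rewrite ler_pM2l ?invr_gt0.
have A := weighted_AM_GM l01 (mulr_ge0 (ltW (etrans (invr_gt0 F) f0)) (Ige0 f bf))
  (mulr_ge0 (ltW (etrans (invr_gt0 G) g0)) (Ige0 g bg)).
have {N} := le_trans A N.
rewrite !powRM ?Ige0 ?invr_ge0 ?(ltW f0) ?(ltW g0)// !inv//.
by rewrite mulrACA -invfM -/K ler_pM2l ?invr_gt0.
Qed.

Definition tuple_conv n (l : R) (x y : T n) : T n :=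
  [tuple l * (tnth x i : R) + (1 - l) * (tnth y i : R) | i < n].

Lemma tuple_conv_cons n l (x y : T n) (s t : R) :
  tuple_conv l (tuple_cons (x, s)) (tuple_cons (y, t)) =
  tuple_cons (tuple_conv l x y, l * s + (1 - l) * t).
Proof.
apply: eq_from_tnth => i; rewrite tnth_mktuple.
have [->|i0] := eqVneq i ord0; first by rewrite !tnth0.
have [j ->] : exists j, i = lift ord0 j.
  by have [j|] := unliftP ord0 i; [exists j|move/eqP: i0].
by rewrite !tnthS tnth_mktuple.
Qed.

Lemma bounded_support_head n (f : T n.+1 -> R) t :
  bounded_support f -> bounded_support (fun s => f (tuple_cons (s, t))).
Proof.
move=> [mf [M [b [M0 b0 fP]]]]; split.
  by apply: measurableT_comp => //; exact: measurable_tuple_consl.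
exists M, b; split=> // y; have [f0 fb] := fP (tuple_cons (y, t)).
by split=> // /fb /cubeS[].
Qed.

Lemma bounded_support_tail n (f : T n.+1 -> R) : bounded_support f ->
  bounded_support1 (fun t => \int[lebesgue_tuple n]_s f (tuple_cons (s, t))) /\
  \int[mu]_t \int[lebesgue_tuple n]_s f (tuple_cons (s, t)) =
  \int[lebesgue_tuple n.+1]_y f y.
Proof.
move=> bf; have [mf [M [b [M0 b0 fP]]]] := bf.
have mf' : measurable_fun setT (fun y => (f y)%:E) by exact/measurable_EFinP.
have f0 y : (0 <= (f y)%:E)%E by rewrite lee_fin; have [/andP[]] := fP y.
have b1 : bounded_support1 (fun t => \int[lebesgue_tuple n]_s f (tuple_cons (s, t))).
  split.
    apply: measurableT_comp => //; exact: (measurable_integral_tail mf' f0).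
  exists (M * (2 * b) ^+ n), b; split=> //.
    by rewrite mulr_ge0// exprn_ge0// mulr_ge0.
  move=> t; have [mft _] := bounded_support_head t bf.
  have := @bounded_support_integral n (fun s => f (tuple_cons (s, t))) M b mft M0 b0.
  rewrite (bounded_support_fin (bounded_support_head t bf)) => h; split.
    rewrite -!lee_fin; apply: h => y; have [fy fb] := fP (tuple_cons (y, t)).
    by split=> // /fb /cubeS[].
  apply: contraNT; rewrite -ltNge => tb; rewrite /Rintegral.
  rewrite (eq_integral (fun=> 0%E)) ?integral0// => s _.
  have [_ fb] := fP (tuple_cons (s, t)); congr EFin.
  by apply/eqP/negP => /negP /fb /cubeS[]; rewrite leNgt tb.
split=> //; apply: EFin_inj; rewrite -bounded_support1_fin// -bounded_support_fin//.
rewrite (integral_lebesgue_tupleS_swap mf' f0).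
by apply: eq_integral => t _; rewrite -bounded_support_fin//; exact: bounded_support_head.
Qed.

(** The induction hypothesis applied to slices with frozen heads s and t says precisely that the
    marginals in the first coordinate satisfy the hypothesis of [prekopa_leindler1]. *)
Theorem prekopa_leindler n (l : R) (f g h : T n -> R) : 0 < l < 1 ->
  bounded_support f -> bounded_support g -> bounded_support h ->
  (forall x y, f x `^ l * g y `^ (1 - l) <= h (tuple_conv l x y)) ->
  (\int[lebesgue_tuple n]_y f y) `^ l * (\int[lebesgue_tuple n]_y g y) `^ (1 - l) <=
  \int[lebesgue_tuple n]_y h y.
Proof.
move=> l01; elim: n f g h => [|n IH] f g h bf bg bh fgh.
  have I0 (u : T 0 -> R) : bounded_support u ->
      \int[lebesgue_tuple 0]_y u y = u [tuple].
    move=> [mu_ _]; rewrite /Rintegral integral_dirac//=; last exact/measurable_EFinP.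
    by rewrite indicE in_setT mul1r.
  by rewrite !I0// (le_trans (fgh _ _))// (tuple0 (tuple_conv _ _ _)).
have [bf1 <-] := bounded_support_tail bf.
have [bg1 <-] := bounded_support_tail bg.
have [bh1 <-] := bounded_support_tail bh.
apply: prekopa_leindler1 => // s t.
apply: IH => [|||x y]; try exact: bounded_support_head.
by rewrite -tuple_conv_cons.
Qed.

End bounded_support.

(** * The Riesz kernel *)

Section riesz_kernel.
Context {R : realType}.
Implicit Types (a r s l x y : R) (N : nat).

Lemma Gamma_gt0 a : 0 < a < 1 -> 0 < Gamma (1 + a).
Proof.
move=> /andP[a0 a1]; rewrite /Gamma /Rintegral.
pose f (x : measurableTypeR R) : R := (x : R) `^ (1 + a - 1) * expR (- (x : R)).
have mf : measurable_fun setT f.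
  apply: measurable_funM; first exact: measurable_powR.
  exact: measurableT_comp.
have f0 x : 0 <= f x by rewrite mulr_ge0 ?powR_ge0 ?expR_ge0.
pose I : set (measurableTypeR R) := `]0, +oo[%classic.
have mI : measurable I by exact: measurable_itv.
(* Positivity requires finiteness, because [fine] sends an infinite integral to 0. The majorant
   comes from x^a <= 1 + x <= 2 e^(x/2). Below, the integrand is at least e^(-2) on [1, 2]. *)
have ub : (\int[lebesgue_measure]_(x in I) (f x)%:E <= 4%:E)%E.
  apply: (@le_trans _ _ (\int[lebesgue_measure]_x (4%:E * (exponential_pdf 2^-1 x)%:E)))%E.
    rewrite integral_mkcond; apply: ge0_le_integral => //.
    - by move=> x _; apply: erestrict_ge0 => z _; rewrite lee_fin.
    - apply/(measurable_restrictT _ _).1 => //; apply: measurable_funTS.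
      exact/measurable_EFinP.
    - apply/measurable_EFinP; apply: measurable_funM => //.
      exact: measurable_exponential_pdf.
    move=> x _; rewrite patchE; case: ifPn => [|_]; last first.
      by rewrite -EFinM lee_fin mulr_ge0// exponential_pdf_ge0.
    rewrite inE /I /= in_itv/= andbT => x0.
    rewrite -EFinM lee_fin (exponential_pdfE _ (ltW x0)) /f.
    rewrite (_ : 1 + a - 1 = a); last by ring.
    have xa : (x : R) `^ a <= 2 * expR (x / 2).
      apply: (@le_trans _ _ (1 + x)).
        have [x1|x1] := lerP x 1.
          apply: (@le_trans _ _ 1); last by rewrite lerDl ltW.
          have <- : 1 `^ a = 1 :> R by rewrite powR1.
          by apply: (ge0_ler_powR (ltW a0)) => //; rewrite nnegrE ltW.
        apply: (@le_trans _ _ x); last by rewrite lerDr.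
        by rewrite ler1_powR// ltW.
      have := expR_ge1Dx (x / 2); have := expR_gt0 (x / 2); lra.
    apply: (@le_trans _ _ (2 * expR (x / 2) * expR (- x))).
      by rewrite ler_wpM2r ?expR_ge0.
    by rewrite -mulrA -expRD (_ : x / 2 - x = - 2^-1 * x); [lra|field].
  rewrite ge0_integralZl_EFin//; last 2 first.
  - by move=> x _; rewrite lee_fin exponential_pdf_ge0.
  - by apply/measurable_EFinP; exact: measurable_exponential_pdf.
  by rewrite integral_exponential_pdf// mule1.
rewrite fine_gt0// (le_lt_trans ub) ?ltry ?andbT//.
pose J : set (measurableTypeR R) := `[1, 2]%classic.
have mJ : measurable J by exact: measurable_itv.
have JI : J `<=` I.
  by move=> x; rewrite /J /I /= !in_itv/= andbT => /andP[x1 _]; exact: lt_le_trans x1.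
have muJ : lebesgue_measure J = 1%:E.
  by rewrite /J lebesgue_measure_itv/= lte_fin ltr1n -EFinD; congr EFin; lra.
apply: (@lt_le_trans _ _ (\int[lebesgue_measure]_(x in J) (f x)%:E)%E); last first.
  apply: ge0_subset_integral => //.
  - by apply: measurable_funTS; exact/measurable_EFinP.
  - by move=> x _; rewrite lee_fin.
apply: (@lt_le_trans _ _ (\int[lebesgue_measure]_(x in J) (cst (expR (- 2))%:E) x)%E).
  rewrite integral_cst// -[X in (_ < _ * X)%E]/(lebesgue_measure J) muJ mule1.
  by rewrite lte_fin expR_gt0.
apply: ge0_le_integral => //.
- by move=> x _; rewrite lee_fin expR_ge0.
- by apply: measurable_funTS; exact/measurable_EFinP.
move=> x; rewrite /J /= in_itv/= => /andP[x1 x2]; rewrite lee_fin /f.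
apply: (@le_trans _ _ (1 * expR (- (x : R)))).
  by rewrite mul1r ler_expR lerN2.
have h1 : 1 `^ a = 1 :> R by rewrite powR1.
rewrite ler_wpM2r ?expR_ge0// (_ : 1 + a - 1 = a); last by ring.
have x0 : 0 <= x by exact: le_trans x1.
by rewrite -[leLHS]h1; apply: (ge0_ler_powR (ltW a0)); rewrite ?nnegrE.
Qed.

Lemma riesz_const_gt0 a : 0 < a < 1 -> 0 < riesz_const a.
Proof.
move=> ha; have /andP[a0 a1] := ha.
rewrite /riesz_const divr_gt0//; last by rewrite powR_gt0// mulr_gt0// pi_gt0.
rewrite mulr_gt0//; first by rewrite mulr_gt0// Gamma_gt0.
have p0 := pi_gt0 R.
have pa : 0 < pi * a by rewrite mulr_gt0.
have pa1 : pi * a < pi by rewrite gtr_pMr.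
by rewrite sin_gt0_pi//; lra.
Qed.

Lemma riesz_kernelE a N r : 0 < a < 1 -> (0 < N)%N ->
  riesz_kernel a N r =
  2 * riesz_const a * N%:R `^ a * riemann_cos a (2 * pi / N%:R * r).
Proof.
move=> ha N0; rewrite /riesz_kernel.
suff -> : limn (fun n => complex.Re (fourier_partial a N r n)) =
    2 * riemann_cos a (2 * pi / N%:R * r) by ring.
apply: (cvg_lim (@Rhausdorff R)).
pose u := series (fun k => cos (k%:R * (2 * pi / N%:R * r)) / k%:R `^ (1 + a)).
have cu : (fun n => 2 * u n.+1) @ \oo --> 2 * riemann_cos a (2 * pi / N%:R * r).
  apply: cvgM; first exact: cvg_cst.
  by rewrite (cvg_shiftS u); exact: cvg_riemann_cos.
rewrite (_ : (fun n => complex.Re _) = (fun n => 2 * u n.+1))//.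
apply/funext => n; rewrite fourier_partialE /= /u /series /= [in RHS]big_nat_recl//=.
rewrite powR0 ?invr0 ?mulr0 ?add0r; last by have := ha; lra.
rewrite big_add1 /= mulr_sumr; apply: eq_bigr => k _.
rewrite [RHS]mulrA; congr (2 * cos _ / _); ring.
Qed.

Lemma riemann_cos_bounded a t : 0 < a < 1 ->
  `|riemann_cos a t| <= limn (series (fun k => (k%:R `^ (1 + a))^-1)).
Proof.
move=> ha; have := @dominated_series_tail R
  (fun k => cos (k%:R * t) / k%:R `^ (1 + a)) _ 0%N (cvg_riemann_series ha).
rewrite /series /= !big_geq// !subr0; apply => k.
rewrite normrM normfV (ger0_norm (powR_ge0 _ _)) ler_piMl ?invr_ge0 ?powR_ge0//.
exact: cos_max.
Qed.

Lemma riesz_kernel_bounded a N : 0 < a < 1 -> (0 < N)%N ->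
  exists B, forall r, `|riesz_kernel a N r| <= B.
Proof.
move=> ha N0.
exists (2 * riesz_const a * N%:R `^ a * limn (series (fun k => (k%:R `^ (1 + a))^-1))) => r.
have c0 := riesz_const_gt0 ha.
have k0 : 0 <= 2 * riesz_const a * N%:R `^ a.
  by rewrite mulr_ge0 ?powR_ge0// mulr_ge0// ltW.
by rewrite riesz_kernelE// normrM (ger0_norm k0) ler_wpM2l// riemann_cos_bounded.
Qed.

Lemma riesz_kernel_reflect a N r : 0 < a < 1 -> (0 < N)%N ->
  riesz_kernel a N (N%:R - r) = riesz_kernel a N r.
Proof.
move=> ha N0; rewrite !riesz_kernelE//; congr (_ * _).
rewrite /riemann_cos; congr (limn (series _)); apply/funext => k; congr (_ / _).
have -> : k%:R * (2 * pi / N%:R * (N%:R - r)) = - (k%:R * (2 * pi / N%:R * r)) + (pi *+ 2) *+ k.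
  rewrite mulrBr divfK ?pnatr_eq0 -?lt0n// mulrBr addrC; congr (_ + _).
  by rewrite -[RHS]mulr_natr -[pi *+ 2]mulr_natr; ring.
by rewrite (periodicn (@cosD2pi R)) cosN.
Qed.

(** The factor N^a of the kernel is exactly what makes [c] independent of [N]: with q = 2 pi / N,
    rescaling the variables produces N^a q^2 q^(a-2) = (2 pi)^a. *)
Lemma riesz_kernel_strongly_convex a : 0 < a < 1 ->
  exists2 c : R, 0 < c & forall N l r s, (0 < N)%N -> 0 <= l <= 1 ->
    0 < r < N%:R -> 0 < s < N%:R ->
    c * (l * (1 - l) * (r - s) ^+ 2) * Num.max r s `^ (a - 2) <=
    convexity_gap l r s (riesz_kernel a N).
Proof.
move=> ha; have [c c0 hc] := @riemann_cos_strongly_convex R a ha.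
have k0 := riesz_const_gt0 ha.
have p0 := pi_gt0 R.
exists (2 * riesz_const a * c * (2 * pi) `^ a).
  apply: mulr_gt0; last by rewrite powR_gt0// mulr_gt0.
  by apply: mulr_gt0 => //; apply: mulr_gt0.
move=> N l r s N0 l01 r0N s0N.
have NR : 0 < N%:R :> R by rewrite ltr0n.
pose q : R := 2 * pi / N%:R.
have q0 : 0 < q by rewrite divr_gt0 ?mulr_gt0.
have inq t : 0 < t < N%:R -> 0 < q * t < 2 * pi.
  move=> /andP[t0 tN]; rewrite mulr_gt0//= /q mulrAC ltr_pdivrMr//.
  by rewrite ltr_pM2l// mulr_gt0.
have -> : convexity_gap l r s (riesz_kernel a N) =
    2 * riesz_const a * N%:R `^ a * convexity_gap l (q * r) (q * s) (riemann_cos a).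
  rewrite /convexity_gap !riesz_kernelE// -/q.
  rewrite (_ : l * (q * r) + (1 - l) * (q * s) = q * (l * r + (1 - l) * s)); last by ring.
  ring.
have := hc l (q * r) (q * s) l01 (inq r r0N) (inq s s0N).
rewrite -maxr_pMr ?(ltW q0)// -mulrBr exprMn.
have m0 : 0 <= Num.max r s by rewrite le_max; case/andP: r0N => /ltW ->.
rewrite (powRM _ (ltW q0) m0) => h.
apply: (@le_trans _ _ (2 * riesz_const a * N%:R `^ a * (c * (l * (1 - l) * (q ^+ 2 * (r - s) ^+ 2)) *
   (q `^ (a - 2) * Num.max r s `^ (a - 2))))); last first.
  by rewrite ler_wpM2l// mulr_ge0 ?powR_ge0// mulr_ge0// ltW.
have E : N%:R `^ a * (q ^+ 2 * q `^ (a - 2)) = (2 * pi) `^ a.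
  rewrite -powR_mulrn ?(ltW q0)// -powRD; last by rewrite (gt_eqF q0) implybT.
  rewrite (_ : 2%:R + (a - 2) = a); last by ring.
  by rewrite -powRM ?(ltW q0) ?(ltW NR)// /q mulrC divfK ?gt_eqF.
rewrite -E le_eqVlt; apply/orP; left; apply/eqP; ring.
Qed.

End riesz_kernel.

(** * Borell's lemma *)

Section borell.
Context d (T : measurableType d) {R : realType} (P : probability T R).
Local Notation MR := (measurableTypeR R).

(** Log-concavity in Borell's sense, for laws that may lack a known density. [K] stands for any
    measurable set containing the Minkowski combination of [I] and [J]. *)
Definition log_concave_law (X : T -> R) : Prop :=
  forall (l : R) (I J K : set MR), 0 < l < 1 ->
    measurable I -> measurable J -> measurable K ->
    (forall r s : R, I r -> J s -> K (l * r + (1 - l) * s)) ->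
    fine (P (X @^-1` I)) `^ l * fine (P (X @^-1` J)) `^ (1 - l) <=
    fine (P (X @^-1` K)).

Lemma log_concave_law_shift (X : T -> R) (c : R) :
  log_concave_law X -> log_concave_law (fun x => X x - c).
Proof.
move=> XP l I J K l01 mI mJ mK IJK.
have msh (A : set MR) : measurable A -> measurable ((fun r : R => r - c) @^-1` A : set MR).
  move=> mA; rewrite -[X in measurable X]setTI.
  have : measurable_fun setT (fun r : MR => (r : R) - c : MR) by exact: measurable_funB.
  exact.
apply: (XP l ((fun r : R => r - c) @^-1` I) ((fun r : R => r - c) @^-1` J)
  ((fun r : R => r - c) @^-1` K) l01); try exact: msh.
move=> r s Ir Js /=.
have := IJK _ _ Ir Js.
by rewrite (_ : l * (r - c) + _ = l * r + (1 - l) * s - c)//; ring.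
Qed.

Let fine_le (A : set T) (r : R) : measurable A -> (P A <= r%:E)%E -> fine (P A) <= r.
Proof.
move=> mA Ar; rewrite -lee_fin fineK//.
exact: fin_num_measure.
Qed.

Lemma measurable_abs_gt (X : T -> R) (t : R) : measurable_fun setT X ->
  measurable [set x | t < `|X x|].
Proof.
move=> mX; rewrite -[X in measurable X]setTI.
have h : measurable_fun setT (fun x => t < `|X x|).
  by apply: measurable_fun_ltr => //; exact: measurableT_comp.
exact: (h measurableT [set true]).
Qed.

Let abs_conv_gt (l s t r u : R) : 0 < l < 1 -> t < `|r| -> `|u| <= s ->
  l * t = s + (1 - l) * s -> s < `|l * r + (1 - l) * u|.
Proof.
move=> /andP[l0 l1] tr us e.
have l1' : 0 <= 1 - l by lra.
have h1 : `|l * r| <= `|l * r + (1 - l) * u| + `|(1 - l) * u|.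
  rewrite -[X in `|X| <= _](addrK ((1 - l) * u)); exact: ler_normB.
move: h1; rewrite 2!normrM (ger0_norm (ltW l0)) (ger0_norm l1') => h1.
have h2 : l * t < l * `|r| by rewrite ltr_pM2l.
have h3 : (1 - l) * `|u| <= (1 - l) * s by rewrite ler_wpM2l.
lra.
Qed.

(** A combination of a point beyond t and a point within s still lies beyond s. With p the tail at
    t, this gives p^l (3/4)^(1-l) <= 1/4, that is p <= (3/4) 3^(-1/l), and 1/l = t / (2 s) + 1/2.
    For t <= s the bound is trivial, because 2 / sqrt 3 >= 1. *)
Lemma borell_tail (X : T -> R) (s t : R) : measurable_fun setT X ->
  log_concave_law X -> 0 < s -> (P [set x | (s < `|X x|)%R] <= (4^-1)%:E)%E -> 0 <= t ->
  (P [set x | (t < `|X x|)%R] <= (2 * expR (- (ln 3 / 2 * (t / s))))%:E)%E.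
Proof.
move=> mX XP s0 Ps t0.
have ln3 : 0 < ln 3 :> R by rewrite ln_gt0// ltr1n.
have [ts|st] := leP t s.
  apply: (le_trans (probability_le1 _ _)); first exact: measurable_abs_gt.
  rewrite lee_fin.
  have h1 : expR (- (ln 3 / 2)) <= expR (- (ln 3 / 2 * (t / s))).
    by rewrite ler_expR lerN2 ler_piMr ?divr_ge0 ?(ltW ln3)// ler_pdivrMr// mul1r.
  have h2 : 2^-1 <= expR (- (ln 3 / 2)) :> R.
    rewrite -[leLHS](@ger0_norm R)// -[leRHS](ger0_norm (expR_ge0 _)) -ler_sqr ?nnegrE//.
    rewrite !real_normK ?num_real// -expRM_natl.
    rewrite (_ : 2%:R * - (ln 3 / 2) = - ln 3); last by field.
    by rewrite expRN lnK ?posrE// expr2 -invfM lef_pV2 ?posrE//; lra.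
  lra.
have ms u : measurable [set x | (u < `|X x|)%R] by exact: measurable_abs_gt.
(* The solution of l t - (1 - l) s = s. *)
pose l := 2 * s / (t + s).
have ts0 : 0 < t + s by lra.
have l0 : 0 < l by rewrite divr_gt0// mulr_gt0.
have l1 : l < 1 by rewrite ltr_pdivrMr//; lra.
pose I : set MR := [set r | t < `|r : R|].
pose J : set MR := [set r | `|r : R| <= s].
pose K : set MR := [set r | s < `|r : R|].
have mgt u : measurable [set r : MR | u < `|r : R|].
  rewrite -[X in measurable X]setTI.
  have h : measurable_fun setT (fun r : MR => u < `|r : R|) by apply: measurable_fun_ltr.
  exact: (h measurableT [set true]).
have mJ : measurable J.
  rewrite (_ : J = ~` K); first by apply: measurableC; exact: mgt.
  apply/seteqP; split=> r; rewrite /J /K /=; first by rewrite leNgt => /negP.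
  by move=> /negP; rewrite -leNgt.
have l01 : 0 < l < 1 by rewrite l0.
have := XP l I J K l01 (mgt t) mJ (mgt s).
set p := fine (P (X @^-1` I)).
have PJ : 3 / 4 <= fine (P (X @^-1` J)).
  have -> : X @^-1` J = ~` [set x | s < `|X x|].
    apply/seteqP; split=> x /=; rewrite /J /=; first by rewrite leNgt => /negP.
    by move=> /negP; rewrite -leNgt.
  rewrite probability_setC// fineB ?fin_num_measure//=.
  by have := fine_le (ms s) Ps; lra.
move=> H.
have {}H : p `^ l * fine (P (X @^-1` J)) `^ (1 - l) <= 4^-1.
  apply: le_trans (fine_le (ms s) Ps); apply: H => r u; rewrite /I /J /K /= => tr us.
  have e : l * t = s + (1 - l) * s by rewrite /l; field; rewrite gt_eqF.
  exact: (@abs_conv_gt l s t r u l01 tr us e).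
have p0 : 0 <= p by exact: fine_ge0.
suff : p <= 2 * expR (- (ln 3 / 2 * (t / s))).
  by rewrite -lee_fin fineK// fin_num_measure//; exact: ms.
have {}H : p `^ l <= 3^-1 * (3 / 4) `^ l.
  have q0 : 0 < (3 / 4) `^ (1 - l) :> R by rewrite powR_gt0.
  have : p `^ l * (3 / 4) `^ (1 - l) <= 4^-1.
    apply: le_trans H; rewrite ler_wpM2l ?powR_ge0// ge0_ler_powR ?nnegrE ?subr_ge0 ?(ltW l1)//.
    by exact: le_trans PJ.
  rewrite -ler_pdivlMr// => /le_trans; apply.
  rewrite ler_pdivrMr// -mulrA -powRD ?subrKC ?powRr1//; first by lra.
  by rewrite oner_eq0.
have {}H : p <= (3^-1 * (3 / 4) `^ l) `^ l^-1.
  rewrite [leLHS](_ : p = (p `^ l) `^ l^-1); last first.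
    by rewrite -powRrM divff ?powRr1// gt_eqF.
  have li : 0 <= l^-1 by rewrite invr_ge0 ltW.
  have q0 : 0 <= 3^-1 * (3 / 4) `^ l by apply: mulr_ge0 => //; exact: powR_ge0.
  by apply: (ge0_ler_powR li) => //; rewrite nnegrE; exact: powR_ge0.
apply: (le_trans H).
rewrite powRM ?powR_ge0// -powRrM divff ?gt_eqF// powRr1//.
have -> : 3^-1 `^ l^-1 = expR (- (ln 3 * l^-1)) :> R.
  by rewrite /powR invr_eq0 pnatr_eq0 /= lnV ?posrE// mulrN mulrC.
rewrite (_ : ln 3 * l^-1 = ln 3 / 2 * (t / s) + ln 3 / 2); last first.
  by rewrite /l; field; rewrite !gt_eqF.
rewrite opprD expRD -mulrA mulrC.
have e0 := expR_gt0 (- (ln 3 / 2 * (t / s))).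
have e1 : expR (- (ln 3 / 2)) <= 1 :> R by rewrite expR_le1 oppr_le0 divr_ge0// ltW.
by rewrite ler_pM2r//; lra.
Qed.

Lemma integral_inv_square :
  (\int[lebesgue_measure]_(t in `[1%R, +oo[) (t `^ (- 2))%:E = 1%:E :> \bar R)%E.
Proof.
have dV (t : R) : 0 < t -> is_derive t 1 (fun u : R => - (u `^ (- 1))) (t `^ (- 2)).
  move=> t0; have h := is_derive1_powR (- 1) t0.
  apply: is_derive_eq.
  by rewrite mulN1r opprK; congr (_ `^ _); ring.
rewrite (@ge0_continuous_FTC2y _ _ (fun t : R => - (t `^ (- 1))) _ 0).
- by rewrite powR1 -EFinB opprK add0r.
- by move=> x _; rewrite powR_ge0.
- apply: derivable_within_continuous => t; rewrite in_itv/= andbT => t1.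
  by have [] := is_derive1_powR (- 2) (lt_le_trans ltr01 t1).
- rewrite -oppr0; apply: cvgN.
  have h : (fun t : R => t^-1) t @[t --> +oo%R] --> (0 : R).
    apply/gtr0_cvgV0; last exact: cvg_id.
    by near=> x; near: x; exact: nbhs_pinfty_gt.
  apply: cvg_trans h; apply: near_eq_cvg; near=> x.
  by rewrite powR_inv1//; near: x; exact: nbhs_pinfty_ge.
- by move=> x x1; have [] := dV x (lt_trans ltr01 x1).
- apply: cvg_at_right_filter; have [h _] := dV 1 ltr01.
  have /differentiable_continuous c : differentiable (fun u : R^o => - (u `^ (- 1)) : R^o) (1 : R^o).
    exact/derivable1_diffP.
  exact: c.
- move=> t; rewrite in_itv/= andbT => t1; rewrite derive1E.
  by have [] := dV t (lt_trans ltr01 t1).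
Unshelve. all: by end_near. Qed.

(** The exponent is half the rate of [borell_tail], so a level t >= 1 is exceeded with probability
    at most 2 t^(-2). Integrating over levels gives 1 + 2 = 3. *)
Lemma borell_exp (X : T -> R) (s : R) : measurable_fun setT X ->
  log_concave_law X -> 0 < s -> (P [set x | (s < `|X x|)%R] <= (4^-1)%:E)%E ->
  (\int[P]_x (expR (ln 3 / 4 * (`|X x| / s)))%:E <= 3%:E)%E.
Proof.
move=> mX XP s0 Ps.
have ln3 : 0 < ln 3 :> R by rewrite ln_gt0// ltr1n.
pose f x := expR (ln 3 / 4 * (`|X x| / s)).
have mf : measurable_fun setT f.
  apply: measurableT_comp => //; apply: measurable_funM => //.
  by apply: measurable_funM => //; exact: measurableT_comp.
have f0 x : 0 <= f x by exact: expR_ge0.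
rewrite (layer_cake P mf f0).
pose I0 : set MR := `[0, 1[%classic; pose I1 : set MR := `[1, +oo[%classic.
pose g (t : MR) : R := \1_I0 t + 2 * (\1_I1 t * (t : R) `^ (- 2)).
have minv : measurable_fun setT (fun t : MR => (t : R) `^ (- 2)).
  exact: measurable_powR.
have g1m : measurable_fun setT (fun t : MR => \1_I1 t * (t : R) `^ (- 2)).
  by apply: measurable_funM => //; apply: measurable_indic; exact: measurable_itv.
have g0 t : 0 <= g t by rewrite addr_ge0// mulr_ge0// mulr_ge0// powR_ge0.
have mg : measurable_fun setT g.
  by apply: measurable_funD; [apply: measurable_indic; exact: measurable_itv|exact: measurable_funM].
have mlevel : measurable_fun setT (fun t : MR => P [set x | (0 <= (t : R) < f x)%R]).
  exact: (measurable_fun_superlevel P).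
have mlevelt (t : R) : measurable [set x | (0 <= t < f x)%R].
  exact: measurable_superlevel.
apply: (@le_trans _ _ (\int[lebesgue_measure]_t (g t)%:E)%E).
  apply: ge0_le_integral => //.
  - exact/measurable_EFinP.
  move=> t _; have [t0|t0] := ltP (t : R) 0.
    rewrite (_ : [set x | _] = set0) ?measure0 ?lee_fin//.
    by apply/seteqP; split=> x //=; rewrite leNgt t0.
  have [t1|t1] := ltP (t : R) 1.
    apply: (le_trans (probability_le1 _ _)); first by have := mlevelt t; rewrite t0.
    rewrite lee_fin /g [\1_I0 t]indicE mem_set ?lerDl ?mulr_ge0 ?powR_ge0//.
    by rewrite /I0 /= in_itv/= t0.
  rewrite (_ : [set x | _] = [set x | (s * (4 / ln 3 * ln t) < `|X x|)%R]); last first.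
    have t00 : 0 < (t : R) by exact: lt_le_trans t1.
    have e x : ((t : R) < f x) = (s * (4 / ln 3 * ln t) < `|X x|).
      rewrite /f -ltr_ln ?posrE ?expR_gt0// expRK [ln 3 / 4 * _]mulrA ltr_pdivlMr//.
      rewrite -[in RHS](ltr_pM2l (divr_gt0 ln3 (ltr0n R 4))).
      by congr (_ < _); field; rewrite gt_eqF.
    by apply/seteqP; split=> x /=; rewrite e.
  apply: (le_trans (borell_tail mX XP s0 Ps _)).
    by rewrite mulr_ge0 ?(ltW s0)// mulr_ge0 ?divr_ge0 ?(ltW ln3)// ln_ge0.
  have t00 : 0 < (t : R) by exact: lt_le_trans t1.
  rewrite lee_fin /g [\1_I1 t]indicE mem_set ?mul1r; last by rewrite /I1 /= in_itv/= t1.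
  apply: ler_wpDl => //; rewrite ler_pM2l//.
  rewrite /powR gt_eqF// ler_expR le_eqVlt; apply/orP; left; apply/eqP.
  by field; rewrite !gt_eqF.
rewrite /g; under eq_integral do rewrite EFinD.
rewrite ge0_integralD//; last 3 first.
- by apply/measurable_EFinP; apply: measurable_indic; exact: measurable_itv.
- by move=> t _; rewrite lee_fin mulr_ge0// mulr_ge0// powR_ge0.
- by apply/measurable_EFinP; exact: measurable_funM.
under [X in (_ + X)%E]eq_integral do rewrite EFinM.
rewrite ge0_integralZl_EFin//; last 2 first.
- by move=> t _; rewrite lee_fin mulr_ge0// powR_ge0.
- exact/measurable_EFinP.
have -> : (\int[lebesgue_measure]_t (\1_I1 t * (t : R) `^ (- 2))%:E)%E = 1%:E :> \bar R.
  rewrite -integral_inv_square [RHS]integral_mkcond; apply: eq_integral => t _.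
  by rewrite patchE indicE; case: ifP => _; rewrite ?mul1r ?mul0r.
have -> : (\int[lebesgue_measure]_t (\1_I0 t)%:E)%E = 1%:E :> \bar R.
  have mI0 : measurable I0 by exact: measurable_itv.
  rewrite (integral_indic _ measurableT mI0) setIT.
  by rewrite -[LHS]/(lebesgue_measure I0) /I0 lebesgue_measure_itv/= lte_fin ltr01 sube0.
by rewrite -EFinM -EFinD lee_fin; lra.
Qed.

Lemma borell_moment2 (X : T -> R) (s : R) : measurable_fun setT X ->
  log_concave_law X -> 0 < s -> (P [set x | (s < `|X x|)%R] <= (4^-1)%:E)%E ->
  (\int[P]_x ((X x) ^+ 2)%:E <= (192 / (ln 3) ^+ 2 * s ^+ 2)%:E)%E.
Proof.
move=> mX XP s0 Ps.
have ln3 : 0 < ln 3 :> R by rewrite ln_gt0// ltr1n.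
(* With v = (ln 3 / 4) |X| / s, the square of X equals C (v/2)^2, and (v/2)^2 <= e^v. The 3 of
   [borell_exp] then yields 192. *)
pose C : R := 64 / (ln 3) ^+ 2 * s ^+ 2.
have C0 : 0 <= C by rewrite mulr_ge0 ?divr_ge0 ?sqr_ge0.
have le1 x : (X x) ^+ 2 <= C * expR (ln 3 / 4 * (`|X x| / s)).
  set v := ln 3 / 4 * (`|X x| / s).
  have v0 : 0 <= v by rewrite mulr_ge0 ?divr_ge0 ?(ltW ln3) ?(ltW s0).
  have e : (X x) ^+ 2 = C * (v / 2) ^+ 2.
    rewrite -[LHS]ger0_norm ?sqr_ge0// normrX /C /v.
    by field; rewrite !gt_eqF.
  rewrite e ler_wpM2l//.
  rewrite (_ : v = 2%:R * (v / 2)); last by field.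
  rewrite expRM_natl mulrC mulKf//.
  have h : v / 2 <= expR (v / 2) by have := expR_ge1Dx (v / 2); lra.
  by rewrite ler_sqr ?nnegrE ?expR_ge0// divr_ge0.
have me : measurable_fun setT (fun x => expR (ln 3 / 4 * (`|X x| / s))).
  apply: measurableT_comp => //; apply: measurable_funM => //.
  by apply: measurable_funM => //; exact: measurableT_comp.
apply: (@le_trans _ _ (\int[P]_x (C%:E * (expR (ln 3 / 4 * (`|X x| / s)))%:E))%E).
  apply: ge0_le_integral => //.
  - by move=> x _; rewrite lee_fin sqr_ge0.
  - by apply/measurable_EFinP; exact: measurable_funX.
  - by apply/measurable_EFinP; exact: measurable_funM.
  - by move=> x _; rewrite -EFinM lee_fin.
rewrite ge0_integralZl_EFin//; last exact/measurable_EFinP.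
apply: (@le_trans _ _ (C%:E * 3%:E)%E).
  by rewrite lee_wpmul2l ?lee_fin//; exact: borell_exp.
rewrite -EFinM lee_fin (_ : C * 3 = 192 / ln 3 ^+ 2 * s ^+ 2)// /C.
by field; rewrite gt_eqF.
Qed.

End borell.

(** * Energy and Palm law *)

Section simplex.
Context {R : realType}.
Local Notation T n := (n.-tuple (measurableTypeR R)).

Lemma particle0 n (y : T n) : particle y 0 = 0.
Proof. by []. Qed.

Lemma particle_conv n l (x y : T n) i :
  particle (tuple_conv l x y) i = l * particle x i + (1 - l) * particle y i.
Proof.
case: i => [|i]; first by rewrite !particle0 !mulr0 addr0.
rewrite !(_ : forall z : T n, particle z i.+1 = nth 0 z i)//.
have [ni|ni] := ltnP i n.
  by rewrite (nth_mktuple _ _ (Ordinal ni)) !(tnth_nth 0).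
by rewrite !nth_default ?size_tuple// !mulr0 addr0.
Qed.

Lemma simplexP n (y : T n) : simplex n.+1 y <->
  (forall i, (i < n)%N -> particle y i < particle y i.+1) /\ particle y n < n.+1%:R.
Proof.
have e i : (i < n)%N -> nth 0 (rcons y (n.+1%:R : R)) i = particle y i.+1.
  by move=> ni; rewrite /particle nth_rcons size_tuple ni.
have en : nth 0 (rcons y (n.+1%:R : R)) n = n.+1%:R.
  by rewrite nth_rcons size_tuple ltnn eqxx.
have e0 i : (i <= n)%N -> nth 0 (0 :: rcons y (n.+1%:R : R)) i = particle y i.
  by case: i => [//|i] ni; rewrite -e.
split=> [/(pathP 0) h|[h1 h2]]; last first.
  apply/(pathP 0) => i; rewrite size_rcons size_tuple ltnS => ni; rewrite e0//.
  by move: ni; rewrite leq_eqVlt => /predU1P[->|ni]; [rewrite en|rewrite e// h1].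
split=> [i ni|].
  by have := h i; rewrite size_rcons size_tuple ltnS (ltnW ni) e0 ?(ltnW ni)// e//; exact.
by have := h n; rewrite size_rcons size_tuple ltnSn e0// en; exact.
Qed.

Lemma simplex_lt n (y : T n) i j : simplex n.+1 y -> (i < j <= n)%N ->
  particle y i < particle y j.
Proof.
move=> /simplexP[h _] /andP[]; elim: j => // j IH; rewrite ltnS leq_eqVlt.
move=> /predU1P[->|ij] jn; first exact: h.
by apply: lt_trans (IH ij (ltnW jn)) _; exact: h.
Qed.

Lemma simplex_particle n (y : T n) i : simplex n.+1 y -> (i <= n)%N ->
  0 <= particle y i < n.+1%:R.
Proof.
move=> Sy ni; have /simplexP[_ h] := Sy; apply/andP; split.
  by case: i ni => // i ni; rewrite ltW// -(particle0 y) (simplex_lt Sy)//.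
by move: ni; rewrite leq_eqVlt => /predU1P[->//|ni]; apply: lt_trans h; rewrite (simplex_lt Sy)// ni /=.
Qed.

Lemma simplex_diff n (y : T n) i j : simplex n.+1 y -> (i < j <= n)%N ->
  0 < particle y j - particle y i < n.+1%:R.
Proof.
move=> Sy ij; rewrite subr_gt0 (simplex_lt Sy ij)/=.
have /andP[ij' jn] := ij.
have /andP[i0 _] := simplex_particle Sy (leq_trans (ltnW ij') jn).
have /andP[_ jN] := simplex_particle Sy jn.
by rewrite ltrBlDr; apply: lt_le_trans jN _; rewrite lerDl.
Qed.

Lemma simplex_conv n l (x y : T n) : 0 < l < 1 -> simplex n.+1 x -> simplex n.+1 y ->
  simplex n.+1 (tuple_conv l x y).
Proof.
move=> /andP[l0 l1] /simplexP[x1 x2] /simplexP[y1 y2].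
have l1' : 0 < 1 - l by rewrite subr_gt0.
apply/simplexP; split=> [i ni|]; rewrite !particle_conv.
  by apply: ltrD; rewrite ltr_pM2l//; [exact: x1|exact: y1].
rewrite -[ltRHS](_ : l * n.+1%:R + (1 - l) * n.+1%:R = _); last by ring.
by apply: ltrD; rewrite ltr_pM2l.
Qed.

Lemma simplex_cube n (y : T n) : simplex n.+1 y -> cube n n.+1%:R y.
Proof.
move=> Sy; apply/cube_tnth => i; rewrite (tnth_nth 0).
rewrite -[nth _ _ _]/(particle y i.+1).
by have /andP[h1 h2] := simplex_particle Sy (ltn_ord i); rewrite ger0_norm// ltW.
Qed.

Lemma energyE a n (y : T n) : energy a n.+1 y =
  \sum_(0 <= j < n.+1) \sum_(0 <= i < j) riesz_kernel a n.+1 (particle y j - particle y i).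
Proof.
rewrite big_mkord; apply: eq_bigr => j _; rewrite big_mkord.
by rewrite (big_ord_widen n.+1 (fun i => riesz_kernel a n.+1 (particle y j - particle y i))) // ltnW.
Qed.

Lemma energy_bounded a n : 0 < a < 1 -> exists2 B, 0 <= B & forall y : T n, `|energy a n.+1 y| <= B.
Proof.
move=> ha; have [B hB] := riesz_kernel_bounded (N := n.+1) ha isT.
have B0 : 0 <= B by apply: le_trans (hB 0).
exists (\sum_(j < n.+1) \sum_(i < n.+1 | (i < j)%N) B).
  by apply: sumr_ge0 => j _; apply: sumr_ge0.
move=> y; apply: le_trans (ler_norm_sum _ _ _) _; apply: ler_sum => j _.
by apply: le_trans (ler_norm_sum _ _ _) _; apply: ler_sum.
Qed.

Lemma energy_gap a : 0 < a < 1 -> exists2 c : R, 0 < c & forall n l (x y : T n),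
  0 < l < 1 -> simplex n.+1 x -> simplex n.+1 y ->
  c * (l * (1 - l)) * (\sum_(0 <= j < n.+1) \sum_(0 <= i < j)
    ((particle x j - particle x i) - (particle y j - particle y i)) ^+ 2 *
    Num.max (particle x j - particle x i) (particle y j - particle y i) `^ (a - 2)) <=
  l * energy a n.+1 x + (1 - l) * energy a n.+1 y - energy a n.+1 (tuple_conv l x y).
Proof.
move=> ha; have [c c0 hc] := @riesz_kernel_strongly_convex R a ha.
exists c => // n l x y l01 Sx Sy; have /andP[l0 l1] := l01.
rewrite !energyE !mulr_sumr -big_split/= -sumrB; apply: ler_sum_nat => j /andP[_ jn].
rewrite !mulr_sumr -big_split/= -sumrB; apply: ler_sum_nat => i /andP[_ ij].
have ijn : (i < j <= n)%N by rewrite ij.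
have l01' : 0 <= l <= 1 by rewrite !ltW.
have := hc n.+1 l _ _ isT l01' (simplex_diff Sx ijn) (simplex_diff Sy ijn).
rewrite /convexity_gap !particle_conv.
rewrite (_ : l * particle x j + (1 - l) * particle y j -
  (l * particle x i + (1 - l) * particle y i) =
  l * (particle x j - particle x i) + (1 - l) * (particle y j - particle y i)); last by ring.
by apply: le_trans; rewrite !mulrA.
Qed.

Lemma energy_gap_ge0 a n l (x y : T n) : 0 < a < 1 ->
  0 < l < 1 -> simplex n.+1 x -> simplex n.+1 y ->
  energy a n.+1 (tuple_conv l x y) <= l * energy a n.+1 x + (1 - l) * energy a n.+1 y.
Proof.
move=> ha l01 Sx Sy; have [c c0 hc] := energy_gap ha.
rewrite -subr_ge0; apply: le_trans (hc n l x y l01 Sx Sy); have /andP[l0 l1] := l01.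
apply: mulr_ge0; first by apply: mulr_ge0; [exact: ltW|rewrite mulr_ge0 ?subr_ge0 ?ltW].
by apply: sumr_ge0 => j _; apply: sumr_ge0 => i _; rewrite mulr_ge0 ?sqr_ge0 ?powR_ge0.
Qed.

Lemma particle_rotate m (y : T m.+1) i : (i <= m)%N ->
  particle (tuple_rotate m.+2%:R y) i = particle y i.+1 - particle y 1.
Proof.
have e : thead y = particle y 1 :> R by rewrite /thead (tnth_nth 0).
case: i => [_|i im]; first by rewrite subrr.
rewrite /particle /= nth_rcons size_map size_behead size_tuple /= im.
by rewrite (nth_map 0) ?size_behead ?size_tuple// nth_behead e.
Qed.

Lemma particle_rotate_last m (y : T m.+1) :
  particle (tuple_rotate m.+2%:R y) m.+1 = m.+2%:R - particle y 1.
Proof.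
rewrite /particle /= nth_rcons size_map size_behead size_tuple /= ltnn eqxx.
by rewrite /thead (tnth_nth 0).
Qed.

Lemma simplex_rotate m (y : T m.+1) :
  simplex m.+2 (tuple_rotate m.+2%:R y) <-> simplex m.+2 y.
Proof.
split=> [|Sy].
  move=> /simplexP[h1 h2]; apply/simplexP.
  move: h2; rewrite particle_rotate_last ltrBlDr ltrDl => y1.
  split=> [[//|i] im|].
    have im' : (i < m)%N by [].
    have := h1 i (ltnW im); rewrite (particle_rotate y (ltnW im')) (particle_rotate y im').
    by rewrite ltrD2r.
  by have := h1 m (ltnSn _); rewrite particle_rotate// particle_rotate_last ltrD2r.
have /simplexP[h1 h2] := Sy; apply/simplexP; split=> [i|].
  rewrite ltnS leq_eqVlt => /predU1P[->|im].
    by rewrite particle_rotate// particle_rotate_last ltrD2r.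
  by rewrite !particle_rotate ?(ltnW im)// ltrD2r; exact: h1.
rewrite particle_rotate_last ltrBlDr ltrDl.
exact: (h1 0%N).
Qed.

(** Only the pairs containing the old origin change: it becomes the last particle, so their distance
    r becomes N - r, where the kernel takes the same value. *)
Lemma energy_rotate a m (y : T m.+1) : 0 < a < 1 ->
  energy a m.+2 (tuple_rotate m.+2%:R y) = energy a m.+2 y.
Proof.
move=> ha; rewrite !energyE.
rewrite [RHS]big_nat_recl// [X in X + _]big_geq// add0r.
under [RHS]eq_big_nat do rewrite big_nat_recl// subr0.
rewrite big_nat_recr//= addrC big_split/=; congr (_ + _).
  apply: eq_big_nat => i /andP[_ im].
  rewrite particle_rotate_last particle_rotate// -[RHS]riesz_kernel_reflect//.
  by congr riesz_kernel; ring.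
apply: eq_big_nat => j /andP[_ jm]; apply: eq_big_nat => i /andP[_ ij].
rewrite !particle_rotate//; first by congr riesz_kernel; ring.
exact: ltnW (leq_trans ij jm).
Qed.

End simplex.

(** * The Palm law as a normalised Boltzmann weight *)

Section palm_law.
Context {R : realType}.
Local Notation T n := (n.-tuple (measurableTypeR R)).
Local Notation mu := (@lebesgue_measure R).

Lemma lebesgue_box n (c : T n) b : 0 <= b ->
  measurable [set y : T n | forall i, `|(tnth y i : R) - tnth c i| <= b] /\
  lebesgue_tuple n [set y | forall i, `|(tnth y i : R) - tnth c i| <= b] = ((2 * b) ^+ n)%:E.
Proof.
move=> b0; elim: n c => [|n IH] c.
  rewrite (_ : [set y : T 0 | _] = setT).
    by rewrite /= diracE mem_set.
  by apply/seteqP; split=> // y _ [].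
have [mB IB] := IH [tuple of behead c].
set B := [set y | _] in mB IB.
pose J : set (measurableTypeR R) := `[thead c - b, thead c + b]%classic.
have mJ : measurable J by exact: measurable_itv.
have eB : [set y : T n.+1 | forall i, `|(tnth y i : R) - tnth c i| <= b] =
    (@tnth _ (measurableTypeR R))^~ ord0 @^-1` J `&` (fun y : T n.+1 => [tuple of behead y]) @^-1` B.
  apply/seteqP; split=> y /=.
    move=> h; split.
      by rewrite /J /= in_itv/= -ler_distlC distrC; exact: h.
    by move=> i; rewrite !tnth_behead; exact: h.
  move=> [h0 h] i; have [->|i0] := eqVneq i ord0.
    by move: h0; rewrite /J /= in_itv/= -ler_distlC distrC.
  have [j ->] : exists j, i = lift ord0 j.
    by have [j|] := unliftP ord0 i; [exists j|move/eqP: i0].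
  by have := h j; rewrite !(tnth_nth 0) /= !nth_behead.
have mE : measurable [set y : T n.+1 | forall i, `|(tnth y i : R) - tnth c i| <= b].
  rewrite eB; apply: measurableI.
    by rewrite -[X in measurable X]setTI; exact: (measurable_tnth _ measurableT).
  by rewrite -[X in measurable X]setTI; exact: (measurable_behead measurableT).
split=> //; rewrite eB /= /lebesgue_cons /pushforward.
rewrite (_ : _ @^-1` _ = B `*` J); last first.
  apply/seteqP; split=> -[s t] /=.
    move=> [h1 h2]; split=> //.
    by move: h2; rewrite (_ : [tuple of behead (tuple_cons (s, t))] = s)//; exact/val_inj.
  move=> [h1 h2]; split=> //.
  by rewrite (_ : [tuple of behead (tuple_cons (s, t))] = s)//; exact/val_inj.
rewrite product_measure1E//.
have I : mu J = (2 * b)%:E.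
  rewrite /J lebesgue_measure_itv/= lte_fin -EFinD.
  case: ifPn => [_|]; first by congr EFin; ring.
  rewrite -leNgt => bb; have -> : b = 0 by lra.
  by rewrite mulr0.
change (lebesgue_tuple n B * mu J = ((2 * b) ^+ n.+1)%:E)%E.
by rewrite IB I -EFinM exprSr.
Qed.

Context (a : R) (n : nat) (beta : R).
Hypothesis ha : 0 < a < 1.
Local Notation P := (palm_law a n.+1 beta).

Definition boltzmann (y : T n) : R := \1_(simplex n.+1) y * expR (- beta * energy a n.+1 y).

Lemma boltzmann_ge0 y : 0 <= boltzmann y.
Proof. by rewrite /boltzmann mulr_ge0 ?expR_ge0. Qed.

Lemma measurable_boltzmann : measurable_fun setT boltzmann.
Proof.
apply: measurable_funM; first by apply: measurable_indic; exact: (@measurable_simplex R n.+1).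
apply: (measurableT_comp (@measurable_expR R)).
by apply: measurable_funM => //; exact: (@measurable_energy R a n.+1).
Qed.

Lemma boltzmann_support y : boltzmann y != 0 -> simplex n.+1 y.
Proof.
move=> b0; apply: contrapT => Sy; move: b0.
by rewrite /boltzmann indicE memNset// mul0r eqxx.
Qed.

Lemma boltzmannE y : simplex n.+1 y -> boltzmann y = expR (- beta * energy a n.+1 y).
Proof. by move=> /mem_set Sy; rewrite /boltzmann indicE Sy mul1r. Qed.

Lemma indic_boltzmann_neq0 (A : set (T n)) y :
  \1_A y * boltzmann y != 0 -> A y /\ simplex n.+1 y.
Proof.
move=> b0; split.
  apply: contrapT => Ay; move: b0; by rewrite indicE memNset// mul0r eqxx.
by apply: boltzmann_support; apply: contra_neq b0 => ->; rewrite mulr0.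
Qed.

Lemma boltzmann_bounded : exists M m, [/\ 0 < M, 0 < m &
  forall y, boltzmann y <= M /\ (simplex n.+1 y -> m <= boltzmann y)].
Proof.
have [B B0 hB] := energy_bounded n ha.
exists (expR (`|beta| * B)), (expR (- (`|beta| * B))).
rewrite !expR_gt0; split=> // y.
have : `|- beta * energy a n.+1 y| <= `|beta| * B.
  by rewrite normrM normrN ler_wpM2l.
rewrite ler_norml => /andP[h1 h2]; split.
  rewrite /boltzmann; apply: (@le_trans _ _ (1 * expR (- beta * energy a n.+1 y))).
    by rewrite ler_wpM2r ?expR_ge0// indicE lern1 leq_b1.
  by rewrite mul1r ler_expR.
by move=> Sy; rewrite boltzmannE// ler_expR.
Qed.

Lemma bounded_support_boltzmann (k : R) (A : set (T n)) : 0 <= k -> measurable A ->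
  bounded_support (fun y => k * (\1_A y * boltzmann y)).
Proof.
move=> k0 mA; split.
  apply: measurable_funM => //; apply: measurable_funM; last exact: measurable_boltzmann.
  exact: measurable_indic.
have [M [m [M0 m0 h]]] := boltzmann_bounded.
exists (k * M), n.+1%:R; split=> //; first by rewrite mulr_ge0// ltW.
move=> y; split.
  apply/andP; split; first by rewrite mulr_ge0// mulr_ge0// boltzmann_ge0.
  rewrite ler_wpM2l//; apply: (@le_trans _ _ (1 * boltzmann y)).
    by rewrite ler_wpM2r ?boltzmann_ge0// indicE lern1 leq_b1.
  by rewrite mul1r; have [] := h y.
move=> y0; apply: simplex_cube; apply: boltzmann_support.
by apply: contra_neq y0 => ->; rewrite !mulr0.
Qed.

Definition palm_mass (A : set (T n)) : R :=
  \int[lebesgue_tuple n]_y (\1_A y * boltzmann y).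

Lemma integral_palm_mass (A : set (T n)) : measurable A ->
  (\int[lebesgue_tuple n]_y (\1_A y * boltzmann y)%:E)%E = (palm_mass A)%:E.
Proof.
move=> mA; rewrite -bounded_support_fin//.
have := bounded_support_boltzmann ler01 mA.
by under eq_fun do rewrite mul1r.
Qed.

Lemma palm_weightE (A : set (T n)) : measurable A ->
  palm_weight a n.+1 beta A = (palm_mass A)%:E.
Proof.
move=> mA; rewrite -integral_palm_mass// /palm_weight integral_mkcond.
apply: eq_integral => y _; rewrite patchE /boltzmann !indicE in_setI.
by case: (y \in A); case: (y \in simplex n.+1); rewrite /= ?mul1r ?mul0r.
Qed.

Lemma palm_mass_gt0 : 0 < palm_mass setT.
Proof.
have [M [m [M0 m0 h]]] := boltzmann_bounded.
(* The equispaced configuration: a box of radius 1/4 around it keeps the particles ordered, hence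
   lies in the simplex. *)
pose c : T n := [tuple (i.+1)%:R : R | i < n].
have b0 : (0 : R) <= 4^-1 by [].
have [mB IB] := lebesgue_box c b0.
set B := [set y | _] in mB IB.
have BS : B `<=` simplex n.+1.
  move=> y By; apply/simplexP.
  have hy i : (i < n.+1)%N -> `|particle y i - i%:R| <= 4^-1.
    case: i => [_|i]; first by rewrite particle0 subr0 normr0.
    rewrite ltnS => ni; have := By (Ordinal ni).
    by rewrite !(tnth_nth 0) /= (nth_mktuple _ _ (Ordinal ni)).
  split=> [i ni|].
    have := hy i (ltnW ni); have := hy i.+1 ni.
    by rewrite !ler_distl -[i.+1%:R]natr1 => /andP[? ?] /andP[? ?]; lra.
  have := hy n (ltnSn n).
  by rewrite ler_distl -[n.+1%:R]natr1 => /andP[? ?]; lra.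
rewrite -lte_fin -integral_palm_mass//.
apply: (@lt_le_trans _ _ (\int[lebesgue_tuple n]_y (m%:E * (\1_B y)%:E))%E).
  rewrite ge0_integralZl_EFin//; last 2 first.
  - by apply/measurable_EFinP; exact: measurable_indic.
  - exact: ltW.
  by rewrite integral_indic// setIT IB -EFinM lte_fin mulr_gt0// exprn_gt0.
apply: ge0_le_integral => //.
- by move=> y _; rewrite -EFinM lee_fin mulr_ge0// ltW.
- by apply/measurable_EFinP; apply: measurable_funM => //; exact: measurable_indic.
- apply/measurable_EFinP; apply: measurable_funM; last exact: measurable_boltzmann.
  exact: measurable_indic.
move=> y _; rewrite -EFinM lee_fin !indicE in_setT mul1r.
have [/set_mem By|_] := boolP (y \in B); last by rewrite mulr0 boltzmann_ge0.
by rewrite mulr1; have [_] := h y; apply; exact: BS.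
Qed.

Lemma palm_lawE (A : set (T n)) : measurable A ->
  P A = (palm_mass A / palm_mass setT)%:E.
Proof.
move=> mA; have Z0 := palm_mass_gt0.
have mT : measurable [set: T n] by exact: measurableT.
(* The total mass is positive and finite, so [mnormalize] does not fall back on its default
   measure. *)
rewrite -[LHS]/((let evidence := palm_weight a n.+1 beta setT in
  if (evidence == 0) || (evidence == +oo) then fun U => dirac point U
  else fun U => palm_weight a n.+1 beta U * (fine evidence)^-1%:E) A)%E.
by rewrite (palm_weightE mT)/= eqe gt_eqF//= (palm_weightE mA) -EFinM.
Qed.

Let indic_boltzmannE (A : set (T n)) y : A y -> simplex n.+1 y ->
  \1_A y * boltzmann y = expR (- beta * energy a n.+1 y).
Proof.
move=> Ay Sy; rewrite (boltzmannE Sy) indicE (mem_set Ay).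
by move: (expR _) => r; rewrite mul1r.
Qed.

Let expR_conv (l k u v w : R) : k <= beta * (l * u + (1 - l) * v - w) ->
  expR (- beta * u) `^ l * expR (- beta * v) `^ (1 - l) <= expR (- k) * expR (- beta * w).
Proof.
move=> kE; rewrite -!expRM -!expRD ler_expR.
by rewrite -subr_ge0; rewrite -subr_ge0 in kE; apply: le_trans kE _; lra.
Qed.

(** [k] records the gain from strong convexity. The value 0 yields log-concavity of gaps, and a
    positive value at l = 1/2 yields concentration. The normalising constant cancels because its
    exponents l and 1 - l add up to 1. *)
Lemma palm_law_prekopa_leindler (l k : R) (A B C : set (T n)) : 0 < l < 1 ->
  measurable A -> measurable B -> measurable C ->
  (forall x y, A x -> simplex n.+1 x -> B y -> simplex n.+1 y ->
    C (tuple_conv l x y) /\ k <= beta * (l * energy a n.+1 x + (1 - l) * energy a n.+1 y -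
      energy a n.+1 (tuple_conv l x y))) ->
  fine (P A) `^ l * fine (P B) `^ (1 - l) <= expR (- k) * fine (P C).
Proof.
move=> l01 mA mB mC ABC; have /andP[l0 l1] := l01.
have Z0 := palm_mass_gt0.
have m0 D : 0 <= palm_mass D.
  by apply: Rintegral_ge0 => y _; rewrite mulr_ge0// boltzmann_ge0.
rewrite !palm_lawE//= !powRM ?invr_ge0 ?(ltW Z0)//.
rewrite mulrACA -powRD ?subrKC ?oner_eq0// powRr1 ?invr_ge0 ?(ltW Z0)//.
rewrite mulrA ler_pM2r ?invr_gt0//.
have k0 := expR_ge0 (- k).
have bs D : measurable D -> bounded_support (fun y => \1_D y * boltzmann y).
  move=> mD; have := bounded_support_boltzmann ler01 mD.
  by under eq_fun do rewrite mul1r.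
have eC : (\int[lebesgue_tuple n]_y (expR (- k) * (\1_C y * boltzmann y)))%R =
    expR (- k) * palm_mass C.
  rewrite /palm_mass /Rintegral; under eq_integral do rewrite EFinM.
  rewrite ge0_integralZl_EFin//.
  - by rewrite integral_palm_mass.
  - by move=> y _; rewrite lee_fin mulr_ge0// boltzmann_ge0.
  - apply/measurable_EFinP; apply: measurable_funM; last exact: measurable_boltzmann.
    exact: measurable_indic.
rewrite -eC; apply: (prekopa_leindler l01 (bs _ mA) (bs _ mB) (bounded_support_boltzmann k0 mC)).
move=> x y.
have h0 : 0 <= expR (- k) * (\1_C (tuple_conv l x y) * boltzmann (tuple_conv l x y)).
  by rewrite mulr_ge0// mulr_ge0// boltzmann_ge0.
have l1' : 1 - l != 0 by rewrite gt_eqF// subr_gt0.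
have l0' : l != 0 by rewrite gt_eqF.
have [fx|/negP/negP fx] := eqVneq (\1_A x * boltzmann x) 0.
  by rewrite fx powR0// mul0r.
have [fy|/negP/negP fy] := eqVneq (\1_B y * boltzmann y) 0.
  by rewrite fy powR0// mulr0.
have [Ax Sx] := indic_boltzmann_neq0 fx; have [By Sy] := indic_boltzmann_neq0 fy.
have [Cxy kE] := ABC x y Ax Sx By Sy.
have Sxy := simplex_conv l01 Sx Sy.
rewrite (indic_boltzmannE Ax Sx) (indic_boltzmannE By Sy) (indic_boltzmannE Cxy Sxy).
exact: expR_conv.
Qed.

End palm_law.

(** * Rotation invariance, means and log-concavity *)

Section palm_law.
Context {R : realType}.
Local Notation T n := (n.-tuple (measurableTypeR R)).
Local Notation rot m := (@tuple_rotate R m.+2%:R m).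

Lemma palm_law_simplex (a : R) n (beta : R) (A : set (T n)) : 0 < a < 1 -> measurable A ->
  (forall y, simplex n.+1 y -> ~ A y) -> palm_law a n.+1 beta A = 0%E.
Proof.
move=> ha mA SA; rewrite palm_lawE// (_ : palm_mass a beta A = 0) ?mul0r//.
rewrite /palm_mass (_ : (fun y => _) = cst 0) ?Rintegral_cst ?mul0r//.
apply/funext => y /=; have [//|/(indic_boltzmann_neq0 )[Ay Sy]] := eqVneq (\1_A y * boltzmann a beta y) 0.
by have := SA y Sy.
Qed.

Lemma boltzmann_rotate (a : R) m (beta : R) (y : T m.+1) : 0 < a < 1 ->
  boltzmann a beta (rot m y) = boltzmann a beta y.
Proof.
move=> ha; rewrite /boltzmann (energy_rotate y ha) !indicE.
rewrite (_ : (rot m y \in simplex m.+2) = (y \in simplex m.+2))//.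
by apply/idP/idP => /set_mem/simplex_rotate/mem_set.
Qed.

Lemma palm_law_rotate (a : R) m (beta : R) (A : set (T m.+1)) : 0 < a < 1 -> measurable A ->
  palm_law a m.+2 beta (rot m @^-1` A) = palm_law a m.+2 beta A.
Proof.
move=> ha mA.
have mr := @measurable_tuple_rotate R m.+2%:R m.
have mrA : measurable (rot m @^-1` A).
  by rewrite -[X in measurable X]setTI; exact: mr.
rewrite !palm_lawE//; congr (_ / _)%:E; apply: EFin_inj; rewrite -!integral_palm_mass//.
have mf : measurable_fun setT (fun y : T m.+1 => (\1_A y * boltzmann a beta y)%:E : \bar R).
  apply/measurable_EFinP; apply: measurable_funM; last exact: measurable_boltzmann.
  exact: measurable_indic.
have f0 (y : T m.+1) : (0 <= (\1_A y * boltzmann a beta y)%:E)%E.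
  by rewrite lee_fin mulr_ge0// boltzmann_ge0.
rewrite -(integral_lebesgue_tuple_rotate m.+2%:R mf f0); apply: eq_integral => y _.
by rewrite (boltzmann_rotate _ y ha).
Qed.

(** Coordinates are unbounded on the ambient space; a bound on the simplex, which carries the law,
    is enough. *)
Lemma palm_law_integrable (a : R) n (beta : R) (X : T n -> R) (M : R) : 0 < a < 1 -> measurable_fun setT X ->
  (forall y, simplex n.+1 y -> `|X y| <= M) ->
  (palm_law a n.+1 beta).-integrable setT (EFin \o X).
Proof.
move=> ha mX XM; apply/integrableP; split; first exact/measurable_EFinP.
apply: (@le_lt_trans _ _ (\int[palm_law a n.+1 beta]_y `|M%:E|)%E); last first.
  by have /integrableP[] := finite_measure_integrable_cst (palm_law a n.+1 beta) M measurableT.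
apply: ae_ge0_le_integral => //.
- by apply: measurableT_comp => //; exact/measurable_EFinP.
exists (~` simplex n.+1); split.
- by apply: measurableC; exact: (@measurable_simplex R n.+1).
- apply: palm_law_simplex => //; last by move=> y Sy; apply.
  by apply: measurableC; exact: (@measurable_simplex R n.+1).
move=> y /=; apply: contra_not => Sy _; rewrite lee_fin.
exact: le_trans (XM y Sy) (ler_norm _).
Qed.

Lemma integral_palm_law_rotate (a : R) m (beta : R) (X : T m.+1 -> R) : 0 < a < 1 ->
  measurable_fun setT X -> (palm_law a m.+2 beta).-integrable setT (EFin \o X) ->
  (palm_law a m.+2 beta).-integrable setT (EFin \o (X \o rot m)) ->
  \int[palm_law a m.+2 beta]_y X (tuple_rotate m.+2%:R y) = \int[palm_law a m.+2 beta]_y X y.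
Proof.
move=> ha mX iX iXr; congr fine.
have mr := @measurable_tuple_rotate R m.+2%:R m.
transitivity (\int[pushforward (palm_law a m.+2 beta) (rot m)]_y (X y)%:E)%E.
  rewrite integral_pushforward//; exact/measurable_EFinP.
apply: eq_measure_integral => A mA _; exact: palm_law_rotate.
Qed.

Lemma palm_law_particle_integrable (a : R) n (beta : R) i : 0 < a < 1 -> (i <= n)%N ->
  (palm_law a n.+1 beta).-integrable setT (EFin \o (fun y : T n => particle y i)).
Proof.
move=> ha ni; apply: (@palm_law_integrable _ _ _ _ n.+1%:R) => //.
  exact: measurable_particle.
by move=> y Sy; have /andP[h1 h2] := simplex_particle Sy ni; rewrite ger0_norm// ltW.
Qed.

(** Rotation invariance makes the increments stationary: with e_j the mean of Y_j, it gives e_j =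
    e_(j+1) - e_1, so e_j = j e_1. Its last coordinate gives e_(N-1) = N - e_1, hence e_1 = 1. *)
Lemma palm_law_mean (a : R) n (beta : R) i : 0 < a < 1 -> (i <= n)%N ->
  \int[palm_law a n.+1 beta]_y particle y i = i%:R.
Proof.
move=> ha; case: n => [|m].
  rewrite leqn0 => /eqP ->; rewrite Rintegral_cst//= mul0r//.
pose P := palm_law a m.+2 beta; pose e j := \int[P]_y @particle R m.+1 y j.
have iP j := @palm_law_particle_integrable a m.+1 beta j ha.
have mP (j : nat) : measurable_fun setT (fun y : T m.+1 => particle y j).
  exact: measurable_particle.
have rot j : (j <= m.+1)%N -> \int[P]_y particle (tuple_rotate m.+2%:R y) j = e j.
  move=> jm; rewrite -[RHS](integral_palm_law_rotate ha (mP j)) //; first exact: iP.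
  apply: (@palm_law_integrable _ _ _ _ m.+2%:R) => //.
    apply: (measurableT_comp (mP j)); exact: measurable_tuple_rotate.
  move=> y /simplex_rotate Sy /=; have /andP[h1 h2] := simplex_particle Sy jm.
  by rewrite ger0_norm// ltW.
have rec j : (j <= m)%N -> e j.+1 = e j + e 1%N.
  move=> jm; rewrite -(rot j) ?leqW//.
  rewrite (_ : (fun y => _) = (fun y => particle y j.+1 - particle y 1)); last first.
    by apply/funext => y; rewrite particle_rotate.
  by rewrite RintegralB//= ?subrK//; exact: iP.
have last : e m.+1 = m.+2%:R - e 1%N.
  rewrite -rot//.
  rewrite (_ : (fun y => _) = (fun y => m.+2%:R - particle y 1)); last first.
    by apply/funext => y; rewrite particle_rotate_last.
  rewrite RintegralB//=; last exact: iP.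
    by rewrite Rintegral_cst//= probability_setT mulr1.
  by apply: (@palm_law_integrable _ _ _ _ m.+2%:R) => //= y _; rewrite ger0_norm.
have lin j : (j <= m.+1)%N -> e j = j%:R * e 1%N.
  elim: j => [_|j IH jm]; first by rewrite mul0r /e Rintegral_cst// mul0r.
  by rewrite rec// IH ?(ltnW jm)// -natr1; ring.
have e1 : e 1%N = 1.
  move: last; rewrite lin// => /eqP; rewrite -subr_eq0 => /eqP h.
  have : m.+2%:R * (e 1%N - 1) = 0 :> R by rewrite -natr1 -[X in _ = X]h -natr1; ring.
  by move=> /eqP; rewrite mulf_eq0 pnatr_eq0/= subr_eq0 => /eqP.
by move=> im; rewrite -[LHS]/(e i) lin// e1 mulr1.
Qed.

Lemma palm_law_log_concave (a : R) n (beta : R) i j : 0 < a < 1 -> 0 < beta ->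
  log_concave_law (palm_law a n.+1 beta) (fun y : T n => particle y j - particle y i).
Proof.
move=> ha b0 l I J K l01 mI mJ mK IJK.
have mX : measurable_fun setT (fun y : T n => particle y j - particle y i : measurableTypeR R).
  by apply: measurable_funB; exact: measurable_particle.
have mp (A : set (measurableTypeR R)) : measurable A ->
    measurable ((fun y : T n => particle y j - particle y i) @^-1` A).
  by move=> mA; rewrite -[X in measurable X]setTI; exact: mX.
have := @palm_law_prekopa_leindler R a n beta ha l 0 _ _ _ l01 (mp _ mI) (mp _ mJ) (mp _ mK).
rewrite oppr0 expR0 mul1r; apply => x y Ix Sx Jy Sy; split.
  rewrite /= !particle_conv.
  rewrite (_ : _ - _ = l * (particle x j - particle x i) + (1 - l) * (particle y j - particle y i)).
    exact: IJK.
  by ring.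
by rewrite mulr_ge0 ?(ltW b0)// subr_ge0 energy_gap_ge0.
Qed.

End palm_law.

(** * Variance *)

Section spread.
Context {R : realType}.

(** The inner sum is the change in the mean of x 0, ..., x (l - 1) when x l is added; the outer sum
    telescopes. *)
Lemma sum_diff_mean (x : nat -> R) i :
  \sum_(1 <= l < i.+1) \sum_(0 <= j < l) (x l - x j) / (l%:R * l.+1%:R) =
  (\sum_(0 <= j < i.+1) x j) / i.+1%:R - x 0%N.
Proof.
elim: i => [|i IH]; first by rewrite big_geq// big_nat1 divr1 subrr.
rewrite big_nat_recr//= IH -mulr_suml sumrB sumr_const_nat subn0.
rewrite [in RHS]big_nat_recr//= -[x i.+1 *+ _]mulr_natr -[i.+2%:R]natr1 -[i.+1%:R]natr1.
have i1 : i%:R + 1 != 0 :> R by rewrite natr1 pnatr_eq0.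
have i2 : i%:R + 1 + 1 != 0 :> R by rewrite !natr1 pnatr_eq0.
by field; rewrite i1 i2.
Qed.

(* The two summands are the increments of the means of the first and of the last
   [l + 1] values among [x 0, ..., x i]. *)
Lemma sum_diff_telescope (x : nat -> R) i :
  \sum_(1 <= l < i.+1) \sum_(0 <= j < l)
    ((x l - x j) + (x (i - j)%N - x (i - l)%N)) / (l%:R * l.+1%:R) = x i - x 0%N.
Proof.
have := sum_diff_mean (fun j => - x (i - j)%N) i.
have -> : \sum_(0 <= j < i.+1) - x (i - j)%N = - \sum_(0 <= j < i.+1) x j.
  rewrite sumrN big_nat_rev/= add0n; congr (- _); apply: eq_big_nat => j /andP[_ ji].
  by congr x; lia.
rewrite subn0 => h.
under eq_bigr do under eq_bigr do rewrite mulrDl.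
under eq_bigr do rewrite big_split.
rewrite big_split/= sum_diff_mean.
under [X in _ + X]eq_bigr do under eq_bigr do rewrite -[x (i - _)%N - _]opprB opprD.
rewrite (_ : x i - x 0%N = (\sum_(0 <= j < i.+1) x j) / i.+1%:R - x 0%N +
  ((- \sum_(0 <= j < i.+1) x j) / i.+1%:R - - x i)); last by field; rewrite addrC natr1 pnatr_eq0.
rewrite -h; congr (_ + _); apply: eq_bigr => l _; apply: eq_bigr => j _; congr (_ / _).
Qed.

(** Reversal of indices permutes the pairs below [i], so the reversed gaps of [sum_diff_telescope]
    contribute the same total as the direct ones. *)
Lemma sum_triangle_rev (F : nat -> nat -> R) i :
  \sum_(0 <= l < i.+1) \sum_(0 <= j < l) F (i - j)%N (i - l)%N =
  \sum_(0 <= l < i.+1) \sum_(0 <= j < l) F l j.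
Proof.
have tri (G : nat -> nat -> R) : \sum_(0 <= l < i.+1) \sum_(0 <= j < l) G l j =
    \sum_(l < i.+1) \sum_(j < i.+1 | (j < l)%N) G l j.
  rewrite big_mkord; apply: eq_bigr => l _; rewrite big_mkord.
  by rewrite (big_ord_widen i.+1 (G l))// ltnW.
rewrite !tri [LHS](exchange_big_dep xpredT)//= (reindex_inj rev_ord_inj)/=.
apply: eq_bigr => l _; rewrite (reindex_inj rev_ord_inj)/=.
apply: eq_big => [j|j _].
  by rewrite ltn_sub2lE// ltnS.
by congr F; rewrite subSS subKn// -ltnS.
Qed.

(* The additive constant 1 only makes [spread] positive when [i = 0]. *)
Definition spread (p : R) i (x : nat -> R) : R :=
  1 + \sum_(1 <= l < i.+1) \sum_(0 <= j < l)
    l%:R `^ p / (l%:R * l.+1%:R) ^+ 2 *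
    (1 + ((x l - x j) ^+ 2 + (x (i - j)%N - x (i - l)%N) ^+ 2) / l%:R ^+ 2).

Lemma spread_ge1 p i x : 1 <= spread p i x.
Proof.
rewrite lerDl; apply: sumr_ge0 => l _; apply: sumr_ge0 => j _.
apply: mulr_ge0; first by rewrite divr_ge0 ?powR_ge0// sqr_ge0.
by rewrite addr_ge0// divr_ge0 ?sqr_ge0// addr_ge0// sqr_ge0.
Qed.

(** Trades a power p <= 2 for a square at the scale [r], so that second moments of the gaps
    suffice. *)
Lemma powR_le_sq (p m r : R) : 0 < p <= 2 -> 0 <= m -> 0 < r ->
  m `^ p <= r `^ p * (1 + m ^+ 2 / r ^+ 2).
Proof.
move=> /andP[p0 p2] m0 r0.
have rp : 0 <= r `^ p by exact: powR_ge0.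
have d0 : 0 <= m ^+ 2 / r ^+ 2 by rewrite divr_ge0 ?sqr_ge0.
have [mr|rm] := leP m r.
  apply: (@le_trans _ _ (r `^ p)).
    by apply: (ge0_ler_powR (ltW p0)) => //; rewrite nnegrE ltW.
  by rewrite ler_peMr// lerDl.
have -> : m `^ p = r `^ p * (m / r) `^ p.
  by rewrite -powRM ?(ltW r0) ?divr_ge0 ?(ltW r0)// mulrC divfK// gt_eqF.
rewrite ler_wpM2l// -expr_div_n -powR_mulrn ?divr_ge0 ?(ltW r0)//.
apply: (@le_trans _ _ ((m / r) `^ 2%:R)); last by rewrite lerDr.
by apply: ler_powR => //; rewrite ler_pdivlMr// mul1r ltW.
Qed.

(* [2 t d e <= d^2 m + t^2 e^2 / m] with [m = M^(-p)], where [M^p] is bounded by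
   the squares of both gaps. *)
Lemma weighted_gap (p t r e u v : R) : 0 < p <= 2 -> 0 < r -> 0 < u -> 0 < v ->
  2 * t * ((u - v) * e) <= (u - v) ^+ 2 * Num.max u v `^ (- p) +
  t ^+ 2 * (r `^ p * e ^+ 2 * (1 + (u ^+ 2 + v ^+ 2) / r ^+ 2)).
Proof.
move=> hp r0 u0 v0; set M := Num.max u v.
have M0 : 0 < M by rewrite lt_max u0.
have MM : M ^+ 2 <= u ^+ 2 + v ^+ 2.
  by rewrite /M; case: (leP u v) => _; rewrite ?lerDr ?lerDl sqr_ge0.
have Mp0 : 0 < M `^ p by rewrite powR_gt0.
have h1 : M `^ p <= r `^ p * (1 + (u ^+ 2 + v ^+ 2) / r ^+ 2).
  apply: le_trans (powR_le_sq hp (ltW M0) r0) _.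
  by rewrite ler_wpM2l ?powR_ge0// lerD2l ler_wpM2r ?invr_ge0 ?sqr_ge0.
apply: (@le_trans _ _ ((u - v) ^+ 2 * M `^ (- p) + t ^+ 2 * (e ^+ 2 * M `^ p))).
  rewrite powRN -subr_ge0.
  rewrite (_ : _ - _ = (M `^ p)^-1 * ((u - v) - t * e * M `^ p) ^+ 2).
    by rewrite mulr_ge0 ?sqr_ge0// invr_ge0 ltW.
  by field; rewrite gt_eqF.
rewrite lerD2l ler_wpM2l ?sqr_ge0//.
apply: (@le_trans _ _ (e ^+ 2 * (r `^ p * (1 + (u ^+ 2 + v ^+ 2) / r ^+ 2)))).
  by rewrite ler_wpM2l ?sqr_ge0.
by rewrite mulrCA mulrA.
Qed.

(** Expand x i - y i by [sum_diff_telescope] and apply [weighted_gap] to each gap, with e = 1 / (l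
    (l + 1)) its telescoping coefficient and r = l its scale. The quadratic costs add up to at most
    the two spreads, and the convexity terms count each pair at most twice. *)
Lemma spread_bound (p : R) i (x y : nat -> R) : 0 < p <= 2 ->
  (forall j k, (j < k <= i)%N -> x j < x k) ->
  (forall j k, (j < k <= i)%N -> y j < y k) -> x 0%N = y 0%N ->
  (x i - y i) ^+ 2 <= 2 * (spread p i x + spread p i y) *
  \sum_(0 <= k < i.+1) \sum_(0 <= j < k) ((x k - x j) - (y k - y j)) ^+ 2 *
    Num.max (x k - x j) (y k - y j) `^ (- p).
Proof.
move=> hp hx hy xy0; set Q := spread p i x + spread p i y.
pose F k j := ((x k - x j) - (y k - y j)) ^+ 2 * Num.max (x k - x j) (y k - y j) `^ (- p).
rewrite -/(\sum_(0 <= k < i.+1) \sum_(0 <= j < k) F k j).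
set D := \sum_(0 <= k < i.+1) _.
have Q2 : 2 <= Q by have := spread_ge1 p i x; have := spread_ge1 p i y; rewrite /Q; lra.
have Q0 : 0 < Q by lra.
set S := x i - y i.
(* Cauchy-Schwarz in dual form: optimised at [t = S / Q]. *)
suff key t : 2 * t * S <= 2 * D + t ^+ 2 * Q.
  have := key (S / Q); rewrite (_ : 2 * (S / Q) * S = 2 * (S ^+ 2 / Q)); last by field; rewrite gt_eqF.
  rewrite (_ : (S / Q) ^+ 2 * Q = S ^+ 2 / Q); last by field; rewrite gt_eqF.
  move=> h; rewrite (_ : 2 * Q * D = 2 * D * Q); last by ring.
  by rewrite -ler_pdivrMr//; move: h; set w := _ / Q; lra.
pose z k := x k - y k.
have -> : S = z i - z 0%N by rewrite /z xy0 subrr subr0.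
rewrite -sum_diff_telescope mulr_sumr.
have DE : 2 * D = \sum_(1 <= l < i.+1) \sum_(0 <= j < l) (F l j + F (i - j)%N (i - l)%N).
  under eq_bigr do rewrite big_split.
  rewrite big_split/=.
  have e (G : nat -> nat -> R) : \sum_(1 <= l < i.+1) \sum_(0 <= j < l) G l j =
      \sum_(0 <= l < i.+1) \sum_(0 <= j < l) G l j.
    by rewrite [RHS]big_ltn// [X in X + _]big_geq// add0r.
  rewrite !e (sum_triangle_rev F) -/D; lra.
rewrite DE.
have QE : t ^+ 2 * \sum_(1 <= l < i.+1) \sum_(0 <= j < l)
    l%:R `^ p / (l%:R * l.+1%:R) ^+ 2 *
    ((1 + ((x l - x j) ^+ 2 + (y l - y j) ^+ 2) / l%:R ^+ 2) +
     (1 + ((x (i - j)%N - x (i - l)%N) ^+ 2 + (y (i - j)%N - y (i - l)%N) ^+ 2) / l%:R ^+ 2))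
   <= t ^+ 2 * Q.
  rewrite ler_wpM2l ?sqr_ge0// /Q /spread addrACA -big_split/=.
  apply: ler_wpDl => //; apply: ler_sum => l _; rewrite -big_split/=.
  by apply: ler_sum => j _; rewrite -mulrDr le_eqVlt; apply/orP; left; apply/eqP; congr (_ * _); ring.
apply: le_trans (lerD (lexx _) QE); rewrite mulr_sumr -big_split/=.
apply: ler_sum_nat => l /andP[l1 li]; rewrite !mulr_sumr -big_split/=.
apply: ler_sum_nat => j /andP[_ jl].
have l0 : 0 < l%:R :> R by rewrite ltr0n.
have a1 : 0 < x l - x j by rewrite subr_gt0 hx// jl -ltnS.
have a2 : 0 < y l - y j by rewrite subr_gt0 hy// jl -ltnS.
have ij : (i - l < i - j <= i)%N by lia.
have b1 : 0 < x (i - j)%N - x (i - l)%N by rewrite subr_gt0 hx.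
have b2 : 0 < y (i - j)%N - y (i - l)%N by rewrite subr_gt0 hy.
have := lerD (weighted_gap t (l%:R * l.+1%:R)^-1 hp l0 a1 a2)
  (weighted_gap t (l%:R * l.+1%:R)^-1 hp l0 b1 b2).
rewrite -/(F l j) -/(F (i - j)%N (i - l)%N).
set A := _ `^ _; set e := (_ * _)^-1; set f := _ ^- 2.
move: (F l j) (F (i - j)%N (i - l)%N) => f1 f2.
rewrite (_ : f = e ^+ 2); last by rewrite /f /e exprVn.
rewrite /z => h; rewrite -subr_ge0; rewrite -subr_ge0 in h; apply: le_trans h _.
by rewrite le_eqVlt; apply/orP; left; apply/eqP; ring.
Qed.

End spread.

(** * Markov's inequality, medians and variance *)

Section concentration.
Context d (T : measurableType d) {R : realType} (P : probability T R).

Lemma measurable_gt (f : T -> R) s : measurable_fun setT f -> measurable [set x | s < f x].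
Proof.
move=> mf; rewrite -[X in measurable X]setTI.
have h : measurable_fun setT (fun x => s < f x) by apply: measurable_fun_ltr.
exact: (h measurableT [set true]).
Qed.

Lemma markov_gt (f : T -> R) (s : R) : 0 <= s -> measurable_fun setT f -> (forall x, 0 <= f x) ->
  (s%:E * P [set x | (s < f x)%R] <= \int[P]_x (f x)%:E)%E.
Proof.
move=> s0 mf f0; have mA := measurable_gt s mf.
apply: (@le_trans _ _ (\int[P]_x (s%:E * (\1_[set x | (s < f x)%R] x)%:E))%E).
  rewrite ge0_integralZl_EFin//; last by apply/measurable_EFinP; exact: measurable_indic.
  by rewrite integral_indic// setIT.
apply: ge0_le_integral => //.
- by move=> x _; rewrite -EFinM lee_fin mulr_ge0.
- by apply/measurable_EFinP; apply: measurable_funM => //; exact: measurable_indic.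
- exact/measurable_EFinP.
move=> x _; rewrite -EFinM lee_fin indicE.
by have [/set_mem/ltW|_] := boolP (x \in _); rewrite ?mulr1 ?mulr0.
Qed.

(** [s] is the infimum of the points where the distribution function reaches 1/2. The margin [t]
    spares any continuity of that function; the concentration argument has such a margin to give. *)
Lemma near_median (X : T -> R) (u v : R) : measurable_fun setT X ->
  fine (P [set x | X x <= u]) < 2^-1 -> 2^-1 <= fine (P [set x | X x <= v]) ->
  exists s, forall t, 0 < t -> fine (P [set x | X x <= s - t]) < 2^-1 /\
    2^-1 <= fine (P [set x | X x <= s + t]).
Proof.
move=> mX Xu Xv; pose E := [set r | 2^-1 <= fine (P [set x | X x <= r])].
have mle r : measurable [set x | X x <= r].
  rewrite (_ : [set x | X x <= r] = ~` [set x | r < X x]); first exact/measurableC/measurable_gt.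
  apply/seteqP; split=> x /=; first by rewrite leNgt => /negP.
  by move=> /negP; rewrite -leNgt.
have mono r r' : r <= r' -> fine (P [set x | X x <= r]) <= fine (P [set x | X x <= r']).
  move=> rr; apply: fine_le; rewrite ?fin_num_measure//.
  by apply: le_measure; rewrite ?inE// => x /= /le_trans; exact.
have lbE : has_inf E.
  split; first by exists v.
  exists u => r Er; rewrite leNgt; apply/negP => /ltW/mono ru.
  by move: Er; rewrite /E /= leNgt (le_lt_trans ru Xu).
exists (inf E) => t t0; split.
  rewrite ltNge; apply/negP => h.
  have : inf E <= inf E - t by apply: ge_inf => //; have [] := lbE.
  by rewrite lerBrDr gerDl leNgt t0.
have [r Er rt] := inf_adherent t0 lbE.
by apply: (le_trans Er); apply: mono; exact: ltW.
Qed.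

(** Transfers a bound centred at a median to the mean: the cross term of the expansion integrates to
    0. *)
Lemma variance_le (X : T -> R) (m s : R) : measurable_fun setT X ->
  P.-integrable setT (EFin \o X) -> P.-integrable setT (EFin \o (fun x => (X x) ^+ 2)) ->
  \int[P]_x X x = m ->
  (\int[P]_x ((X x - m) ^+ 2)%:E <= \int[P]_x ((X x - s) ^+ 2)%:E)%E.
Proof.
move=> mX iX iX2 EX.
have ic (r : R) : P.-integrable setT (EFin \o (fun=> r)).
  exact: (finite_measure_integrable_cst P r measurableT).
have isq (r : R) : P.-integrable setT (EFin \o (fun x => (X x - r) ^+ 2)).
  rewrite (_ : _ \o _ = (fun x => ((X x) ^+ 2)%:E + ((- 2 * r) * X x + r ^+ 2)%:E)%E); last first.
    by apply/funext => x /=; rewrite -EFinD; congr EFin; ring.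
  apply: integrableD => //.
  rewrite (_ : (fun x => _) = (fun x => ((- 2 * r)%:E * (X x)%:E + (r ^+ 2)%:E)%E)); last first.
    by apply/funext => x.
  by apply: integrableD => //; [exact: (integrableZl _ _ iX)|exact: (ic (r ^+ 2))].
have e (r : R) : (\int[P]_x ((X x - r) ^+ 2)%:E)%E = (\int[P]_x ((X x - r) ^+ 2))%:E.
  by rewrite /Rintegral fineK//; apply: integrable_fin_num => //; exact: isq.
rewrite !e lee_fin.
have iXm : P.-integrable setT (EFin \o (fun x => (X x - m))).
  rewrite (_ : _ \o _ = (fun x => (X x)%:E - m%:E)%E); last by apply/funext.
  by apply: integrableB => //; exact: (ic m).
have i2 : P.-integrable setT (EFin \o (fun x => 2 * (m - s) * (X x - m))).
  rewrite (_ : _ \o _ = (fun x => (2 * (m - s))%:E * (X x - m)%:E)%E); last by apply/funext.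
  exact: (integrableZl _ _ iXm).
have E0 : \int[P]_x (2 * (m - s) * (X x - m)) = 0.
  rewrite RintegralZl// (RintegralB measurableT iX (ic m)).
  by rewrite EX Rintegral_cst//= probability_setT mulr1 subrr mulr0.
rewrite -[leLHS]addr0 -E0 -(RintegralD measurableT (isq m) i2).
apply: le_Rintegral => //.
- rewrite (_ : _ \o _ = (fun x => ((X x - m) ^+ 2)%:E + (2 * (m - s) * (X x - m))%:E)%E); last by apply/funext.
  by apply: integrableD => //; exact: isq.
move=> x _; rewrite -subr_ge0 (_ : _ - _ = (m - s) ^+ 2) ?sqr_ge0//; ring.
Qed.

End concentration.

(** * Moments of gaps and of the spread *)

Section palm_law.
Context {R : realType}.
Local Notation T n := (n.-tuple (measurableTypeR R)).

Lemma palm_law_simplex1 (a : R) n (beta : R) (A : set (T n)) : 0 < a < 1 -> measurable A ->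
  simplex n.+1 `<=` A -> palm_law a n.+1 beta A = 1%E.
Proof.
move=> ha mA SA; rewrite -[A]setCK probability_setC; last exact: measurableC.
by rewrite palm_law_simplex ?sube0//; [exact: measurableC|move=> y /SA Ay /(_ Ay)].
Qed.

(** The gap is nonnegative on the simplex with mean k - j <= l, so Markov's inequality at 4 l gives
    the probability 1/4 that Borell's lemma requires. The resulting bound does not depend on
    [beta]. *)
Lemma palm_law_gap_moment (a : R) n (beta : R) (l j k : nat) : 0 < a < 1 -> 0 < beta ->
  (j <= k <= n)%N -> (k - j <= l)%N -> (0 < l)%N ->
  (\int[palm_law a n.+1 beta]_y ((particle y k - particle y j) ^+ 2)%:E <=
   (192 / (ln 3) ^+ 2 * (4 * l%:R) ^+ 2)%:E)%E.
Proof.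
move=> ha b0 /andP[jk kn] jkl l0; set P := palm_law _ _ _.
have l0' : 0 < l%:R :> R by rewrite ltr0n.
pose X (y : T n) : R := particle y k - particle y j.
have mX : measurable_fun setT X by apply: measurable_funB; exact: measurable_particle.
apply: (@borell_moment2 _ _ _ P X (4 * l%:R) mX) => //.
- exact: palm_law_log_concave.
- by rewrite mulr_gt0.
have mA : measurable_fun setT (fun y => `|X y|) by exact: measurableT_comp.
have X0 y : simplex n.+1 y -> 0 <= X y.
  move=> Sy; rewrite /X subr_ge0; move: jk; rewrite leq_eqVlt => /predU1P[->//|jk].
  by rewrite ltW// (simplex_lt Sy)// jk.
have iP i : (i <= n)%N -> P.-integrable setT (EFin \o (fun y : T n => particle y i)).
  by move=> ni; exact: palm_law_particle_integrable.
have jn : (j <= n)%N by exact: leq_trans jk kn.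
have EX : (\int[P]_y `|X y|%:E)%E = (k - j)%:R%:E.
  transitivity (\int[P]_y (X y)%:E)%E.
    apply: ae_eq_integral => //; [exact/measurable_EFinP|exact/measurable_EFinP|].
    exists (~` simplex n.+1); split.
    - by apply: measurableC; exact: (@measurable_simplex R n.+1).
    - apply: palm_law_simplex => //; last by move=> y Sy; apply.
      by apply: measurableC; exact: (@measurable_simplex R n.+1).
    by move=> y /=; apply: contra_not => Sy _; rewrite ger0_norm// X0.
  rewrite -[LHS]fineK; last first.
    apply: integrable_fin_num => //.
    rewrite (_ : (fun y => _) = (fun y : T n => (particle y k)%:E - (particle y j)%:E)%E).
      by apply: integrableB => //; exact: iP.
    by apply/funext.
  congr EFin; rewrite -[LHS]/(\int[P]_y (particle y k - particle y j)).
  rewrite (RintegralB measurableT (iP _ kn) (iP _ jn)) !palm_law_mean//.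
  by rewrite natrB.
have s0 : 0 <= 4 * l%:R :> R by rewrite mulr_ge0.
have := markov_gt P s0 mA (fun y => normr_ge0 _).
rewrite EX -[P _]fineK ?fin_num_measure//; last exact: measurable_abs_gt.
rewrite -EFinM !lee_fin => h.
have kl : (k - j)%:R <= l%:R :> R by rewrite ler_nat.
rewrite -(ler_pM2l (_ : 0 < 4 * l%:R)) ?mulr_gt0//.
by apply: (le_trans h); rewrite mulrAC divff// mul1r.
Qed.

(** Gaps at scale l have second moments of order l^2, so every bracket in [spread] has bounded mean.
    The l pairs at scale l together weigh l^(3-a) / (l (l + 1))^2 <= l^(-1-a). The 16 is the square
    of the 4 in [palm_law_gap_moment]. *)
Lemma integral_spread (a : R) n (beta : R) i (K : R) : 0 < a < 1 -> 0 < beta ->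
  (i <= n)%N -> limn (series (fun k => (k%:R `^ (1 + a))^-1)) = K ->
  (\int[palm_law a n.+1 beta]_y (spread (2 - a) i (particle y))%:E <=
   (1 + (1 + 2 * (192 / (ln 3) ^+ 2 * 16)) * K)%:E)%E.
Proof.
move=> ha b0 ni KE; set P := palm_law _ _ _; set m2 := 192 / _ * 16.
have m20 : 0 <= m2.
  rewrite /m2; move: (192 : R) (16 : R) (ler0n R 192) (ler0n R 16) => u v u0 v0.
  by apply: mulr_ge0 => //; apply: divr_ge0 => //; exact: sqr_ge0.
have gm l j k : (j <= k <= n)%N -> (k - j <= l)%N -> (0 < l)%N ->
    (\int[P]_y ((particle y k - particle y j) ^+ 2)%:E <= (m2 * l%:R ^+ 2)%:E)%E.
  move=> jk d l0; apply: le_trans (palm_law_gap_moment ha b0 jk d l0) _.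
  by rewrite lee_fin exprMn mulrA le_eqVlt; apply/orP; left; apply/eqP; congr (_ * _ * _); ring.
move: m2 m20 gm => m2 m20 gm.
pose w l : R := l%:R `^ (2 - a) / (l%:R * l.+1%:R) ^+ 2.
have w0 l : 0 <= w l by rewrite divr_ge0 ?powR_ge0// sqr_ge0.
pose D j k (y : T n) : R := (particle y k - particle y j) ^+ 2.
have mD j k : measurable_fun setT (D j k).
  by apply: measurable_funX; apply: measurable_funB; exact: measurable_particle.
have D0 j k y : 0 <= D j k y by exact: sqr_ge0.
pose g l j (y : T n) : R := w l * (1 + (D j l y + D (i - l)%N (i - j)%N y) / l%:R ^+ 2).
have mg l j : measurable_fun setT (g l j).
  apply: measurable_funM => //; apply: measurable_funD => //.
  by apply: measurable_funM => //; exact: measurable_funD.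
have g0 l j y : 0 <= g l j y.
  by rewrite mulr_ge0// addr_ge0// divr_ge0 ?sqr_ge0// addr_ge0.
have Ig l j : (j < l <= i)%N -> (\int[P]_y (g l j y)%:E <= (w l * (1 + 2 * m2))%:E)%E.
  move=> /andP[jl li]; have l0 : (0 < l)%N by exact: leq_ltn_trans jl.
  have l2 : 0 < l%:R ^+ 2 :> R by rewrite exprn_gt0// ltr0n.
  have ID j' k' : (j' <= k' <= n)%N -> (k' - j' <= l)%N ->
      (\int[P]_y (D j' k' y)%:E <= (m2 * l%:R ^+ 2)%:E)%E.
    by move=> jk' d; exact: gm.
  rewrite /g; under eq_integral do rewrite EFinM.
  rewrite ge0_integralZl_EFin//; last 2 first.
  - by move=> y _; rewrite lee_fin addr_ge0// divr_ge0 ?sqr_ge0// addr_ge0.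
  - apply/measurable_EFinP; apply: measurable_funD => //.
    by apply: measurable_funM => //; exact: measurable_funD.
  rewrite [leRHS]EFinM; apply: lee_wpmul2l; first by rewrite lee_fin.
  under eq_integral do rewrite EFinD.
  rewrite ge0_integralD//; last 2 first.
  - by move=> y _; rewrite lee_fin divr_ge0 ?sqr_ge0// addr_ge0.
  - by apply/measurable_EFinP; apply: measurable_funM => //; exact: measurable_funD.
  rewrite EFinD; apply: leeD.
    by rewrite (integral_cst _ measurableT) -[X in (_ * X)%E]/(P setT) probability_setT mule1.
  under eq_integral do rewrite mulrC EFinM EFinD.
  rewrite ge0_integralZl_EFin//; last 2 first.
  - by move=> y _; rewrite -EFinD lee_fin addr_ge0.
  - by apply: emeasurable_funD; exact/measurable_EFinP.
  rewrite ge0_integralD//; last 4 first.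
  - by move=> y _; rewrite lee_fin.
  - exact/measurable_EFinP.
  - by move=> y _; rewrite lee_fin.
  - exact/measurable_EFinP.
  have -> : (2 * m2)%:E = ((l%:R ^+ 2)^-1%:E * (m2 * l%:R ^+ 2 + m2 * l%:R ^+ 2)%:E)%E.
    by rewrite -EFinM; congr EFin; field; rewrite gt_eqF// ltr0n.
  apply: lee_wpmul2l; first by rewrite lee_fin invr_ge0 ltW.
  by rewrite EFinD leeD//; apply: ID; lia.
pose r := [seq (l, j) | l <- index_iota 1 i.+1, j <- index_iota 0 l].
have qE y : spread (2 - a) i (particle y) = 1 + \sum_(p <- r) g p.1 p.2 y.
  by rewrite /spread /r big_allpairs_dep.
under eq_integral do rewrite qE EFinD.
rewrite ge0_integralD//; last 2 first.
- by move=> y _; rewrite lee_fin sumr_ge0.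
- by apply/measurable_EFinP; apply: measurable_sum.
rewrite EFinD; apply: leeD.
  by rewrite (integral_cst _ measurableT) -[X in (_ * X)%E]/(P setT) probability_setT mule1.
under eq_integral do rewrite -sumEFin.
rewrite ge0_integral_sum//; last 2 first.
- by move=> p; exact/measurable_EFinP.
- by move=> p y _; rewrite lee_fin.
rewrite /r big_allpairs_dep /=.
apply: (@le_trans _ _ (\sum_(1 <= l < i.+1) \sum_(0 <= j < l) (w l * (1 + 2 * m2))%:E)%E).
  rewrite big_nat [leRHS]big_nat; apply: lee_sum => l /andP[l1 li].
  rewrite big_nat [leRHS]big_nat; apply: lee_sum => j /andP[_ jl].
  by apply: Ig; rewrite jl -ltnS.
under eq_bigr do rewrite sumEFin sumr_const_nat subn0.
rewrite sumEFin lee_fin [leRHS]mulrC.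
apply: (@le_trans _ _ (\sum_(1 <= l < i.+1) (l%:R `^ (1 + a))^-1 * (1 + 2 * m2))).
  apply: ler_sum_nat => l /andP[l1 _]; rewrite -mulrnAl ler_wpM2r ?addr_ge0 ?mulr_ge0//.
  have l0 : 0 < l%:R :> R by rewrite ltr0n.
  have ln0 : l%:R != 0 :> R by rewrite gt_eqF.
  have e : l%:R `^ (2 - a) = l%:R `^ (- (1 + a)) * l%:R ^+ 3 :> R.
    rewrite -powR_mulrn ?(ltW l0)// -powRD ?ln0 ?implybT//; congr (_ `^ _); ring.
  rewrite /w -mulr_natr -powRN e.
  have -> (A u B : R) : A * u ^+ 3 * B * u = A * (u ^+ 4 * B) by ring.
  rewrite ler_piMr ?powR_ge0// ler_pdivrMr ?exprn_gt0 ?mulr_gt0 ?ltr0n// mul1r.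
  rewrite (_ : l%:R ^+ 4 = (l%:R * l%:R) ^+ 2); last by ring.
  by rewrite ler_sqr ?nnegrE ?mulr_ge0// ler_pM2l// ler_nat.
rewrite -mulr_suml ler_wpM2r ?addr_ge0 ?mulr_ge0// -KE.
have := cvg_riemann_series ha => cz.
have nd : nondecreasing_seq (series (fun k => ((k%:R : R) `^ (1 + a))^-1)).
  by apply: nondecreasing_series => k _ _; rewrite invr_ge0 powR_ge0.
apply: le_trans (nondecreasing_cvgn_le nd cz i.+1).
by rewrite /series /= [leRHS]big_ltn// lerDr invr_ge0 powR_ge0.
Qed.

End palm_law.

Section fine_probability.
Context d (T : measurableType d) {R : realType} (P : probability T R).

Lemma fine_probability_le (A B : set T) : measurable A -> measurable B -> A `<=` B ->
  fine (P A) <= fine (P B).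
Proof.
move=> mA mB AB; apply: fine_le; rewrite ?fin_num_measure//.
by apply: le_measure; rewrite ?inE.
Qed.

Lemma fine_probability_setU (A B : set T) : measurable A -> measurable B ->
  fine (P (A `|` B)) <= fine (P A) + fine (P B).
Proof.
move=> mA mB; rewrite -fineD ?fin_num_measure//; apply: fine_le.
- by rewrite fin_num_measure//; exact: measurableU.
- by rewrite fin_numD !fin_num_measure.
- exact: measureU2.
Qed.

Lemma fine_probability_setI (A B : set T) : measurable A -> measurable B ->
  fine (P A) <= fine (P (A `&` B)) + fine (P (~` B)).
Proof.
move=> mA mB; have mC := measurableC mB; have mI := measurableI _ _ mA mB.
apply: le_trans (fine_probability_setU mI mC).
apply: fine_probability_le => //; first exact: measurableU.
by move=> x Ax; have [Bx|Bx] := pselect (B x); [left|right].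
Qed.

Lemma measurable_le (X : T -> R) r : measurable_fun setT X -> measurable [set x | X x <= r].
Proof.
move=> mX; rewrite -[X in measurable X]setTI.
have h : measurable_fun setT (fun x => X x <= r) by apply: measurable_fun_ler.
exact: (h measurableT [set true]).
Qed.

Lemma measurable_ge (X : T -> R) r : measurable_fun setT X -> measurable [set x | r <= X x].
Proof.
move=> mX; rewrite -[X in measurable X]setTI.
have h : measurable_fun setT (fun x => r <= X x) by apply: measurable_fun_ler.
exact: (h measurableT [set true]).
Qed.

End fine_probability.

(** * Concentration around a median and variance *)

Section palm_law.
Context {R : realType}.
Local Notation T n := (n.-tuple (measurableTypeR R)).

Lemma energy_gap_spread (a : R) : 0 < a < 1 -> exists2 c : R, 0 < c &
  forall n i (x y : T n), (i <= n)%N -> simplex n.+1 x -> simplex n.+1 y ->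
  c * (particle x i - particle y i) ^+ 2 <=
  (spread (2 - a) i (particle x) + spread (2 - a) i (particle y)) *
  (2^-1 * energy a n.+1 x + (1 - 2^-1) * energy a n.+1 y - energy a n.+1 (tuple_conv 2^-1 x y)).
Proof.
move=> ha; have [c c0 hc] := energy_gap ha.
(* The 8 is 4 times 2: l (1 - l) = 1/4 at the midpoint, and the factor 2 of [spread_bound]. The
   pairs with an index above [i] are dropped, their contributions being nonnegative. *)
exists (c / 8); first by rewrite divr_gt0.
move=> n i x y ni Sx Sy; have /andP[a0 a1] := ha.
have l01 : 0 < (2^-1 : R) < 1 by rewrite invr_gt0 ltr0n /=; lra.
have p2 : 0 < 2 - a <= 2 by lra.
have inc (z : T n) : simplex n.+1 z -> forall j k, (j < k <= i)%N -> particle z j < particle z k.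
  move=> Sz j k /andP[jk ki]; apply: (simplex_lt Sz).
  by rewrite jk (leq_trans ki ni).
have := spread_bound p2 (inc x Sx) (inc y Sy) erefl.
set Q := spread _ _ _ + _; set S := (_ - _) ^+ 2; set D := \sum_(0 <= k < i.+1) _ => SQ.
have := hc n 2^-1 x y l01 Sx Sy; set D' := \sum_(0 <= j < n.+1) _; set G := _ - energy _ _ _ => DG.
have Q0 : 0 <= Q.
  by apply: addr_ge0; apply: le_trans (spread_ge1 _ _ _).
have DD : D <= D'.
  rewrite /D /D' (big_cat_nat (n := i.+1) (p := n.+1))//= opprB lerDl.
  apply: sumr_ge0 => j _; apply: sumr_ge0 => k _.
  by rewrite mulr_ge0 ?sqr_ge0// powR_ge0.
have h1 : S <= 2 * Q * D' by apply: (le_trans SQ); rewrite ler_wpM2l// mulr_ge0.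
have h2 : Q * (c * (2^-1 * (1 - 2^-1)) * D') <= Q * G by rewrite ler_wpM2l.
apply: le_trans h2.
rewrite (_ : Q * _ = c / 8 * (2 * Q * D')); last by field.
by rewrite ler_wpM2l// divr_ge0// ltW.
Qed.

(** On [Q] the two spreads add up to at most 2 K, so two configurations whose particles [i] differ
    by at least t have energy excess at least c t^2 / (2 K). The third set is the whole space, of
    probability 1; squaring removes the exponents 1/2. *)
Lemma palm_law_anticoncentration (a : R) n (beta t r K k : R) i c : 0 < a < 1 -> 0 < beta ->
  (i <= n)%N -> 0 < c -> 0 < t -> 0 < K ->
  (forall (x y : T n), simplex n.+1 x -> simplex n.+1 y ->
  c * (particle x i - particle y i) ^+ 2 <=
  (spread (2 - a) i (particle x) + spread (2 - a) i (particle y)) *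
  (2^-1 * energy a n.+1 x + (1 - 2^-1) * energy a n.+1 y - energy a n.+1 (tuple_conv 2^-1 x y))) ->
  k * (2 * K) <= beta * (c * t ^+ 2) ->
  let Q := [set y : T n | spread (2 - a) i (particle y) <= K] in
  measurable Q ->
  fine (palm_law a n.+1 beta ([set y | particle y i <= r] `&` Q)) *
  fine (palm_law a n.+1 beta ([set y | r + t <= particle y i] `&` Q)) <= expR (- (2 * k)).
Proof.
move=> ha b0 ni c0 t0 K0 hc kt Q mQ; set P := palm_law _ _ _.
have l01 : 0 < (2^-1 : R) < 1 by rewrite invr_gt0 ltr0n /=; lra.
set A := _ `&` Q; set B := _ `&` Q.
have mX : measurable_fun setT (fun y : T n => particle y i) by exact: measurable_particle.
have mA : measurable A by apply: measurableI => //; exact: measurable_le.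
have mB : measurable B by apply: measurableI => //; exact: measurable_ge.
have := @palm_law_prekopa_leindler R a n beta ha 2^-1 k A B setT l01 mA mB measurableT.
rewrite -/P probability_setT mulr1 => PL.
have {}PL : fine (P A) `^ 2^-1 * fine (P B) `^ (1 - 2^-1) <= expR (- k).
  apply: PL => x y [/= Ax Qx] Sx [/= By Qy] Sy; split=> //.
  have := hc x y Sx Sy; set G := _ - energy _ _ _; set Qxy := spread _ _ _ + _ => h.
  have G0 : 0 <= G by rewrite subr_ge0; apply: energy_gap_ge0.
  have Q2 : Qxy <= 2 * K by move: Qx Qy; rewrite /Q /Qxy /=; lra.
  have tX : t ^+ 2 <= (particle x i - particle y i) ^+ 2.
    rewrite -[leRHS]sqrrN opprB ler_sqr ?nnegrE ?(ltW t0)//; lra.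
  have h1 : c * t ^+ 2 <= 2 * K * G.
    apply: le_trans (le_trans _ h) _; first by rewrite ler_wpM2l ?(ltW c0).
    by rewrite ler_wpM2r.
  have h2 : beta * (c * t ^+ 2) <= beta * (2 * K * G) by rewrite ler_pM2l.
  have K2 : 0 < 2 * K by rewrite mulr_gt0.
  rewrite -(ler_pM2r K2); apply: (le_trans kt); apply: (le_trans h2).
  by rewrite le_eqVlt; apply/orP; left; apply/eqP; ring.
have e : 1 - 2^-1 = 2^-1 :> R by field.
rewrite e -powRM ?fine_ge0// in PL.
have pp : 0 <= fine (P A) * fine (P B) by rewrite mulr_ge0 ?fine_ge0.
have sq (u : R) : 0 <= u -> u = (u `^ 2^-1) ^+ 2.
  by move=> u0; rewrite -powR_mulrn ?powR_ge0// -powRrM mulVf// powRr1.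
rewrite (sq _ pp) (_ : - (2 * k) = 2%:R * - k); last by ring.
by rewrite expRM_natl ler_sqr ?nnegrE ?expR_ge0 ?powR_ge0.
Qed.

Lemma palm_law_deviation (a : R) : 0 < a < 1 -> exists2 C : R, 0 < C &
  forall n (beta : R) i, 0 < beta -> (i <= n)%N ->
  exists s, (palm_law a n.+1 beta
    [set y | (Num.sqrt (C / beta) < `|particle y i - s|)%R] <= (4^-1)%:E)%E.
Proof.
move=> ha; have [c c0 hc] := energy_gap_spread ha.
pose z : R := limn (series (fun k => (k%:R `^ (1 + a))^-1)).
pose K0 : R := 1 + (1 + 2 * (192 / (ln 3) ^+ 2 * 16)) * z.
(* By Markov's inequality the spread exceeds [K] with probability at most 1/16; the absolute value
   and the added 1 make [K] positive outright. *)
pose K := 16 * `|K0| + 1.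
have Kp : 0 < K by rewrite ltr_wpDl// mulr_ge0.
exists (32 * K / c); first by rewrite divr_gt0// mulr_gt0.
move=> n beta i b0 ni; set P := palm_law _ _ _.
pose X (y : T n) : R := particle y i.
have mX : measurable_fun setT X by exact: measurable_particle.
(* Chosen so that beta c t^2 = 8 K, which is k (2 K) for the gain k = 4. The deviation in the
   statement is 2 t, whence 32 = 4 times 8 in the witness. *)
pose t := Num.sqrt (8 * K / c / beta).
have t0 : 0 < t by rewrite sqrtr_gt0 !divr_gt0// mulr_gt0.
have t2 : Num.sqrt (32 * K / c / beta) = 2 * t.
  rewrite (_ : 32 * K / c / beta = 2 ^+ 2 * (8 * K / c / beta)); last by field; rewrite !gt_eqF.
  by rewrite sqrtrM ?sqr_ge0// sqrtr_sqr ger0_norm.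
rewrite t2.
pose q (y : T n) := spread (2 - a) i (particle y).
have mq : measurable_fun setT q.
  have mp k := @measurable_particle R n k.
  apply: measurable_funD => //; apply: measurable_sum => l; apply: measurable_sum => j.
  apply: measurable_funM => //; apply: measurable_funD => //; apply: measurable_funM => //.
  by apply: measurable_funD; apply: measurable_funX; exact: measurable_funB.
pose Q := [set y | q y <= K].
have mQ : measurable Q by exact: measurable_le.
have QC : fine (P (~` Q)) <= 16^-1.
  have eQ : ~` Q = [set y | K < q y].
    by apply/seteqP; split=> y /=; rewrite /Q /= ltNge => /negP.
  have := le_trans (markov_gt P (ltW Kp) mq (fun y => le_trans ler01 (spread_ge1 _ _ _)))
    (integral_spread ha b0 ni erefl).
  rewrite -/z -/K0 -eQ -[P _]fineK ?fin_num_measure//; last exact: measurableC.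
  rewrite -EFinM lee_fin; set p := fine _ => h.
  have p0 : 0 <= p by exact: fine_ge0.
  have h1 : K * p <= K / 16.
    by apply: (le_trans h); have := ler_norm K0; rewrite /K; lra.
  by move: h1; rewrite ler_pM2l.
(* The gain k = 4 gives e^(-8), which is at most 2^(-8). *)
have core r : fine (P ([set y | X y <= r] `&` Q)) *
    fine (P ([set y | r + t <= X y] `&` Q)) <= (2 ^+ 8)^-1.
  apply: (@le_trans _ _ (expR (- (2 * 4)))); last first.
    have e2 : 2 <= expR 1 :> R by have := expR_ge1Dx (1 : R); lra.
    rewrite (_ : - (2 * 4) = - (8%:R * 1)); last by ring.
    have e8 : (2 : R) ^+ 8 <= expR 1 ^+ 8 by rewrite lerXn2r ?nnegrE ?expR_ge0.
    by rewrite expRN expRM_natl lef_pV2// posrE exprn_gt0// expR_gt0.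
  apply: (@palm_law_anticoncentration a n beta t r K 4 i c ha b0 ni c0 t0 Kp _ _ mQ).
    by move=> x y; exact: hc.
  rewrite sqr_sqrtr ?divr_ge0 ?mulr_ge0 ?(ltW Kp) ?(ltW c0) ?(ltW b0)//.
  by rewrite le_eqVlt; apply/orP; left; apply/eqP; field; rewrite !gt_eqF.
have Xu : fine (P [set y | X y <= - 1]) < 2^-1.
  rewrite palm_law_simplex//=; first exact: measurable_le.
  by move=> y Sy; have /andP[h _] := simplex_particle Sy ni; apply/negP; rewrite -ltNge /X; lra.
have Xv : 2^-1 <= fine (P [set y | X y <= n.+1%:R]).
  rewrite palm_law_simplex1//=; first by lra.
    exact: measurable_le.
  by move=> y Sy; have /andP[_ h] := simplex_particle Sy ni; exact: ltW.
have [s /(_ t t0)[h1 h2]] := near_median mX Xu Xv.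
exists s.
have mle r : measurable [set y | X y <= r] by exact: measurable_le.
have mge r : measurable [set y | r <= X y] by exact: measurable_ge.
have mm : measurable [set y | 2 * t < `|X y - s|].
  by apply: measurable_gt; apply: measurableT_comp => //; exact: measurable_funB.
rewrite -[P _]fineK ?fin_num_measure// lee_fin.
(* One of the two events has probability at least 1/2 - 1/16 = 7/16, which forces the other below
   1/16 on [Q]. Adding 1/16 for the complement of [Q] leaves 1/8 on each side of the median, and 1/4
   in total. *)
have small (p p' : R) : 0 <= p -> 7 / 16 <= p' -> p' * p <= (2 ^+ 8)^-1 -> p <= 16^-1.
  move=> p0 h7 h; have := ler_wpM2r p0 h7; lra.
have up : fine (P [set y | s + 2 * t <= X y]) <= 8^-1.
  have := core (s + t); rewrite (_ : s + t + t = s + 2 * t); last by ring.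
  have i1 := fine_probability_setI P (mle (s + t)) mQ.
  have i2 := fine_probability_setI P (mge (s + 2 * t)) mQ.
  move=> /small; rewrite fine_ge0// => /(_ isT) h3; lra.
have down : fine (P [set y | X y <= s - 2 * t]) <= 8^-1.
  have := core (s - 2 * t); rewrite (_ : s - 2 * t + t = s - t); last by ring.
  have i1 := fine_probability_setI P (mge (s - t)) mQ.
  have i2 := fine_probability_setI P (mle (s - 2 * t)) mQ.
  have i3 : 2^-1 <= fine (P [set y | s - t <= X y]).
    apply: (@le_trans _ _ (fine (P (~` [set y | X y <= s - t])))).
      rewrite probability_setC// fineB ?fin_num_measure//=; lra.
    apply: fine_probability_le => //; first exact: measurableC.
    by move=> y /= /negP; rewrite -ltNge => /ltW.
  rewrite mulrC => /small; rewrite fine_ge0// => /(_ isT) h3; lra.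
apply: (@le_trans _ _ (fine (P ([set y | X y <= s - 2 * t] `|` [set y | s + 2 * t <= X y])))).
  apply: fine_probability_le => //; first exact: measurableU.
  move=> y /=; rewrite ltr_normr => /orP[h|h]; [right|left] => /=; rewrite /X in h *; lra.
apply: le_trans (fine_probability_setU P _ _) _ => //; lra.
Qed.

Lemma palm_law_particle_log_concave (a : R) n (beta s : R) i : 0 < a < 1 -> 0 < beta ->
  log_concave_law (palm_law a n.+1 beta) (fun y : T n => particle y i - s).
Proof.
move=> ha b0; apply: log_concave_law_shift.
rewrite (_ : (fun y : T n => _) = (fun y => particle y i - particle y 0)).
  exact: palm_law_log_concave.
by apply/funext => y; rewrite particle0 subr0.
Qed.

(** Borell's lemma is applied around the point [s] of [palm_law_deviation], since a shift preserves
    log-concavity; [variance_le] then recentres at the mean. *)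
Lemma palm_law_variance (a : R) : 0 < a < 1 -> exists2 C : R, 0 < C &
  forall n (beta : R) i, 0 < beta -> (i <= n)%N ->
  (\int[palm_law a n.+1 beta]_y ((particle y i - i%:R) ^+ 2)%:E <= (C / beta)%:E)%E.
Proof.
move=> ha; have [C C0 hC] := palm_law_deviation ha.
have ln3 : 0 < ln 3 :> R by rewrite ln_gt0// ltr1n.
have pos (u : R) : 0 < u -> 0 < u / (ln 3) ^+ 2 * C.
  by move=> u0; rewrite mulr_gt0// divr_gt0// exprn_gt0.
exists (192 / (ln 3) ^+ 2 * C); first by apply: pos; rewrite ltr0n.
move=> n beta i b0 ni; have [s hs] := hC n beta i b0 ni.
have Cb : 0 < C / beta by rewrite divr_gt0.
have mX : measurable_fun setT (fun y : T n => particle y i) by exact: measurable_particle.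
have := borell_moment2 (measurable_funB mX (measurable_cst s))
  (@palm_law_particle_log_concave a n beta s i ha b0) (_ : 0 < Num.sqrt (C / beta)) hs.
rewrite sqrtr_gt0 sqr_sqrtr ?(ltW Cb)// mulrA => /(_ Cb); apply: le_trans.
apply: variance_le => //; last exact: palm_law_mean.
  exact: palm_law_particle_integrable.
apply: (@palm_law_integrable _ _ _ _ _ (n.+1%:R ^+ 2)) => //; first exact: measurable_funX.
move=> y Sy; have /andP[h1 h2] := simplex_particle Sy ni.
by rewrite normrX ger0_norm// ler_sqr ?nnegrE// ltW.
Qed.

End palm_law.

Theorem theorem1p1 (R : realType) (a : R) (ha : 0 < a < 1) :
  exists C : R, 0 < C /\
    forall (N : nat) (beta : R) (i : nat),
      (2 <= N)%N -> 0 < beta -> (i < N)%N ->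
      let P := palm_law a N beta in
      let sigma : R := Num.sqrt (C / beta) in
      let kappa : R := ln 3 / 4 in
      [/\ ('E_P[fun y => particle y i] = (i%:R : R)%R%:E)%E,
          ('E_P[(fun y => `|particle y i - i%:R| ^+ 2)%R] <= (C / beta)%:E)%E,
          (forall t : R, 0 <= t ->
             (P [set y | (t < `|particle y i - i%:R|)%R]
                <= (2 * expR (- (kappa * t / sigma)))%:E)%E)
        & ('E_P[(fun y => expR (kappa * `|particle y i - i%:R| / (2 * sigma)))%R]
             <= 3%:E)%E ].
Proof.
have [C C0 hC] := palm_law_variance ha; exists C; split=> // -[//|n] beta i _ b0 ni P sigma kappa.
have Cb : 0 < C / beta by rewrite divr_gt0.
have s0 : 0 < sigma by rewrite sqrtr_gt0.
have s2 : sigma ^+ 2 = C / beta by rewrite sqr_sqrtr// ltW.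
have ss0 : 0 < 2 * sigma by rewrite mulr_gt0.
have mX : measurable_fun setT (fun y : n.-tuple (measurableTypeR R) => particle y i - i%:R).
  by apply: measurable_funB => //; exact: measurable_particle.
have lc := @palm_law_particle_log_concave R a n beta i%:R i ha b0.
have var := hC n beta i b0 ni.
(* Chebyshev's inequality at 2 sigma supplies the probability 1/4 for Borell's lemma centred at the
   mean. Using 2 sigma as its scale turns the rate ln 3 / 2 into kappa / sigma in the tail, and ln 3
   / 4 into kappa / (2 sigma) in the exponential moment. *)
have P4 : (P [set y | (2 * sigma < `|particle y i - i%:R|)%R] <= (4^-1)%:E)%E.
  rewrite (_ : [set y | _] = [set y | (2 * sigma) ^+ 2 < (particle y i - i%:R) ^+ 2]); last first.
    have e (z : R) : (2 * sigma < `|z|) = ((2 * sigma) ^+ 2 < z ^+ 2).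
      by rewrite -[in RHS](real_normK (num_real z)) ltr_sqr ?nnegrE ?(ltW ss0).
    by apply/seteqP; split=> y /=; rewrite e.
  have mX2 := measurable_funX 2 mX.
  have := le_trans (markov_gt P (sqr_ge0 (2 * sigma)) mX2 (fun y => sqr_ge0 _)) var.
  rewrite -[P _]fineK ?fin_num_measure//; last exact: measurable_gt.
  rewrite -EFinM !lee_fin -s2 exprMn => h.
  have : 0 < sigma ^+ 2 by rewrite exprn_gt0.
  by move=> /ler_pM2l <-; lra.
split.
- rewrite unlock -(@palm_law_mean R a n beta i ha ni) /Rintegral fineK//.
  by apply: integrable_fin_num => //; exact: palm_law_particle_integrable.
- rewrite unlock; under eq_integral do rewrite real_normK ?num_real//.
  exact: var.
- move=> t t0; have := borell_tail mX lc ss0 P4 t0.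
  rewrite (_ : ln 3 / 2 * (t / (2 * sigma)) = kappa * t / sigma)// /kappa.
  by field; rewrite gt_eqF.
- rewrite unlock; have := borell_exp mX lc ss0 P4.
  by under eq_integral do rewrite mulrA.
Qed.
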